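(* Let $X$ be a Hilbert space, $U$ a Banach space, and let $A$ generate an exponentially stable analytic semigroup $T=(T(t))_{t\ge0}$ on $X$. Let $(\gamma,q)\in[0,1)\times[0,\frac12)$ with $\gamma+q<1$. Then for every $B\in L(U,X_{-\gamma})$, the function $$W_q(x)=\int_0^\infty\big\|(-A)^qT(t)x\big\|^2\,dt,\qquad x\in X,$$ is a non-coercive $L^2$-ISS Lyapunov function for $\Sigma(A,B)$. If, additionally, $W_{\frac12}(x)=\int_0^\infty\|(-A)^{\frac12}T(t)x\|^2\,dt<\infty$ for all $x\in X$, then the assertion also holds for $q=\frac12$ and $\gamma<\frac12$, i.e. for every $\gamma<\frac12$ and every $B\in L(U,X_{-\gamma})$ the function $W_{\frac12}$ is a non-coercive $L^2$-ISS Lyapunov function for $\Sigma(A,B)$.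
   Context: ''Non-coercive'' means ''not necessarily coercive''. $L(X,Y)$ denotes the bounded linear operators from $X$ to $Y$. $\mathcal K_\infty$ is the set of continuous, strictly increasing $\theta:[0,\infty)\to[0,\infty)$ with $\theta(0)=0$, $\lim_{r\to\infty}\theta(r)=\infty$. $X_{-1}$ is the completion of $X$ with respect to $\|x\|_{X_{-1}}=\|(aI-A)^{-1}x\|_X$ for some $a$ in the resolvent set of $A$; $T$ extends uniquely to a strongly continuous semigroup $T_{-1}$ on $X_{-1}$, with generator $A_{-1}$ extending $A$, $D(A_{-1})=X$. Since $-A$ is sectorial and boundedly invertible, $(-A)^{-\alpha}$, $\alpha\in(0,1)$, is a bounded injective operator (Riesz--Dunford calculus) and $(-A)^\alpha$ denotes its inverse; $(-A)^0=I$. For $t>0$, $(-A)^\alpha T(t)$ is bounded on $X$. For $\alpha\in(0,1)$, $X_\alpha$ is $D((-A)^\alpha)$ with its graph norm. $X_0=X$. For $\alpha\in(0,1)$, $X_{-\alpha}$ is obtained by the same construction for the extended semigroup on $X_{-1}$ (i.e. $X_{-\alpha}=D((-A_{-1})^{1-\alpha})\subset X_{-1}$; up to equivalence of norms it is the completion of $X$ with respect to $\|(-A)^{-\alpha}x\|_X$). For $B\in L(U,X_{-1})$, $\Sigma(A,B)$ denotes the system $\dot x(t)=Ax(t)+Bu(t)$, $x(0)=x_0$, with mild solution $\phi(t,x_0,u)=T(t)x_0+\int_0^tT_{-1}(t-s)Bu(s)\,ds$ (integral in $X_{-1}$). $B$ is $C$-admissible if $\int_0^tT_{-1}(t-s)Bu(s)\,ds\in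 X$ for all $t\ge0$ and all $u\in C([0,t],U)$. $L^2$-ISS Lyapunov function for $\Sigma(A,B)$ (where $B$ is $C$-admissible): a continuous $V:X\to[0,\infty)$ such that there is $\alpha_2\in\mathcal K_\infty$ with $0<V(x)\le\alpha_2(\|x\|)$ for $x\ne0$, and there are $a_3,a_4>0$ with $\dot V_u(x):=\limsup_{h\to0^+}\frac1h\big(V(\phi(h,x,u))-V(x)\big)\le-a_3\|x\|^2+a_4\|u(0)\|_U^2$ for all $x\in X$ and all $u\in C([0,\infty),U)$. *)

(* Defs.v *)
(* All spaces are complex: normed modules over R[i], with R : realType. *)
From HB Require Import structures.
From mathcomp Require Import all_boot all_order all_algebra.
From mathcomp Require Import all_classical all_reals all_analysis.
From mathcomp Require Import complex.

Set Implicit Arguments.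
Unset Strict Implicit.
Unset Printing Implicit Defensive.
Import Order.TTheory GRing.Theory Num.Theory.
Import numFieldNormedType.Exports.
Local Open Scope classical_set_scope.
Local Open Scope ring_scope.
Local Open Scope complex_scope.

(* `|x| lives in R[i] (with zero imaginary part); nrm x is the same number in R. *)
Definition nrm (R : realType) (V : normedModType R[i]) (x : V) : R :=
  complex.Re `|x|.

Definition hilbert (R : realType) (X : completeNormedModType R[i]) : Prop :=
  exists ip : {dot X for @Num.conj R[i]}, forall x : X, `|x| ^+ 2 = ip x x.

Definition bounded_linear (R : realType) (V W : normedModType R[i])
    (f : V -> W) : Prop :=
  linear f /\ exists M : R, forall x, nrm (f x) <= M * nrm x.

(* A partially defined operator: only the values of [app] on [dom] matter. *)
Record unbop (V W : Type) := Unbop { dom : set V ; app :> V -> W }.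

(* The inverse, defined on the range, of an injective map. *)
Definition opinv (R : realType) (V W : normedModType R[i]) (f : V -> W) :
    unbop W V :=
  Unbop (range f) (fun y => xget 0 [set x | f x = y]).

Definition opN (R : realType) (V W : normedModType R[i]) (A : unbop V W) :
    unbop V W :=
  Unbop (dom A) (fun x => - A x).

(* Q = (lam I - A)^-1, everywhere defined and bounded *)
Definition is_resolvent (R : realType) (V : normedModType R[i])
    (A : unbop V V) (lam : R[i]) (Q : V -> V) : Prop :=
  [/\ bounded_linear Q,
      forall y, dom A (Q y) /\ lam *: Q y - A (Q y) = y
    & forall x, dom A x -> Q (lam *: x - A x) = x].

Definition resolvent_set (R : realType) (V : normedModType R[i])
    (A : unbop V V) : set R[i] :=
  [set lam | exists Q, is_resolvent A lam Q].

Definition resolvent (R : realType) (V : normedModType R[i])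
    (A : unbop V V) (lam : R[i]) : V -> V :=
  xget (fun=> 0) [set Q | is_resolvent A lam Q].

(* The values of T at negative times are irrelevant. *)
Definition C0_semigroup (R : realType) (V : normedModType R[i])
    (T : R -> V -> V) : Prop :=
  [/\ forall t, 0 <= t -> bounded_linear (T t),
      T 0 = id,
      forall s t, 0 <= s -> 0 <= t -> T (s + t) = T s \o T t
    & forall x, T t x @[t --> 0^'+] --> x].

Definition exp_stable (R : realType) (V : normedModType R[i])
    (T : R -> V -> V) : Prop :=
  exists M w : R, 0 < w /\
    forall t x, 0 <= t -> nrm (T t x) <= M * expR (- w * t) * nrm x.

Definition generator (R : realType) (V : normedModType R[i])
    (T : R -> V -> V) : unbop V V :=
  Unbop [set x | cvg ((h%:C)^-1 *: (T h x - x) @[h --> 0^'+])]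
        (fun x => lim ((h%:C)^-1 *: (T h x - x) @[h --> 0^'+])).

(* cis phi = e^(i phi) *)
Definition cis (R : realType) (phi : R) : R[i] := cos phi +i* sin phi.

Definition sector (R : realType) (theta : R) : set R[i] :=
  [set z | exists r phi : R, [/\ 0 < r, `|phi| < theta & z = r%:C * cis phi]].

Definition analytic_semigroup (R : realType) (V : normedModType R[i])
    (T : R -> V -> V) : Prop :=
  C0_semigroup T /\
  exists2 theta : R, 0 < theta <= pi / 2 &
  exists S : R[i] -> V -> V,
    [/\ forall t : R, 0 <= t -> S t%:C = T t,
        forall z, sector theta z -> bounded_linear (S z),
        forall z w, sector theta z -> sector theta w -> S (z + w) = S z \o S w,
        forall x z, sector theta z ->
          derivable ((fun w => S w x) : R[i]^o -> V) z 1
      & forall x,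
          S z x @[z --> within (sector theta) (nbhs (0 : R[i]^o))] --> x].

(* v is the Riemann integral of f over [a, b], a <= b: limit of the Riemann sums
   over tagged partitions p 0 <= xi 0 <= p 1 <= ... <= p n as the mesh tends to 0. *)
Definition is_rint (R : realType) (V : normedModType R[i]) (f : R -> V)
    (a b : R) (v : V) : Prop :=
  forall eps : R, 0 < eps -> exists2 delta : R, 0 < delta &
    forall (n : nat) (p xi : nat -> R),
      p 0%N = a -> p n = b ->
      (forall i, (i < n)%N ->
         p i <= xi i <= p i.+1 /\ p i.+1 - p i < delta) ->
      nrm (\sum_(i < n) (p i.+1 - p i)%:C *: f (xi i) - v) < eps.

Definition rint (R : realType) (V : normedModType R[i]) (f : R -> V)
    (a b : R) : V :=
  xget 0 [set v | is_rint f a b v].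

(* c = (theta, delta) is admissible for a sectorial, boundedly invertible B
   when the spectrum of B lies strictly inside the region
   {r e^(i phi) : r > delta, |phi| < theta}, with the sectorial resolvent
   bound |z| ||(z - B)^-1|| <= M for theta <= |arg z| <= pi. *)
Definition admissible_contour (R : realType) (V : normedModType R[i])
    (B : unbop V V) (c : R * R) : Prop :=
  [/\ 0 < c.1 < pi,
      0 < c.2,
      forall z : R[i], `|z| <= (c.2)%:C -> resolvent_set B z
    & exists M : R, forall r phi : R, 0 < r -> c.1 <= `|phi| <= pi ->
        resolvent_set B (r%:C * cis phi) /\
        forall x, r * nrm (resolvent B (r%:C * cis phi) x) <= M * nrm x].

(* By Cauchy's theorem the integral below does not depend on the choice. *)
Definition contour (R : realType) (V : normedModType R[i]) (B : unbop V V) :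
    R * R :=
  xget (0, 0) [set c | admissible_contour B c].

(* the principal power (r e^(i phi))^(-alpha), for r > 0 and |phi| < pi *)
Definition cpowN (R : realType) (alpha r phi : R) : R[i] :=
  (r `^ (- alpha))%:C * cis (- alpha * phi).

(* integral of z^(-alpha) (z - B)^-1 x along z = r e^(i phi), r from delta to oo *)
Definition ray_integral (R : realType) (V : normedModType R[i])
    (B : unbop V V) (alpha delta phi : R) (x : V) : V :=
  lim (rint (fun r => (cpowN alpha r phi * cis phi) *:
                      resolvent B (r%:C * cis phi) x) delta b @[b --> +oo]).

(* the same integral along z = delta e^(i phi), phi from - theta to theta *)
Definition arc_integral (R : realType) (V : normedModType R[i])
    (B : unbop V V) (alpha theta delta : R) (x : V) : V :=
  rint (fun phi => (cpowN alpha delta phi * ('i * delta%:C * cis phi)) *: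
                   resolvent B (delta%:C * cis phi) x) (- theta) theta.

(* B^(-alpha), for 0 < alpha < 1: 1/(2 pi i) times the integral of
   z^(-alpha) (z - B)^-1 along the contour running from oo e^(i theta) down to
   delta e^(i theta), along the arc to delta e^(- i theta), and out to
   oo e^(- i theta); the spectrum is on its left. *)
Definition negpow (R : realType) (V : normedModType R[i])
    (B : unbop V V) (alpha : R) (x : V) : V :=
  let: (theta, delta) := contour B in
  (2 * pi%:C * 'i)^-1 *:
    (ray_integral B alpha delta (- theta) x
     - arc_integral B alpha theta delta x
     - ray_integral B alpha delta theta x).

(* B^alpha for 0 <= alpha < 1 *)
Definition fracpow (R : realType) (V : normedModType R[i])
    (B : unbop V V) (alpha : R) : unbop V V :=
  if alpha == 0 then Unbop setT id else opinv (negpow B alpha).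

(* (Y, iota) is the completion of X for the norm ||(a - A)^-1 x|| *)
Definition is_extrapolation_space (R : realType)
    (X Y : completeNormedModType R[i]) (A : unbop X X) (a : R[i])
    (iota : X -> Y) : Prop :=
  [/\ linear iota,
      forall x, nrm (iota x) = nrm (resolvent A a x)
    & dense (range iota)].

(* T_{-1}: the bounded extension of T to the extrapolation space *)
Definition extrap_semigroup (R : realType) (X Y : normedModType R[i])
    (T : R -> X -> X) (iota : X -> Y) (t : R) : Y -> Y :=
  xget (fun=> 0)
    [set S | bounded_linear S /\ forall x, S (iota x) = iota (T t x)].

(* (- A_{-1})^alpha, for 0 <= alpha < 1 *)
Definition extrap_fracpow (R : realType) (X Y : normedModType R[i])
    (T : R -> X -> X) (iota : X -> Y) (alpha : R) : unbop Y Y :=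
  fracpow (opN (generator (extrap_semigroup T iota))) alpha.

(* X_{-gamma}, for 0 <= gamma < 1, as a subspace of X_{-1} with its own norm:
   X itself for gamma = 0, and D((- A_{-1})^(1 - gamma)) with the graph norm
   otherwise. *)
Definition Xneg (R : realType) (X Y : normedModType R[i])
    (T : R -> X -> X) (iota : X -> Y) (gamma : R) : set Y :=
  if gamma == 0 then range iota else dom (extrap_fracpow T iota (1 - gamma)).

Definition Xneg_norm (R : realType) (X Y : normedModType R[i])
    (T : R -> X -> X) (iota : X -> Y) (gamma : R) (y : Y) : R :=
  if gamma == 0 then nrm (opinv iota y)
  else nrm y + nrm (extrap_fracpow T iota (1 - gamma) y).

(* B belongs to L(U, X_{-gamma}) *)
Definition bounded_into_Xneg (R : realType) (X Y U : normedModType R[i])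
    (T : R -> X -> X) (iota : X -> Y) (gamma : R) (B : U -> Y) : Prop :=
  [/\ linear B,
      forall u, Xneg T iota gamma (B u)
    & exists M : R, forall u, Xneg_norm T iota gamma (B u) <= M * nrm u].

Definition C_admissible (R : realType) (X Y U : normedModType R[i])
    (T : R -> X -> X) (iota : X -> Y) (B : U -> Y) : Prop :=
  forall (t : R) (u : R -> U), 0 <= t -> {within `[0, t], continuous u} ->
    exists x : X,
      is_rint (fun s => extrap_semigroup T iota (t - s) (B (u s))) 0 t (iota x).

(* The mild solution; the integral is taken in X_{-1} and, when B is
   C-admissible, lies in (the copy of) X. *)
Definition mild_solution (R : realType) (X Y U : normedModType R[i])
    (T : R -> X -> X) (iota : X -> Y) (B : U -> Y)
    (t : R) (x0 : X) (u : R -> U) : X :=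
  T t x0 + opinv iota
    (rint (fun s => extrap_semigroup T iota (t - s) (B (u s))) 0 t).

Definition class_Kinfty (R : realType) (f : R -> R) : Prop :=
  [/\ {within `[0, +oo[, continuous f},
      forall r s, 0 <= r -> r < s -> f r < f s,
      f 0 = 0
    & f r @[r --> +oo] --> +oo].

Definition L2_ISS_Lyapunov (R : realType) (X Y U : normedModType R[i])
    (T : R -> X -> X) (iota : X -> Y) (B : U -> Y) (V : X -> R) : Prop :=
  [/\ C_admissible T iota B,
      continuous V,
      forall x, 0 <= V x,
      exists2 alpha2 : R -> R, class_Kinfty alpha2 &
        forall x, x != 0 -> 0 < V x <= alpha2 (nrm x)
    & exists a3 a4 : R, [/\ 0 < a3, 0 < a4 &
        forall (x : X) (u : R -> U), {within `[0, +oo[, continuous u} ->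
          (limf_esup (fun h : R =>
              (h^-1 * (V (mild_solution T iota B h x u) - V x))%:E) 0^'+
           <= (- a3 * nrm x ^+ 2 + a4 * nrm (u 0) ^+ 2)%:E)%E]].

(* W_q(x), possibly +oo; T(0)x need not lie in the domain, hence t > 0 *)
Definition W (R : realType) (X : normedModType R[i]) (T : R -> X -> X)
    (q : R) (x : X) : \bar R :=
  (\int[lebesgue_measure]_(t in `]0%R, +oo[)
     ((nrm (fracpow (opN (generator T)) q (T t x))) ^+ 2)%:E)%E.

(* Main.v *)
(* On a Hilbert space norms are attained by functionals, so vector integrals can be
   handled weakly. Deforming the contour gives (-A)^(-q) x = c_q J_{1-q} x with
   J_p x the integral of s^(-p) T(s) x, and J_q J_{1-q} = c A^-1. Cauchy estimates give
   |A T(t)| <= C/t e^(-wt), whence P(t) = (-A)^q T(t) = c J_q A T(t) satisfies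
   |P(t)| <= C t^(-q) e^(-wt). Since a - A extends to an isometry X -> X_{-1}, one also
   gets T_{-1}(t) B = K(t) with |K(t)| <= C t^(-gamma) e^(-wt), so that
   |P(s) K(t)| <= C (s+t)^(-q-gamma) e^(-w(s+t)). Hence, for the input part psi of the
   mild solution, the integral over t of |P(t) psi| is at most C h sup |u|, and with
   H the integral of |P(t) x|^2 over (0, h] expanding the square gives
   W(phi(h,x,u)) <= W(x) - H/2 + C h sup |u|^2, while H/h >= c |x|^2 - o(1). *)
Require Import Defs.
From HB Require Import structures.
From mathcomp Require Import all_boot all_order all_algebra.
From mathcomp Require Import all_classical all_reals all_analysis.
From mathcomp Require Import complex.
From mathcomp Require Import measurable_realfun ring lra.

Set Implicit Arguments.
Unset Strict Implicit.
Unset Printing Implicit Defensive.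
Import Order.TTheory GRing.Theory Num.Theory.
Import numFieldNormedType.Exports.
Local Open Scope classical_set_scope.
Local Open Scope ring_scope.
Local Open Scope complex_scope.
Import Normc.

(** The definition of [negpow] leaves its contour to a choice, so only admissibility is known of it;
    hence an arbitrary admissible contour is pushed onto the two sides of the negative half-line.
    Rays and arcs are coordinate lines in polar coordinates, where z^(-al) is a function of (r, phi)
    for phi from - pi to pi, so that no branch of the logarithm enters and Cauchy's theorem becomes
    Green's formula on a rectangle. Of the constants c_q it only matters that they are nonzero.

    Both kernels factor through the semigroup, so P(t) K(r) depends on t + r alone and the two
    singularities merge into (t + r)^(-(q + gamma)), integrable at 0 because q + gamma < 1. The
    square of this power need not be integrable; when |P(t) psi|^2 is integrated, one factor is
    bounded uniformly in t and only the other by h t^(-(q + gamma)). For q = 1/2 the bound on P no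
    longer yields finiteness of W, and continuity has to come from uniform boundedness. *)

Section nrm_theory.
Context {R : realType}.
Implicit Types V W : normedModType R[i].

Lemma nrmE V (x : V) : `|x| = (nrm x)%:C.
Proof. by rewrite /nrm RRe_real// ger0_real. Qed.

Lemma nrm_ge0 V (x : V) : 0 <= nrm x.
Proof. by rewrite -ler0c -nrmE. Qed.

Lemma nrm0 V : nrm (0 : V) = 0.
Proof. by rewrite /nrm normr0. Qed.

Lemma nrm0_eq0 V (x : V) : nrm x = 0 -> x = 0.
Proof. by move=> h; apply/normr0_eq0; rewrite nrmE h. Qed.

Lemma nrm_gt0 V (x : V) : x != 0 -> 0 < nrm x.
Proof.
move=> x0; rewrite lt_neqAle nrm_ge0 andbT eq_sym.
by apply: contra_neq x0; exact: nrm0_eq0.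
Qed.

Lemma nrmN V (x : V) : nrm (- x) = nrm x.
Proof. by rewrite /nrm normrN. Qed.

Lemma nrmB V (x y : V) : nrm (x - y) = nrm (y - x).
Proof. by rewrite /nrm distrC. Qed.

Lemma nrmD V (x y : V) : nrm (x + y) <= nrm x + nrm y.
Proof. by rewrite -lecR rmorphD/= -!nrmE ler_normD. Qed.

Lemma nrmBD V (x y : V) : nrm (x - y) <= nrm x + nrm y.
Proof. by rewrite -(nrmN y) nrmD. Qed.

Lemma nrm_tri V (y x z : V) : nrm (x - z) <= nrm (x - y) + nrm (y - z).
Proof. by rewrite -[x - z](subrKA y) nrmD. Qed.

Lemma nrm_sub_le V (x y : V) : `|nrm x - nrm y| <= nrm (x - y).
Proof.
have h (u v : V) : nrm u - nrm v <= nrm (u - v).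
  by rewrite lerBlDr -{1}(subrK v u) nrmD.
by rewrite ler_norml h andbT lerNl opprB nrmB h.
Qed.

Lemma nrmZ V (c : R[i]) (x : V) : nrm (c *: x) = normc c * nrm x.
Proof.
apply: (@complexI R); rewrite rmorphM/= -!nrmE normrZ normc_def.
by case: c.
Qed.

Lemma normcR (r : R) : normc r%:C = `|r|.
Proof. by rewrite /normc/= expr0n/= addr0 sqrtr_sqr. Qed.

Lemma nrmZr V (r : R) (x : V) : nrm (r%:C *: x) = `|r| * nrm x.
Proof. by rewrite nrmZ normcR. Qed.

Lemma normc_ge0 (c : R[i]) : 0 <= normc c.
Proof. by case: c => a b; exact: sqrtr_ge0. Qed.

(** Balls have radii in [R[i]]; a positive element there is real, so real radii suffice. *)
Lemma cvg_nrmP V {T : Type} {F : set_system T} {FF : Filter F} (f : T -> V) (l : V) :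
  f @ F --> l <-> forall e : R, 0 < e -> \forall t \near F, nrm (l - f t) < e.
Proof.
split=> [/cvgrPdist_lt h e e0|h].
  have e0' : 0 < e%:C by rewrite ltcR.
  by apply: filterS (h _ e0') => t; rewrite nrmE ltcR.
apply/cvgrPdist_lt => e e0.
have er : e = (complex.Re e)%:C by rewrite RRe_real// gtr0_real.
move: e0; rewrite er ltcR => /h.
by apply: filterS => t; rewrite nrmE ltcR.
Qed.

Lemma cvg_nrm V {T : Type} {F : set_system T} {FF : Filter F} (f : T -> V) (l : V) :
  f @ F --> l -> nrm (f t) @[t --> F] --> nrm l.
Proof.
move=> /cvg_nrmP fl; apply/cvgrPdist_lt => e e0.
apply: filterS (fl _ e0) => t; apply: le_lt_trans; exact: nrm_sub_le.
Qed.

Lemma cauchy_seq_nrm (V : completeNormedModType R[i]) (f : nat -> V) :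
  (forall e : R, 0 < e -> exists N, forall m n, (N <= m)%N -> (N <= n)%N ->
     nrm (f m - f n) < e) -> cvg (f @ \oo).
Proof.
move=> h; apply/cauchy_cvgP/cauchyP => e e0.
have er : e = (complex.Re e)%:C by rewrite RRe_real// gtr0_real.
move: e0; rewrite er ltcR => /h[N hN].
exists (f N); exists N => // n /= Nn.
by rewrite -ball_normE/= nrmE ltcR hN.
Qed.

End nrm_theory.

(** * Functionals that attain norms *)

Section functionals.
Context {R : realType}.
Implicit Types V W : normedModType R[i].

(** Real-valued and only real-linear, so that [l \o f] is a real function to which Lebesgue
    integration applies; complex scalars are handled by [rfun_scale]. *)
Definition rfun V (l : V -> R) : Prop :=
  [/\ forall x y, l (x + y) = l x + l y,
      forall (a : R) x, l (a%:C *: x) = a * l x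
    & exists M : R, forall x, `|l x| <= M * nrm x].

(* The conclusion of Hahn-Banach; on a Hilbert space the inner product provides it. *)
Definition norming V : Prop := forall x : V, exists l : V -> R,
  [/\ rfun l, forall y, `|l y| <= nrm y & l x = nrm x].

Lemma rfun0 V (l : V -> R) : rfun l -> l 0 = 0.
Proof. by case=> _ lZ _; rewrite -(scale0r (0 : V)) lZ mul0r. Qed.

Lemma rfunN V (l : V -> R) x : rfun l -> l (- x) = - l x.
Proof.
by case=> _ lZ _; rewrite -scaleN1r -[-1]/(- (1%:C)) -rmorphN/= lZ mulN1r.
Qed.

Lemma rfunB V (l : V -> R) x y : rfun l -> l (x - y) = l x - l y.
Proof. by move=> hl; rewrite -(rfunN _ hl); case: hl => ->. Qed.

Lemma rfun_sum V (l : V -> R) n (f : 'I_n -> V) : rfun l ->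
  l (\sum_(i < n) f i) = \sum_(i < n) l (f i).
Proof.
move=> hl; elim/big_ind2 : _ => //; first exact: rfun0.
by move=> x a y b <- <-; case: hl => ->.
Qed.

Lemma bl_add V W (L : V -> W) x y : bounded_linear L -> L (x + y) = L x + L y.
Proof. by case=> h _; have := h 1 x y; rewrite !scale1r. Qed.

Lemma bl0 V W (L : V -> W) : bounded_linear L -> L 0 = 0.
Proof.
by case=> h _; have := h (-1) 0 0; rewrite !scaleN1r oppr0 addr0 addNr => <-.
Qed.

Lemma blZ V W (L : V -> W) c x : bounded_linear L -> L (c *: x) = c *: L x.
Proof. by move=> hL; have [h _] := hL; have := h c x 0; rewrite (bl0 hL) !addr0. Qed.

Lemma blN V W (L : V -> W) x : bounded_linear L -> L (- x) = - L x.
Proof. by move=> hL; rewrite -scaleN1r (blZ _ _ hL) scaleN1r. Qed.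

Lemma blB V W (L : V -> W) x y : bounded_linear L -> L (x - y) = L x - L y.
Proof. by move=> hL; rewrite (bl_add _ _ hL) (blN _ hL). Qed.

Lemma bl_bound V W (L : V -> W) : bounded_linear L ->
  exists2 M : R, 0 < M & forall x, nrm (L x) <= M * nrm x.
Proof.
case=> _ [M hM]; exists (`|M| + 1); first by rewrite ltr_wpDl.
move=> x; rewrite (le_trans (hM x))// ler_wpM2r ?nrm_ge0//.
by rewrite (le_trans (ler_norm M))// lerDl.
Qed.

Lemma rfun_comp V W (L : V -> W) (l : W -> R) :
  bounded_linear L -> rfun l -> rfun (l \o L).
Proof.
move=> hL [lD lZ [M hM]]; have [K K0 hK] := bl_bound hL; split.
- by move=> x y /=; rewrite (bl_add _ _ hL) lD.
- by move=> a x /=; rewrite (blZ _ _ hL) lZ.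
- exists (`|M| * K) => x /=; rewrite (le_trans (hM _))//.
  rewrite -mulrA (@le_trans _ _ (`|M| * nrm (L x)))//.
    by rewrite ler_wpM2r ?nrm_ge0// ler_norm.
  by rewrite ler_wpM2l.
Qed.

Lemma bl_scale V (c : R[i]) : bounded_linear (fun x : V => c *: x).
Proof.
split; first by move=> a x y /=; rewrite scalerDr !scalerA mulrC.
by exists (normc c) => x; rewrite nrmZ.
Qed.

Lemma bl_comp V W (Z : normedModType R[i]) (L : V -> W) (K : W -> Z) :
  bounded_linear L -> bounded_linear K -> bounded_linear (K \o L).
Proof.
move=> hL hK; have [M M0 hM] := bl_bound hL; have [N N0 hN] := bl_bound hK.
split; first by move=> a x y /=; case: hL => -> _; case: hK => -> _.
exists (N * M) => x /=; rewrite (le_trans (hN _))// -mulrA ler_wpM2l//.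
exact: ltW.
Qed.

Lemma bl_addf V W (L K : V -> W) :
  bounded_linear L -> bounded_linear K -> bounded_linear (fun x => L x + K x).
Proof.
move=> hL hK; have [M M0 hM] := bl_bound hL; have [N N0 hN] := bl_bound hK.
split.
  move=> a x y /=; case: hL => -> _; case: hK => -> _.
  by rewrite scalerDr addrACA.
exists (M + N) => x /=; rewrite (le_trans (nrmD _ _))// mulrDl lerD//.
Qed.

Lemma rfunZ V (l : V -> R) (c : R[i]) : rfun l -> rfun (fun x => l (c *: x)).
Proof. by move=> hl; exact: (rfun_comp (bl_scale V c) hl). Qed.

Lemma rfun_scale V (l : V -> R) (c : R[i]) x : rfun l ->
  l (c *: x) = complex.Re c * l x + complex.Im c * l ('i *: x).
Proof.
move=> hl; have [lD lZ _] := hl.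
by rewrite {1}(complexE c) scalerDl lD lZ [_ * _%:C]mulrC -scalerA lZ.
Qed.

Lemma rfun_bound V (l : V -> R) : rfun l ->
  exists2 M : R, 0 < M & forall x, `|l x| <= M * nrm x.
Proof.
case=> _ _ [M hM]; exists (`|M| + 1); first by rewrite ltr_wpDl.
move=> x; rewrite (le_trans (hM x))// ler_wpM2r ?nrm_ge0//.
by rewrite (le_trans (ler_norm M))// lerDl.
Qed.

Lemma rfun_cvg V (l : V -> R) {T : Type} {F : set_system T} {FF : Filter F}
  (f : T -> V) (v : V) : rfun l -> f @ F --> v -> l (f t) @[t --> F] --> l v.
Proof.
move=> hl /cvg_nrmP fv; have [M M0 hM] := rfun_bound hl.
apply/cvgrPdist_lt => e e0; have eM : 0 < e / M by rewrite divr_gt0.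
apply: filterS (fv _ eM) => t; rewrite ltr_pdivlMr// => h.
by rewrite -(rfunB _ _ hl) (le_lt_trans (hM _))// mulrC.
Qed.

Lemma bl_cvg V W (L : V -> W) {T : Type} {F : set_system T} {FF : Filter F}
  (f : T -> V) (v : V) : bounded_linear L -> f @ F --> v -> L (f t) @[t --> F] --> L v.
Proof.
move=> hL /cvg_nrmP fv; have [M M0 hM] := bl_bound hL.
apply/cvg_nrmP => e e0; have eM : 0 < e / M by rewrite divr_gt0.
apply: filterS (fv _ eM) => t; rewrite ltr_pdivlMr// => h.
by rewrite -(blB _ _ hL) (le_lt_trans (hM _))// mulrC.
Qed.

Lemma norming_sep V (x y : V) : norming V -> (forall l, rfun l -> l x = l y) -> x = y.
Proof.
move=> nV h; have [l [hl _ lx]] := nV (x - y).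
apply/subr0_eq/nrm0_eq0; rewrite -lx (rfunB _ _ hl) (h _ hl) subrr//.
Qed.

Lemma norming_le V (x : V) (c : R) : norming V ->
  (forall l, rfun l -> (forall y, `|l y| <= nrm y) -> l x <= c) -> nrm x <= c.
Proof. by move=> nV h; have [l [hl l1 <-]] := nV x; exact: h. Qed.

Lemma norming_iso V W (L : V -> W) : norming W -> linear L ->
  (forall x, nrm (L x) = nrm x) -> norming V.
Proof.
move=> nW Ll iL x; have [l [hl l1 lx]] := nW (L x).
have hL : bounded_linear L by split => //; exists 1 => y; rewrite mul1r iL.
exists (l \o L); split; first exact: rfun_comp.
  by move=> y /=; rewrite -iL.
by rewrite /= lx iL.
Qed.

(** The functional y |-> Re <y, x> / |x| attains its norm at [x]. Cauchy-Schwarz for this real part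
    follows from the positivity of |y + t x|^2 for real [t]. *)
Lemma hilbert_norming (X : completeNormedModType R[i]) : hilbert X -> norming X.
Proof.
case=> ip hip x.
have [->|x0] := eqVneq x 0.
  exists (fun=> 0); rewrite nrm0; split => //.
    split; [by move=> *; rewrite addr0|by move=> *; rewrite mulr0|].
    by exists 0 => y; rewrite normr0 mul0r.
  by move=> y; rewrite normr0 nrm_ge0.
have ReD (a b : R[i]) : complex.Re (a + b) = complex.Re a + complex.Re b.
  by case: a; case: b.
have ReZ (t : R) (b : R[i]) : complex.Re (t%:C * b) = t * complex.Re b.
  by case: b => b1 b2 /=; rewrite mul0r subr0.
have nrm2 y : nrm y ^+ 2 = complex.Re (ip y y).
  by rewrite -hip nrmE -rmorphXn.
pose l y := complex.Re (ip y x).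
have quad (t : R) y :
    nrm (y + t%:C *: x) ^+ 2 = nrm y ^+ 2 + 2 * t * l y + t ^+ 2 * nrm x ^+ 2.
  rewrite nrm2 hnormD !ReD -nrm2 -nrm2 nrmZr exprMn real_normK ?num_real//.
  set d := (X in complex.Re X + complex.Re _).
  have dE : d = t%:C * ip y x.
    by rewrite /d linearZr_LR/=; congr (_ * _); exact: conjc_real.
  set d' := (X in _ + (_ + complex.Re X)).
  have -> : complex.Re d' = complex.Re d.
    by rewrite /d' expr0 mul1r -/d; case: (d).
  rewrite dE ReZ -/(l y); ring.
have xg0 : 0 < nrm x by exact: nrm_gt0.
have lCS y : `|l y| <= nrm x * nrm y.
  rewrite -ler_sqr ?nnegrE ?mulr_ge0 ?nrm_ge0// real_normK ?num_real//.
  (* The minimiser of the quadratic in [t]; nonnegativity there is Cauchy-Schwarz. *)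
  have := quad (- (l y / nrm x ^+ 2)) y.
  set q := nrm (_ + _) => e.
  have : 0 <= nrm x ^+ 2 * q ^+ 2 by rewrite mulr_ge0 ?sqr_ge0.
  rewrite e.
  have -> : nrm x ^+ 2 * (nrm y ^+ 2 + 2 * - (l y / nrm x ^+ 2) * l y +
     (- (l y / nrm x ^+ 2)) ^+ 2 * nrm x ^+ 2) = (nrm x * nrm y) ^+ 2 - l y ^+ 2.
    by field; exact: lt0r_neq0.
  by rewrite subr_ge0.
exists (fun y => l y / nrm x); split.
- split.
  + by move=> y z; rewrite /l linearDl ReD mulrDl.
  + by move=> a y; rewrite /l linearZl_LR ReZ mulrA.
  + exists 1 => y; rewrite normrM normfV (gtr0_norm xg0) mul1r.
    by rewrite ler_pdivrMr// mulrC.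
- by move=> y; rewrite normrM normfV (gtr0_norm xg0) ler_pdivrMr// mulrC.
- by rewrite /l -nrm2 expr2 mulfK// lt0r_neq0.
Qed.

End functionals.

(** * Riemann and Pettis integrals *)

Section riemann_pettis.
Context {R : realType}.
Implicit Types V W : normedModType R[i].
Notation mu := (@lebesgue_measure R).

Lemma within_nrmP V (D : set R) (f : R -> V) :
  {within D, continuous f} <->
  forall t, D t -> forall e : R, 0 < e -> exists2 d : R, 0 < d &
    forall s, D s -> `|t - s| < d -> nrm (f t - f s) < e.
Proof.
split=> [/subspace_continuousP cf t Dt e e0|h].
  have /cvg_nrmP/(_ e e0) := cf t Dt.
  by case=> d /= d0 hd; exists d => // s Ds ts; apply: hd => //.
apply/subspace_continuousP => t Dt; apply/cvg_nrmP => e e0.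
have [d d0 hd] := h t Dt e e0.
by exists d => //= s ts Ds; exact: hd.
Qed.

Lemma rfun_within V (D : set R) (f : R -> V) (l : V -> R) : rfun l ->
  {within D, continuous f} -> {within D, continuous (l \o f)}.
Proof.
move=> hl /subspace_continuousP cf; apply/subspace_continuousP => t Dt.
exact: (rfun_cvg hl (cf t Dt)).
Qed.

Lemma nrm_within V (D : set R) (f : R -> V) :
  {within D, continuous f} -> {within D, continuous (fun t => nrm (f t))}.
Proof.
move=> /subspace_continuousP cf; apply/subspace_continuousP => t Dt.
exact: (cvg_nrm (cf t Dt)).
Qed.

(** Heine-Cantor from the covering form of compactness, with the filter [0^'+] as the family of
    candidate radii. *)
Lemma unif_cont_itv V (a b : R) (f : R -> V) : {within `[a, b], continuous f} ->
  forall e : R, 0 < e -> exists2 d : R, 0 < d &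
    forall s t, s \in `[a, b] -> t \in `[a, b] -> `|s - t| < d ->
      nrm (f s - f t) < e.
Proof.
move=> /within_nrmP cf e e0.
have /compact_near_coveringP/(_ R (0^'+)
  (fun d s => s \in `[a, b] -> forall t, t \in `[a, b] -> `|s - t| < d ->
     nrm (f s - f t) < e)) := @segment_compact R a b.
case.
  move=> x Kx; have e2 : 0 < e / 2 by rewrite divr_gt0.
  have [d d0 hd] := cf x Kx _ e2; have d2 : 0 < d / 2 by rewrite divr_gt0.
  exists (ball x (d / 2), `]0, d / 2[%classic).
    split; first exact: nbhsx_ballx.
    exists (d / 2) => //= r; rewrite /= sub0r normrN => rd r0.
    by rewrite in_itv/= r0 (le_lt_trans (ler_norm r)).
  move=> [s r] /= [+ +] sab t tab str.
  rewrite /ball/= in_itv/= => xs /andP[_ rd].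
  have xt : `|x - t| < d.
    by rewrite -(subrKA s) (le_lt_trans (ler_normD _ _))// [ltRHS]splitr ltrD// (lt_trans str).
  have xsd : `|x - s| < d by rewrite (lt_trans xs)// ltr_pdivrMr// mulr2n mulrDr mulr1 ltrDl.
  rewrite (le_lt_trans (nrm_tri (f x) _ _))// [ltRHS]splitr ltrD//.
    by rewrite nrmB hd.
  exact: hd.
move=> d /= d0 hd; exists (d / 2); first by rewrite divr_gt0.
move=> s t sab tab std; apply: (hd (d / 2)) => //=.
- by rewrite sub0r normrN gtr0_norm ?divr_gt0// ltr_pdivrMr// mulr2n mulrDr mulr1 ltrDl.
- by rewrite divr_gt0.
Qed.

Lemma cont_integrable (g : R -> R) (a b : R) : {within `[a, b], continuous g} ->
  mu.-integrable `[a, b] (EFin \o g).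
Proof. by move=> cg; apply: continuous_compact_integrable => //; exact: segment_compact. Qed.

(** Induction on the cells: on one cell, the term of the sum minus the integral is the integral of
    [g (xi i) - g s], at most [e] times the length of the cell. *)
Lemma rsum_close (g : R -> R) (a b e : R) n (p xi : nat -> R) :
  {within `[a, b], continuous g} -> p 0%N = a -> p n = b ->
  (forall i, (i < n)%N -> p i <= xi i <= p i.+1) ->
  (forall i s, (i < n)%N -> p i <= s <= p i.+1 -> `|g (xi i) - g s| <= e) ->
  `|\sum_(i < n) (p i.+1 - p i) * g (xi i) - \int[mu]_(t in `[a, b]) g t|
    <= e * (b - a).
Proof.
move=> cg p0 pn pxi ge.
have pS i : (i < n)%N -> p i <= p i.+1.
  by move=> /pxi/andP[]; exact: le_trans.
have pm i j : (i <= j)%N -> (j <= n)%N -> p i <= p j.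
  move=> ij; elim: j ij => [|j IH]; first by rewrite leqn0 => /eqP ->.
  rewrite leq_eqVlt => /predU1P[->//|]; rewrite ltnS => ij jn.
  by rewrite (le_trans (IH ij (ltnW jn)))// pS.
have ig := cont_integrable cg.
suff H k : (k <= n)%N ->
    `|\sum_(i < k) (p i.+1 - p i) * g (xi i) - \int[mu]_(t in `[a, p k]) g t|
      <= e * (p k - a) by rewrite -{1 2}pn; exact: H.
elim: k => [_|k IH kn].
  by rewrite big_ord0 p0 set_itv1 Rintegral_set1 !subrr normr0 mulr0.
have apk : a <= p k by rewrite -p0 pm// ltnW.
have pk1b : p k.+1 <= b by rewrite -pn pm.
have ik1 : mu.-integrable `[a, p k.+1] (EFin \o g).
  apply: integrableS ig => //; apply: subset_itvl; rewrite bnd_simp//.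
have ikk : mu.-integrable `]p k, p k.+1] (EFin \o g).
  apply: integrableS ik1 => //; apply: subset_itvr; rewrite bnd_simp//.
have E : \int[mu]_(t in `[a, p k.+1]) g t = \int[mu]_(t in `[a, p k]) g t
      + \int[mu]_(t in `]p k, p k.+1]) g t.
  rewrite -(@Rintegral_itvB _ _ _ _ (p k) ik1) ?bnd_simp ?pS//.
  by rewrite addrC subrK.
rewrite big_ord_recr/= E opprD addrACA (le_trans (ler_normD _ _))//.
have -> : p k.+1 - a = (p k - a) + (p k.+1 - p k) by ring.
rewrite mulrDr lerD ?IH ?(ltnW kn)//.
have mI : mu `]p k, p k.+1] = (p k.+1 - p k)%:E.
  rewrite lebesgue_measure_itv/= lte_fin; have := pS _ kn.
  by rewrite le_eqVlt => /predU1P[->|->//]; rewrite ltxx subrr.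
have icst c : mu.-integrable `]p k, p k.+1] (EFin \o (fun=> c : R)).
  apply: (@integrableS _ _ _ mu `[p k, p k.+1]) => //; first exact: subset_itv_oc_cc.
  by apply: cont_integrable => x; exact: cvg_cst.
have -> : (p k.+1 - p k) * g (xi k) = \int[mu]_(t in `]p k, p k.+1]) g (xi k).
  by rewrite Rintegral_cst//= mI/= mulrC.
rewrite -RintegralB// (le_trans (le_normr_Rintegral _ _))//.
  by apply: (integrableB _ (icst _) ikk).
have -> : e * (p k.+1 - p k) = \int[mu]_(t in `]p k, p k.+1]) e.
  by rewrite Rintegral_cst//= mI.
apply: le_Rintegral => //.
- by apply: integrable_norm => //; apply: (integrableB _ (icst _) ikk).
- by move=> s /=; rewrite in_itv/= => /andP[/ltW ps sp]; apply: ge; rewrite ?ps.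
Qed.

(* The Pettis (weak) integral for Lebesgue measure, over any set. *)
Definition pint V (D : set R) (f : R -> V) (v : V) : Prop :=
  forall l, rfun l -> mu.-integrable D (EFin \o (l \o f)) /\
                      \int[mu]_(t in D) l (f t) = l v.

(** One uniform partition, finer than the moduli of both integrals, compares the two limits. *)
Lemma is_rint_uniq V (f : R -> V) a b v w : a <= b ->
  is_rint f a b v -> is_rint f a b w -> v = w.
Proof.
move=> ab hv hw; apply/subr0_eq/nrm0_eq0/eqP; rewrite eq_le nrm_ge0 andbT.
apply/ler_addgt0Pl => e e0; rewrite addr0.
have e2 : 0 < e / 2 by rewrite divr_gt0.
have [d1 d10 h1] := hv _ e2; have [d2 d20 h2] := hw _ e2.
pose d := Num.min d1 d2; have d0 : 0 < d by rewrite lt_min d10.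
pose n := (Num.truncn ((b - a) / d)).+1.
have n0 : 0 < n%:R :> R by rewrite ltr0n.
pose p (i : nat) := a + i%:R * ((b - a) / n%:R).
have pd i : p i.+1 - p i = (b - a) / n%:R by rewrite /p -natr1; ring.
have pdd : (b - a) / n%:R < d.
  by rewrite ltr_pdivrMr// mulrC -ltr_pdivrMr// truncnS_gt.
have ge0 : 0 <= (b - a) / n%:R by rewrite divr_ge0 ?subr_ge0 ?ler0n.
have pn : p n = b by rewrite /p mulrCA divff ?lt0r_neq0// mulr1 addrC subrK.
have p0 : p 0%N = a by rewrite /p mul0r addr0.
have := h1 n p p p0 pn; have := h2 n p p p0 pn.
set S := \sum_(_ < _) _ => k2 k1.
rewrite (le_trans (nrm_tri S _ _))// [leRHS]splitr lerD// ltW//.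
- rewrite nrmB; apply: k1 => i _; rewrite lexx/= -subr_ge0 pd ge0; split => //.
  by rewrite (lt_le_trans pdd)// ge_min lexx.
- apply: k2 => i _; rewrite lexx/= -subr_ge0 pd ge0; split => //.
  by rewrite (lt_le_trans pdd)// ge_min lexx orbT.
Qed.

Lemma rintE V (f : R -> V) a b v : a <= b -> is_rint f a b v -> rint f a b = v.
Proof. by move=> ab h; apply: xget_unique => // w hw; exact: (is_rint_uniq ab hw h). Qed.

(** Sums over fine partitions are Cauchy: tested against a functional of norm at most one, each is
    within e (b - a) of the same real integral, and a norming functional turns this into a bound for
    the norm of their difference. The same estimate identifies the limit as the weak integral. *)
Lemma rint_exists (V : completeNormedModType R[i]) (f : R -> V) a b :
  norming V -> a <= b -> {within `[a, b], continuous f} ->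
  exists v, is_rint f a b v /\ pint `[a, b] f v.
Proof.
move=> nV ab cf.
have cl (l : V -> R) : rfun l -> {within `[a, b], continuous (l \o f)}.
  by move=> hl; exact: rfun_within.
pose tag d n (p xi : nat -> R) := [/\ p 0%N = a, p n = b &
  forall i, (i < n)%N -> p i <= xi i <= p i.+1 /\ p i.+1 - p i < d].
pose S n (p xi : nat -> R) := \sum_(i < n) (p i.+1 - p i)%:C *: f (xi i).
have close e : 0 < e -> exists2 d : R, 0 < d & forall n p xi, tag d n p xi ->
    forall l : V -> R, rfun l -> (forall y, `|l y| <= nrm y) ->
    `|l (S n p xi) - \int[mu]_(t in `[a, b]) l (f t)| <= e * (b - a).
  move=> e0; have [d d0 hd] := unif_cont_itv cf e0.
  exists d => // n p xi [p0 pn pxi] l hl l1.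
  have pS i : (i < n)%N -> p i <= p i.+1.
    by move=> /pxi[/andP[+ +] _]; exact: le_trans.
  have pm i j : (i <= j)%N -> (j <= n)%N -> p i <= p j.
    move=> ij; elim: j ij => [|j IH]; first by rewrite leqn0 => /eqP ->.
    rewrite leq_eqVlt => /predU1P[->//|]; rewrite ltnS => ij jn.
    by rewrite (le_trans (IH ij (ltnW jn)))// pS.
  have -> : l (S n p xi) = \sum_(i < n) (p i.+1 - p i) * l (f (xi i)).
    rewrite rfun_sum//; apply: eq_bigr => i _; by case: hl => _ ->.
  apply: (rsum_close (cl _ hl)) => //; first by move=> i /pxi[].
  move=> i s ilt /andP[ps sp].
  have [/andP[px xp] pd] := pxi _ ilt.
  have ab' r : p i <= r -> r <= p i.+1 -> r \in `[a, b].
    move=> h1 h2; rewrite in_itv/= -p0 -pn (le_trans (pm _ _ _ _) h1)//; last exact: ltnW.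
    by rewrite (le_trans h2)// pm.
  rewrite -(rfunB _ _ hl) (le_trans (l1 _))// ltW// hd//; [exact: ab'|exact: ab'|].
  by rewrite ltr_norml; apply/andP; split; lra.
have ex_tag d : 0 < d -> exists n p xi, tag d n p xi.
  move=> d0; pose n := (Num.truncn ((b - a) / d)).+1.
  have n0 : 0 < n%:R :> R by rewrite ltr0n.
  pose p (i : nat) := a + i%:R * ((b - a) / n%:R).
  have pd i : p i.+1 - p i = (b - a) / n%:R by rewrite /p -natr1; ring.
  exists n, p, p; split.
  - by rewrite /p mul0r addr0.
  - by rewrite /p mulrCA divff ?lt0r_neq0// mulr1 addrC subrK.
  - move=> i _; rewrite lexx/= -subr_ge0 pd divr_ge0 ?subr_ge0 ?ler0n//; split => //.
    by rewrite ltr_pdivrMr// mulrC -ltr_pdivrMr// truncnS_gt.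
have SS e : 0 < e -> exists2 d : R, 0 < d &
   forall n p xi n' p' xi', tag d n p xi -> tag d n' p' xi' ->
     nrm (S n p xi - S n' p' xi') <= e.
  move=> e0.
  (* The added 1 allows for [a = b]. *)
  have c0 : 0 < 2 * (b - a + 1) by lra.
  have [d d0 hd] := close _ (divr_gt0 e0 c0).
  exists d => // n p xi n' p' xi' h h'; apply: norming_le => // l hl l1.
  have := hd _ _ _ h l hl l1; have := hd _ _ _ h' l hl l1.
  rewrite (rfunB _ _ hl); move: (l (S n p xi)) (l (S n' p' xi')) => x y.
  move: (\int[mu]_(_ in _) _) => I; rewrite !ler_norml => /andP[h1 h2] /andP[h3 h4].
  have : e / (2 * (b - a + 1)) * (b - a) <= e / 2.
    rewrite invfM mulrA -mulrA ler_piMr ?divr_ge0// ?(ltW e0)//.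
    by rewrite mulrC ler_pdivrMr ?mul1r; lra.
  lra.
have dm m : exists d : R, 0 < d /\ forall n p xi n' p' xi', tag d n p xi -> tag d n' p' xi' ->
     nrm (S n p xi - S n' p' xi') <= m.+1%:R^-1.
  by have [|d d0 hd] := SS m.+1%:R^-1; [rewrite invr_gt0|exists d].
have [dd hdd] := choice dm.
(* The partition [T m] is fine enough for all of the first moduli [dd 0], ..., [dd m], so that the
   sums [s m] form a Cauchy sequence. *)
have [T hT] : exists T : nat -> nat * (nat -> R) * (nat -> R), forall m,
    forall k, (k <= m)%N -> tag (dd k) (T m).1.1 (T m).1.2 (T m).2.
  suff /choice[T hT] : forall m, exists Tm : nat * (nat -> R) * (nat -> R),
      forall k, (k <= m)%N -> tag (dd k) Tm.1.1 Tm.1.2 Tm.2 by exists T.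
  move=> m.
  have [d [d0 hd]] : exists d : R, 0 < d /\ forall k, (k <= m)%N -> d <= dd k.
    elim: m => [|m [d [d0 hd]]].
      by exists (dd 0%N); split; [case: (hdd 0%N)|move=> k; rewrite leqn0 => /eqP ->].
    exists (Num.min d (dd m.+1)); split; first by rewrite lt_min d0; case: (hdd m.+1).
    move=> k; rewrite leq_eqVlt ltnS ge_min => /predU1P[->|/hd ->//].
    by rewrite lexx orbT.
  have [n [p [xi [p0 pn h]]]] := ex_tag d d0.
  exists (n, p, xi) => k km; split => // i /h[? h2]; split => //.
  by rewrite (lt_le_trans h2) ?hd.
pose s m := S (T m).1.1 (T m).1.2 (T m).2.
have /cauchy_seq_nrm/cvg_ex[v sv] : forall e : R, 0 < e -> exists N, forall m n,
    (N <= m)%N -> (N <= n)%N -> nrm (s m - s n) < e.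
  move=> e e0; have [N _ hN] := near_infty_natSinv_lt (PosNum e0).
  exists N => m n Nm Nn; rewrite (@le_lt_trans _ _ N.+1%:R^-1)//; last exact: (hN N (leqnn N)).
  by case: (hdd N) => _; apply; exact: hT.
have rv : is_rint f a b v.
  move=> e e0; have e2 : 0 < e / 2 by rewrite divr_gt0.
  have [N _ hN] := near_infty_natSinv_lt (PosNum e2).
  exists (dd N); first by case: (hdd N).
  move=> n p xi p0 pn h.
  have : nrm (S n p xi - v) <= N.+1%:R^-1.
    have c : nrm (S n p xi - s m) @[m --> \oo] --> nrm (S n p xi - v).
      by apply: cvg_nrm; apply: cvgB => //; exact: cvg_cst.
    apply: (cvgr_to_le c).
    exists N => // m /= Nm; case: (hdd N) => _; apply => //; exact: hT.
  move=> /le_lt_trans; apply; rewrite (lt_trans (hN N _))//=; lra.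
exists v; split => // l hl; split; first exact: cont_integrable (cl l hl).
have [M M0 hM] := rfun_bound hl.
(* The estimate [close] speaks of functionals of norm at most one, so [l] is rescaled. *)
pose k x := M^-1 * l x.
have hk : rfun k.
  split; rewrite /k; case: (hl) => lD lZ _.
  - by move=> x y; rewrite lD mulrDr.
  - by move=> c x; rewrite lZ mulrCA.
  - by exists 1 => x; rewrite mul1r normrM gtr0_norm ?invr_gt0// mulrC ler_pdivrMr// mulrC.
have k1 x : `|k x| <= nrm x.
  by rewrite normrM gtr0_norm ?invr_gt0// mulrC ler_pdivrMr// mulrC.
have lk x : l x = M * k x by rewrite /k mulrA divff ?mul1r ?lt0r_neq0.
suff E : \int[mu]_(t in `[a, b]) k (f t) = k v.
  rewrite lk -E -RintegralZl//; first by apply: eq_Rintegral => x _; rewrite lk.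
  exact: cont_integrable (cl k hk).
apply/subr0_eq/normr0_eq0/eqP; rewrite eq_le normr_ge0 andbT.
apply/ler_addgt0Pl => e e0; rewrite addr0.
have c0 : 0 < 2 * (b - a + 1) by lra.
have [d d0 hd] := close _ (divr_gt0 e0 c0).
have e2 : 0 < e / 2 by rewrite divr_gt0.
have [d' d'0 hd'] := rv _ e2.
have [|n [p [xi [p0 pn h]]]] := ex_tag (Num.min d d'); first by rewrite lt_min d0.
have t1 : tag d n p xi by split => // i /h[? ]; rewrite lt_min => /andP[].
have := hd _ _ _ t1 k hk k1.
have : nrm (S n p xi - v) < e / 2.
  by apply: hd' => // i /h[? ]; rewrite lt_min => /andP[].
move=> q1; have q2 : `|k (S n p xi) - k v| <= e / 2.
  by rewrite -(rfunB _ _ hk) (le_trans (k1 _))// ltW.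
have : e / (2 * (b - a + 1)) * (b - a) <= e / 2.
  rewrite invfM mulrA -mulrA ler_piMr ?divr_ge0// ?(ltW e0)//.
  by rewrite mulrC ler_pdivrMr ?mul1r; lra.
move: q2; rewrite !ler_norml => /andP[? ?] ? /andP[? ?]; apply/andP; split; lra.
Qed.

End riemann_pettis.

Section pettis.
Context {R : realType}.
Implicit Types V W : normedModType R[i].
Notation mu := (@lebesgue_measure R).
Notation mset := (@measurable _ (measurableTypeR R)).

(** Dominated convergence for the truncations of [h] to [F n], with |h| as the bound. *)
Lemma Rint_exhaust (F : nat -> set R) (h : R -> R) :
  nondecreasing_seq F -> (forall n, mset (F n)) ->
  mu.-integrable (\bigcup_n F n) (EFin \o h) ->
  \int[mu]_(t in F n) h t @[n --> \oo] --> \int[mu]_(t in \bigcup_n F n) h t.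
Proof.
move=> ndF mF ih; set D := \bigcup_n F n; have mD : mset D by exact: bigcup_measurable.
have mh : @measurable_fun _ _ (measurableTypeR R) _ D h by apply/measurable_EFinP; exact: measurable_int ih.
have FD n : F n `<=` D by exact: bigcup_sup.
have mhF n : @measurable_fun _ _ (measurableTypeR R) _ D (EFin \o (h \_ (F n))).
  apply/measurable_EFinP; rewrite -measurable_restrict//.
  by apply: measurable_funS mh => // x [].
have := @dominated_convergence _ _ _ mu D mD (fun n => EFin \o (h \_ (F n))) (EFin \o h)
  (abse \o (EFin \o h)) mhF (measurable_int _ ih).
case.
- apply: aeW => t [N _ FNt]; apply: cvg_near_cst; exists N => // n /= Nn.
  by rewrite /= patchE mem_set//; have /subsetPset := ndF _ _ Nn; exact.
- exact: integrable_abse.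
- apply: aeW => t n Dt /=; rewrite patchE; case: ifP => // _.
  by rewrite /= normr0 lee_fin.
move=> _ _ cv.
have E n : (\int[mu]_(t in D) ((EFin \o (h \_ (F n))) t))%E = (\int[mu]_(t in F n) h t)%:E.
  have {2}-> : F n = D `&` F n by rewrite setIidr.
  rewrite Rintegral_mkcondr /Rintegral fineK//.
  apply: integrable_fin_num => //.
  suff : mu.-integrable D ((EFin \o h) \_ (F n)) by rewrite restrict_EFin.
  apply/integrable_restrict; first exact: mF.
    exact: mD.
  by apply: (integrableS mD _ _ ih); [exact: measurableI|move=> x []].
move: cv; under eq_fun do rewrite E.
rewrite -(@fineK _ (\int[mu]_(x in D) _)%E); last exact: integrable_fin_num.
by move/fine_cvg.
Qed.

Lemma pint_uniq V (D : set R) (f : R -> V) v w : norming V ->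
  pint D f v -> pint D f w -> v = w.
Proof.
by move=> nV hv hw; apply: norming_sep => // l hl; rewrite -(hv l hl).2 -(hw l hl).2.
Qed.

Lemma pint_ext V (D : set R) (f g : R -> V) v : mset D -> (forall t, D t -> f t = g t) ->
  pint D f v -> pint D g v.
Proof.
move=> mD fg hf l hl; have [i1 i2] := hf l hl; split.
  by apply: eq_integrable i1 => // t; rewrite inE => /fg /= ->.
by rewrite -i2; apply: eq_Rintegral => t; rewrite inE => /fg ->.
Qed.

Lemma pint_map V W (L : V -> W) (D : set R) (f : R -> V) v : bounded_linear L ->
  pint D f v -> pint D (L \o f) (L v).
Proof. by move=> hL hf l hl; exact: (hf (l \o L) (rfun_comp hL hl)). Qed.

Lemma pintD V (D : set R) (f g : R -> V) v w : mset D ->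
  pint D f v -> pint D g w -> pint D (fun t => f t + g t) (v + w).
Proof.
move=> mD hf hg l hl; have [i1 i2] := hf l hl; have [j1 j2] := hg l hl.
have lD := (let: And3 h _ _ := hl in h).
split.
  rewrite (_ : _ \o _ = fun t => (EFin \o (l \o f)) t + (EFin \o (l \o g)) t)%E.
    exact: integrableD.
  by apply/funext => t /=; rewrite lD EFinD.
by rewrite lD -i2 -j2 -RintegralD//; apply: eq_Rintegral => t _; rewrite lD.
Qed.

Lemma pintZ V (c : R[i]) (D : set R) (f : R -> V) v :
  pint D f v -> pint D (fun t => c *: f t) (c *: v).
Proof. exact: (pint_map (bl_scale V c)). Qed.

Lemma pint_le V (D : set R) (f : R -> V) v (g : R -> R) : norming V -> mset D ->
  pint D f v -> mu.-integrable D (EFin \o g) ->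
  (forall t, D t -> nrm (f t) <= g t) -> nrm v <= \int[mu]_(t in D) g t.
Proof.
move=> nV mD hf ig fg; apply: norming_le => // l hl l1.
have [i1 <-] := hf l hl; apply: le_Rintegral => // t Dt.
by rewrite (le_trans (ler_norm _))// (le_trans (l1 _)) ?fg.
Qed.

Lemma pint_setD V (D E : set R) (f : R -> V) v w : mset D -> mset E ->
  E `<=` D -> pint D f v -> pint E f w -> pint (D `\` E) f (v - w).
Proof.
move=> mD mE ED hv hw l hl; have [i1 i2] := hv l hl; have [j1 j2] := hw l hl.
have mDE : mset (D `\` E) by exact: measurableD.
have k1 : mu.-integrable (D `\` E) (EFin \o (l \o f)).
  by apply: integrableS i1 => // x [].
split => //; rewrite (rfunB _ _ hl) -i2 -j2.
have DE : D = E `|` (D `\` E) by rewrite setDUK.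
rewrite {2}DE Rintegral_setU//=.
- by rewrite addrAC subrr add0r.
- by rewrite -DE.
- by apply/disj_setPS => x [Ex []].
Qed.

(** The integrals [w n] over the segments are Cauchy, since [w n - w m] is an integral over a
    difference of segments and is bounded there by the integral of [g], that is by [I n - I m]. *)
Lemma pint_exists (V : completeNormedModType R[i]) (f : R -> V) (g : R -> R)
    (a b : nat -> R) : norming V -> (forall n, a n <= b n) ->
  nondecreasing_seq (fun n => `[a n, b n]%classic : set R) ->
  (forall n, {within `[a n, b n], continuous f}) ->
  mu.-integrable (\bigcup_n `[a n, b n]%classic) (EFin \o g) ->
  (forall t, (\bigcup_n `[a n, b n]%classic) t -> nrm (f t) <= g t) ->
  exists v, pint (\bigcup_n `[a n, b n]%classic) f v.
Proof.
move=> nV ab ndF cf ig fg; set D := \bigcup_n _.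
have mD : mset D by exact: bigcup_measurable.
have FD n : `[a n, b n]%classic `<=` D by move=> x hx; exists n.
have /choice[w hw] : forall n, exists v, pint `[a n, b n] f v.
  by move=> n; have [v [_ hv]] := rint_exists nV (ab n) (cf n); exists v.
pose I n := \int[mu]_(t in `[a n, b n]) g t.
have cI : I n @[n --> \oo] --> \int[mu]_(t in D) g t by exact: Rint_exhaust.
have igF n : mu.-integrable `[a n, b n] (EFin \o g) by apply: integrableS ig.
have wI m n : (m <= n)%N -> nrm (w n - w m) <= I n - I m.
  move=> mn; have mnF : `[a m, b m] `<=` `[a n, b n] by apply/subsetPset; exact: ndF.
  have ms : mset (`[a n, b n] `\` `[a m, b m]) by exact: measurableD.
  have igs : mu.-integrable (`[a n, b n] `\` `[a m, b m]) (EFin \o g).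
    by apply: integrableS (igF n) => // x [].
  have -> : I n - I m = \int[mu]_(t in `[a n, b n] `\` `[a m, b m]) g t.
    rewrite /I; have DE : `[a n, b n]%classic = `[a m, b m] `|` (`[a n, b n] `\` `[a m, b m]).
      by rewrite setDUK.
    rewrite {1}DE Rintegral_setU//=.
    - by rewrite addrAC subrr add0r.
    - by rewrite -DE.
    - by apply/disj_setPS => x [Ex []].
  apply: (pint_le nV ms) => //; first by apply: pint_setD.
  by move=> t [tn _]; apply: fg; exists n.
have /cauchy_seq_nrm/cvg_ex[v wv] : forall e : R, 0 < e -> exists N, forall m n,
    (N <= m)%N -> (N <= n)%N -> nrm (w m - w n) < e.
  move=> e e0; move/cvgrPdist_lt : cI => /(_ (e / 2))[|N _ hN]; first by rewrite divr_gt0.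
  exists N => m n; wlog mn : m n / (m <= n)%N.
    by move=> H; case: (leqP m n) => [|/ltnW] h h1 h2; [|rewrite nrmB]; exact: H.
  move=> Nm Nn; rewrite nrmB (le_lt_trans (wI _ _ mn))//.
  have := hN _ Nm; have := hN _ Nn; rewrite !ltr_norml => /andP[? ?] /andP[? ?]; lra.
exists v => l hl.
have il : mu.-integrable D (EFin \o (l \o f)).
  have [M M0 hM] := rfun_bound hl.
  apply: (le_integrable mD _ _ (integrableZl mD M ig)).
    apply/measurable_EFinP; apply/measurable_fun_bigcup => // n.
    by apply: subspace_continuous_measurable_fun => //; exact: rfun_within.
  move=> t Dt /=; rewrite lee_fin (le_trans (hM _))// (le_trans _ (ler_norm _))//.
  by rewrite ler_pM2l// fg.
split => //.
have c1 := Rint_exhaust ndF (fun=> measurable_itv _) il.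
have c2 := rfun_cvg hl wv.
have c3 : \int[mu]_(t in `[a n, b n]) (l \o f) t @[n --> \oo] --> l v.
  suff -> : (fun n => \int[mu]_(t in `[a n, b n]) (l \o f) t) = l \o w by exact: c2.
  by apply/funext => n; rewrite /= -(hw n l hl).2.
by rewrite -(cvg_lim _ c3)//; apply/esym; apply: cvg_lim c1.
Qed.

End pettis.

(** * Cauchy's theorem in polar coordinates *)

Section polar_green.
Context {R : realType}.
Notation mu := (@lebesgue_measure R).

Lemma within_LR (F : R -> R) a b : a < b -> {within `[a, b], continuous F} ->
  {in `]a, b[, forall x, derivable F x 1} -> derivable_oo_LRcontinuous F a b.
Proof. by move=> ab /(continuous_within_itvP _ ab)[_ h1 h2] dF; split. Qed.

Lemma Rint_FTC2 (f F : R -> R) a b : a < b -> {within `[a, b], continuous f} ->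
  {within `[a, b], continuous F} -> (forall x, x \in `]a, b[ -> is_derive x 1 F (f x)) ->
  \int[mu]_(x in `[a, b]) f x = F b - F a.
Proof.
move=> ab cf cF dF; rewrite /Rintegral (continuous_FTC2 ab cf (F := F))//.
  by apply: within_LR => // x xab; have [] := dF x xab.
by move=> x xab; rewrite derive1E; have [_ ->] := dF x xab.
Qed.

Lemma within_ext (S : topologicalType) (D : set R) (f g : R -> S) :
  (forall x, D x -> f x = g x) -> {within D, continuous f} -> {within D, continuous g}.
Proof.
move=> fg; apply: (@subspace_eq_continuous R D S f g) => x.
by rewrite inE; exact: fg.
Qed.

(** Used to pass from continuity on a segment to continuity on an open neighbourhood of it, as
    continuity under the integral sign demands. *)
Lemma continuous_clamp (T : topologicalType) (g : R -> T) (k : R -> R) (D : set R) :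
  {within D, continuous g} -> continuous k -> (forall x, D (k x)) ->
  continuous (g \o k).
Proof.
move=> /subspace_continuousP cg ck kD x A /(cg (k x) (kD x)).
rewrite /within/= !nbhs_simpl => /ck; rewrite nbhs_simpl/=.
by apply: filterS => y; apply; exact: kD.
Qed.

(** The equality of dp/dr and dq/df, both being [D], says that the form p df + q dr is closed. The
    integral of p over [f0, f1] then has r-derivative [q r f1 - q r f0], by differentiation under
    the integral and the fundamental theorem in f; a second use of the latter, in r, concludes. *)
Lemma green_rectangle (p q D : R -> R -> R) (r0 r1 f0 f1 C : R) :
  r0 < r1 -> f0 < f1 ->
  (forall r f, r \in `]r0, r1[ -> f \in `[f0, f1] ->
     is_derive r 1 (fun r => p r f) (D r f) /\ `|D r f| <= C) ->
  (forall r f, r \in `]r0, r1[ -> f \in `]f0, f1[ -> is_derive f 1 (q r) (D r f)) ->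
  (forall r, r \in `]r0, r1[ -> {within `[f0, f1], continuous (D r)} /\
     {within `[f0, f1], continuous (q r)}) ->
  (forall r, r \in `[r0, r1] -> {within `[f0, f1], continuous (p r)}) ->
  (forall f, f \in `[f0, f1] -> {within `[r0, r1], continuous (p ^~ f)}) ->
  (forall r f, r \in `[r0, r1] -> f \in `[f0, f1] -> `|p r f| <= C) ->
  {within `[r0, r1], continuous (fun r => q r f1 - q r f0)} ->
  \int[mu]_(f in `[f0, f1]) p r1 f - \int[mu]_(f in `[f0, f1]) p r0 f =
  \int[mu]_(r in `[r0, r1]) (q r f1 - q r f0).
Proof.
move=> r01 f01 dp dq cD cp1 cp2 bp cq.
pose Phi r := \int[mu]_(f in `[f0, f1]) p r f.
suff -> : \int[mu]_(r in `[r0, r1]) (q r f1 - q r f0) = Phi r1 - Phi r0 by [].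
have icst (c : R) : mu.-integrable `[f0, f1] (EFin \o (fun=> c)).
  by apply: cont_integrable => x; exact: cvg_cst.
have cPhi : {within `[r0, r1], continuous Phi}.
  (* Clamping r to the segment extends the integrand to (r0 - 1, r1 + 1), so that the endpoints
     become interior. *)
  pose k r := Num.max r0 (Num.min r r1).
  have kr r : k r \in `[r0, r1].
    by rewrite in_itv/= /k le_max lexx/= ge_max (ltW r01)/= ge_min lexx orbT.
  have kid r : r \in `[r0, r1] -> k r = r.
    by rewrite in_itv/= => /andP[h1 h2]; rewrite /k min_l// max_r.
  have ck : continuous k.
    move=> x; apply: (@continuous_max _ R (fun=> r0) (fun r => Num.min r r1) x).
      exact: cst_continuous.
    apply: (@continuous_min _ R id (fun=> r1) x); first exact: cvg_id.
    exact: cst_continuous.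
  have H : {in `](r0 - 1), (r1 + 1)[%classic,
      continuous (fun r => \int[mu]_(f in `[f0, f1]) p (k r) f)}.
    apply: (@continuity_under_integral R _ _ mu (fun r f => p (k r) f) `[f0, f1]%classic _
      (r0 - 1) (r1 + 1) _ _ (fun=> C)) => //.
    + by move=> r _; apply: cont_integrable; exact: cp1.
    + apply: aeW => f ff x _.
      by apply: (continuous_clamp (cp2 f ff) ck) => y; exact: kr.
    + by move=> r _; apply: aeW => f ff; exact: bp.
  apply: (@within_ext _ _ (fun r => \int[mu]_(f in `[f0, f1]) p (k r) f)).
    by move=> r; rewrite /Phi/= => /kid ->.
  apply: continuous_in_subspaceT => x; rewrite inE/= in_itv/= => /andP[h1 h2].
  by apply: H; rewrite inE/= in_itv/=; apply/andP; split; lra.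
have dPhi r : r \in `]r0, r1[ -> is_derive r 1 Phi (q r f1 - q r f0).
  move=> rr.
  have dE r' f : r' \in `]r0, r1[ -> f \in `[f0, f1] -> derive1 (p ^~ f) r' = D r' f.
    by move=> h1 h2; rewrite derive1E; have [[_ ->] _] := dp r' f h1 h2.
  have C0 : 0 <= C.
    have f0f : f0 \in `[f0, f1] by rewrite in_itv/= lexx ltW.
    by have [_] := dp r f0 rr f0f; apply: le_trans.
  have hi x : x \in `]r0, r1[ -> mu.-integrable `[f0, f1] (EFin \o p x).
    by move=> xr; apply: cont_integrable; apply: cp1; exact: subset_itv_oo_cc.
  have hd x y : x \in `]r0, r1[ -> y \in `[f0, f1] -> derivable (p ^~ y) x 1.
    by move=> h1 h2; have [[]] := dp x y h1 h2.
  have hb x y : x \in `]r0, r1[ -> y \in `[f0, f1] -> `|derive1 (p ^~ y) x| <= C.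
    by move=> h1 h2; rewrite dE//; have [] := dp x y h1 h2.
  apply: DeriveDef.
    exact: (derivable_under_integral _ rr hi hd _ (icst C) hb).
  rewrite -derive1E (differentiation_under_integral _ rr hi hd _ (icst C) hb)//.
  transitivity (\int[mu]_(f in `[f0, f1]) D r f).
    by apply: eq_Rintegral => f; rewrite inE/= => ff; exact: dE.
  have [c1 c2] := cD r rr.
  have dqr f : f \in `]f0, f1[ -> is_derive f 1 (q r) (D r f) by exact: dq.
  by rewrite (Rint_FTC2 f01 c1 c2 dqr).
exact: (Rint_FTC2 r01 cq cPhi dPhi).
Qed.
End polar_green.

Section polar_cauchy.
Context {R : realType}.
Notation mu := (@lebesgue_measure R).
Implicit Types E : normedModType R[i].

(** At a zero of [A] the product rule needs only continuity of [B], which in [wder_hol] is a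
    difference quotient; Caratheodory's factor of [A] carries the derivative. *)
Lemma is_derive_mul0 (A B : R -> R) (t a : R) : is_derive t 1 A a -> A t = 0 ->
  {for t, continuous B} -> is_derive t 1 (fun s => A s * B s) (a * B t).
Proof.
move=> /is_derive1_caratheodory[h [hA ch ht]] At cB.
apply/is_derive1_caratheodory; exists (fun s => h s * B s); split.
- by move=> s; have := hA s; rewrite At subr0 => ->; rewrite mul0r subr0; ring.
- exact: continuousM.
- by rewrite ht.
Qed.

(* Continuity and complex differentiability relative to K; in [hol] the quotient
   (f w - f z) / (w - z) extends continuously to z (Caratheodory). *)
Definition ccont E (K : set R[i]) (g : R[i] -> E) (z : R[i]) : Prop :=
  forall e : R, 0 < e -> exists2 d : R, 0 < d &
    forall w, K w -> normc (w - z) < d -> nrm (g w - g z) < e.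

Definition hol E (K : set R[i]) (f f' : R[i] -> E) : Prop :=
  forall z, K z -> exists g : R[i] -> E, [/\ g z = f' z,
    forall w, K w -> f w - f z = (w - z) *: g w & ccont K g z].

Definition cder (c : R -> R[i]) (t : R) (c' : R[i]) : Prop :=
  is_derive t 1 (fun s => complex.Re (c s)) (complex.Re c') /\
  is_derive t 1 (fun s => complex.Im (c s)) (complex.Im c').

(* Differentiability tested against real functionals. *)
Definition wder E (F : R -> E) (t : R) (v : E) : Prop :=
  forall l, rfun l -> is_derive t 1 (l \o F) (l v).

Lemma wder_scale E (c : R -> R[i]) (F : R -> E) t c' v :
  cder c t c' -> wder F t v ->
  wder (fun s => c s *: F s) t (c' *: F t + c t *: v).
Proof.
move=> [c1 c2] hF l hl.
have hil := rfunZ 'i hl.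
have F1 := hF _ hl; have F2 := hF _ hil.
have -> : l \o (fun s => c s *: F s) = (fun s => complex.Re (c s) * (l \o F) s) +
    (fun s => complex.Im (c s) * ((fun x => l ('i *: x)) \o F) s).
  by apply/funext => s /=; rewrite (rfun_scale _ _ hl).
apply: is_derive_eq; case: (hl) => -> _ _.
rewrite (rfun_scale c' _ hl) (rfun_scale (c t) _ hl) /= /GRing.scale/=.
ring.
Qed.

Lemma normc_i : normc ('i : R[i]) = 1.
Proof. by rewrite /normc/= expr0n/= expr1n add0r sqrtr1. Qed.

Lemma normc_le (z : R[i]) : normc z <= `|complex.Re z| + `|complex.Im z|.
Proof.
by rewrite {1}(complexE z) (le_trans (le_normcD _ _))// normcM !normcR normc_i mul1r.
Qed.

Lemma cder_cont (z : R -> R[i]) t z' : cder z t z' ->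
  forall e : R, 0 < e -> \forall s \near t, normc (z s - z t) < e.
Proof.
move=> [[h1 _] [h2 _]] e e0.
have c1 : {for t, continuous (fun s => complex.Re (z s))}.
  exact/differentiable_continuous/derivable1_diffP.
have c2 : {for t, continuous (fun s => complex.Im (z s))}.
  exact/differentiable_continuous/derivable1_diffP.
have e2 : 0 < e / 2 by rewrite divr_gt0.
move/cvgrPdist_lt : c1 => /(_ _ e2); move/cvgrPdist_lt : c2 => /(_ _ e2).
apply: filterS2 => s hb ha; rewrite (le_lt_trans (normc_le _))//.
rewrite [ltRHS]splitr ltrD//.
  by move: ha; rewrite distrC; case: (z s) => ? ?; case: (z t).
by move: hb; rewrite distrC; case: (z s) => ? ?; case: (z t).
Qed.

(** Chain rule from f (z s) = f (z t) + (z s - z t) g (z s): after applying [l], the real and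
    imaginary parts of z s - z t each give a product whose first factor vanishes at [t]. *)
Lemma wder_hol E K (f f' : R[i] -> E) (z : R -> R[i]) t z' :
  hol K f f' -> K (z t) -> (\forall s \near t, K (z s)) -> cder z t z' ->
  wder (f \o z) t (z' *: f' (z t)).
Proof.
move=> hf Kz nK cz l hl; have [g [gz fg cg]] := hf _ Kz.
have hil := rfunZ 'i hl.
pose A1 s := complex.Re (z s) - complex.Re (z t).
pose A2 s := complex.Im (z s) - complex.Im (z t).
have cB (k : E -> R) : rfun k -> {for t, continuous (k \o g \o z)}.
  move=> hk; apply: (@rfun_cvg _ _ k _ _ _ (g \o z) _ hk).
  apply/cvg_nrmP => e e0; have [d d0 hd] := cg e e0.
  have := cder_cont cz d0; move: nK; apply: filterS2 => s Ks sd.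
  by rewrite nrmB; exact: hd.
have d1 := @is_derive_mul0 A1 (l \o g \o z) t (complex.Re z').
have d2 := @is_derive_mul0 A2 ((fun x => l ('i *: x)) \o g \o z) t (complex.Im z').
have dA1 : is_derive t 1 A1 (complex.Re z').
  have [h _] := cz; rewrite -[complex.Re z']subr0; exact: is_deriveB.
have dA2 : is_derive t 1 A2 (complex.Im z').
  have [_ h] := cz; rewrite -[complex.Im z']subr0; exact: is_deriveB.
have {}d1 := d1 dA1 (subrr _) (cB _ hl).
have {}d2 := d2 dA2 (subrr _) (cB _ hil).
pose G s := l (f (z t)) + ((A1 s * (l \o g \o z) s) +
  (A2 s * ((fun x => l ('i *: x)) \o g \o z) s)).
have dG : is_derive t 1 G (l (z' *: f' (z t))).
  rewrite (rfun_scale _ _ hl) -gz -[X in is_derive _ _ _ X]add0r.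
  by apply: is_deriveD; exact: is_deriveD.
have FG : \forall s \near t, G s = (l \o (f \o z)) s.
  apply: filterS nK => s Ks; rewrite /G /=.
  have := fg _ Ks => /(canRL (subrK _)) ->.
  have [lD _ _] := hl.
  rewrite lD addrC (rfun_scale (z s - z t) _ hl) /A1 /A2; congr (_ + _).
  by case: (z s) => ? ?; case: (z t).
exact: near_eq_is_derive FG dG.
Qed.

End polar_cauchy.

Section polar_cauchy.
Context {R : realType}.
Notation mu := (@lebesgue_measure R).
Implicit Types E : normedModType R[i].

Lemma cisD (a b : R) : cis (a + b) = cis a * cis b.
Proof.
rewrite /cis cosD sinD; apply/eqP; rewrite eq_complex/= eqxx/=.
by apply/eqP; ring.
Qed.

Lemma normc_cis (a : R) : normc (cis a) = 1.
Proof. by rewrite /normc/= cos2Dsin2 sqrtr1. Qed.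

Lemma cis0 : cis 0 = 1 :> R[i].
Proof. by rewrite /cis cos0 sin0. Qed.

Lemma cis_conj (a : R) : cis a * cis (- a) = 1.
Proof. by rewrite -cisD subrr cis0. Qed.

Lemma cder_cis (a t : R) : cder (fun s => cis (a * s)) t (a%:C * 'i * cis (a * t)).
Proof.
have dl : is_derive t 1 (fun s : R => a * s) a.
  by rewrite -[X in is_derive _ _ _ X]mulr1; exact: is_deriveZ.
have h1 := @is_derive1_comp R cos (fun s => a * s) t _ _ (is_derive_cos _) dl.
have h2 := @is_derive1_comp R sin (fun s => a * s) t _ _ (is_derive_sin _) dl.
split; rewrite /cis/=.
  by have -> : (a * 0 - 0 * 1) * cos (a * t) - (a * 1 + 0 * 0) * sin (a * t)
     = - sin (a * t) * a by ring.
by have -> : (a * 0 - 0 * 1) * sin (a * t) + (a * 1 + 0 * 0) * cos (a * t)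
   = cos (a * t) * a by ring.
Qed.

Lemma ReM (z w : R[i]) :
  complex.Re (z * w) = complex.Re z * complex.Re w - complex.Im z * complex.Im w.
Proof. by case: z; case: w. Qed.

Lemma ImM (z w : R[i]) :
  complex.Im (z * w) = complex.Re z * complex.Im w + complex.Im z * complex.Re w.
Proof. by case: z; case: w. Qed.

Lemma cder_cst_mul (k : R[i]) (c : R -> R[i]) t c' : cder c t c' ->
  cder (fun s => k * c s) t (k * c').
Proof.
move=> [h1 h2]; split.
  have -> : (fun s => complex.Re (k * c s)) =
    (complex.Re k \*: (fun s => complex.Re (c s)) -
     complex.Im k \*: (fun s => complex.Im (c s))).
    by apply/funext => s; rewrite ReM.
  by rewrite ReM; apply: is_deriveB; exact: is_deriveZ.
have -> : (fun s => complex.Im (k * c s)) =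
    (complex.Re k \*: (fun s => complex.Im (c s)) +
     complex.Im k \*: (fun s => complex.Re (c s))).
  by apply/funext => s; rewrite ImM.
by rewrite ImM; apply: is_deriveD; exact: is_deriveZ.
Qed.

Lemma cder_real (g : R -> R) (t a : R) (k : R[i]) : is_derive t 1 g a ->
  cder (fun s => (g s)%:C * k) t (a%:C * k).
Proof.
case: k => k1 k2 dg; split.
  have -> : (fun s => complex.Re ((g s)%:C * (k1 +i* k2))) = k1 \*: g.
    by apply/funext => s /=; rewrite mul0r subr0 mulrC.
  by rewrite /= mul0r subr0 mulrC; exact: is_deriveZ.
have -> : (fun s => complex.Im ((g s)%:C * (k1 +i* k2))) = k2 \*: g.
  by apply/funext => s /=; rewrite mul0r addr0 mulrC.
by rewrite /= mul0r addr0 mulrC; exact: is_deriveZ.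
Qed.

(* z^(-b) dz/dr and z^(-b) dz/df for z = r e^(i f). *)
Definition ray_coef (b r f : R) : R[i] := (r `^ (- b))%:C * cis ((1 - b) * f).
Definition arc_coef (b r f : R) : R[i] := 'i * (r * r `^ (- b))%:C * cis ((1 - b) * f).

Lemma ray_coefE b r f : cpowN b r f * cis f = ray_coef b r f.
Proof.
rewrite /cpowN /ray_coef -mulrA -cisD; congr (_ * cis _); ring.
Qed.

Lemma arc_coefE b r f : cpowN b r f * ('i * r%:C * cis f) = arc_coef b r f.
Proof.
transitivity ('i * r%:C * (cpowN b r f * cis f)); first by ring.
by rewrite ray_coefE /ray_coef /arc_coef rmorphM/=; ring.
Qed.

(** Together with [cder_arc]: the angular derivative of the ray coefficient equals the radial
    derivative of the arc coefficient, which is the closedness of z^(-b) dz. *)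
Lemma cder_ray b r f :
  cder (ray_coef b r) f ((1 - b)%:C * 'i * ray_coef b r f).
Proof.
rewrite /ray_coef.
have := cder_cst_mul (r `^ (- b))%:C (cder_cis (1 - b) f).
by congr cder; rewrite !mulrA; congr (_ * _); rewrite -mulrA mulrC.
Qed.

Lemma cder_arc b r f : 0 < r ->
  cder (fun r => arc_coef b r f) r ((1 - b)%:C * 'i * ray_coef b r f).
Proof.
move=> r0; rewrite /ray_coef.
have dp : is_derive r 1 (fun s : R => s * s `^ (- b)) ((1 - b) * r `^ (- b)).
  have h := is_derive1_powR (- b) r0.
  apply: is_derive_eq; rewrite /GRing.scale/= powRB ?oppr_eq0; last first.
    by rewrite lt0r_neq0 ?implybT.
  by rewrite powRr1 ?ltW//; field; exact: lt0r_neq0.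
have := cder_real ('i * cis ((1 - b) * f)) dp.
rewrite /arc_coef => h.
have -> : (1 - b)%:C * 'i * ((r `^ (- b))%:C * cis ((1 - b) * f)) =
    ((1 - b) * r `^ (- b))%:C * ('i * cis ((1 - b) * f)).
  by rewrite rmorphM/=; ring.
have -> : (fun r => 'i * (r * r `^ (- b))%:C * cis ((1 - b) * f)) =
  (fun s => (s * s `^ (- b))%:C * ('i * cis ((1 - b) * f))) by apply/funext => s; ring.
exact: h.
Qed.

(** The sum of the endpoint values serves increasing and decreasing powers alike. *)
Lemma powR_itv_le (b r0 r1 r : R) : 0 < r0 -> r \in `[r0, r1] ->
  r `^ b <= r0 `^ b + r1 `^ b.
Proof.
move=> r00; rewrite in_itv/= => /andP[h0 h1].
have rg : 0 < r by exact: lt_le_trans h0.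
have r1g : 0 < r1 by exact: lt_le_trans h1.
have [b0|b0] := leP 0 b.
  by rewrite (@le_trans _ _ (r1 `^ b)) ?lerDr ?powR_ge0// ge0_ler_powR// nnegrE ltW.
rewrite (@le_trans _ _ (r0 `^ b)) ?lerDl ?powR_ge0//.
rewrite -(opprK b) !(powRN _ (- b)) lef_pV2 ?posrE ?powR_gt0//.
by apply: ge0_ler_powR; rewrite ?nnegrE ?oppr_ge0// ltW.
Qed.

Lemma within_rfun_scale E (l : E -> R) (c : R -> R[i]) (F : R -> E) (D : set R) :
  rfun l -> (forall t, D t -> exists c', cder c t c') ->
  {within D, continuous F} -> {within D, continuous (fun t => l (c t *: F t))}.
Proof.
move=> hl hc cF; have hil := rfunZ 'i hl.
have cl := rfun_within hl cF; have cil := rfun_within hil cF.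
apply: (@within_ext _ _ _ (fun t => complex.Re (c t) * (l \o F) t +
    complex.Im (c t) * ((fun x => l ('i *: x)) \o F) t)).
  by move=> t _; rewrite (rfun_scale _ _ hl).
have cc (g : R -> R) : (forall t, D t -> derivable g t 1) -> {within D, continuous g}.
  move=> dg; apply/subspace_continuousP => t /dg h.
  apply: cvg_within_filter.
  exact/differentiable_continuous/derivable1_diffP.
have c1 : {within D, continuous (fun s => complex.Re (c s))}.
  by apply: cc => t /hc[c' [[]]].
have c2 : {within D, continuous (fun s => complex.Im (c s))}.
  by apply: cc => t /hc[c' [_ []]].
by move=> x; apply: cvgD; apply: cvgM; [exact: c1|exact: cl|exact: c2|exact: cil].
Qed.

Lemma ccont_within E K (f : R[i] -> E) (z : R -> R[i]) (D : set R) :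
  (forall w, K w -> ccont K f w) -> (forall t, D t -> K (z t)) ->
  (forall t, D t -> exists z', cder z t z') -> {within D, continuous (f \o z)}.
Proof.
move=> cf Kz dz; apply/subspace_continuousP => t Dt; apply/cvg_nrmP => e e0.
have [d d0 hd] := cf _ (Kz _ Dt) e e0; have [z' cz] := dz _ Dt.
apply: filterS (cder_cont cz d0) => s sd Ds.
by rewrite /= nrmB; apply: hd => //; exact: Kz.
Qed.

Lemma hol_ccont E K (f f' : R[i] -> E) : hol K f f' -> forall w, K w -> ccont K f w.
Proof.
move=> hf w Kw e e0; have [g [_ fg cg]] := hf w Kw.
have [d d0 hd] := cg 1 ltr01.
pose M := nrm (g w) + 1; have M0 : 0 < M by rewrite ltr_wpDl ?nrm_ge0.
exists (Num.min d (e / M)); first by rewrite lt_min d0 divr_gt0.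
move=> v Kv; rewrite lt_min => /andP[vd ve]; rewrite fg// nrmZ.
rewrite (@le_lt_trans _ _ (normc (v - w) * M))//; last by rewrite -ltr_pdivlMr.
rewrite ler_wpM2l ?normc_ge0// /M -(subrK (g w) (g v)) (le_trans (nrmD _ _))// addrC lerD2l.
by rewrite ltW// hd.
Qed.

Lemma polar_bound E K (f : R[i] -> E) (r0 r1 f0 f1 : R) :
  (forall w, K w -> ccont K f w) ->
  (forall r p, r \in `[r0, r1] -> p \in `[f0, f1] -> K (r%:C * cis p)) ->
  exists2 M : R, 0 < M &
    forall r p, r \in `[r0, r1] -> p \in `[f0, f1] -> nrm (f (r%:C * cis p)) <= M.
Proof.
move=> cf hK.
pose A := `[r0, r1]%classic `*` `[f0, f1]%classic : set (R * R).
have cA : compact A by apply: compact_setX; exact: segment_compact.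
have cF : {within A, continuous (fun x : R * R => nrm (f (x.1%:C * cis x.2)))}.
  apply/subspace_continuousP => -[r p] [/= hr hp].
  apply: cvg_nrm; apply/cvg_nrmP => e e0.
  have [d d0 hd] := cf _ (hK _ _ hr hp) e e0.
  have d2 : 0 < d / 2 by rewrite divr_gt0.
  have c1 : (x.1 * cos x.2) @[x --> (r, p)] --> r * cos p.
    apply: cvgM; first exact: cvg_fst.
    by apply: continuous_comp; [exact: cvg_snd|exact: continuous_cos].
  have c2 : (x.1 * sin x.2) @[x --> (r, p)] --> r * sin p.
    apply: cvgM; first exact: cvg_fst.
    by apply: continuous_comp; [exact: cvg_snd|exact: continuous_sin].
  move/cvgrPdist_lt : c1 => /(_ _ d2); move/cvgrPdist_lt : c2 => /(_ _ d2).
  apply: filterS2 => -[s q] /= h1 h2 [/= hs hq]; rewrite nrmB; apply: hd; first exact: hK.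
  rewrite (le_lt_trans (normc_le _))// [ltRHS]splitr ltrD//.
    have -> : complex.Re (s%:C * cis q - r%:C * cis p) = s * cos q - r * cos p.
      by rewrite /cis/=; ring.
    by rewrite distrC.
  have -> : complex.Im (s%:C * cis q - r%:C * cis p) = s * sin q - r * sin p.
    by rewrite /cis/=; ring.
  by rewrite distrC.
have /compact_bounded[M [_ hM]] := continuous_compact cF cA.
exists (`|M| + 1); first by rewrite ltr_wpDl.
move=> r p hr hp.
have := hM (`|M| + 1); rewrite (le_lt_trans (ler_norm M)) ?ltrDl// => /(_ isT).
move=> /(_ (nrm (f (r%:C * cis p)))).
move=> H; have := H (ex_intro2 _ _ (r, p) (conj hr hp) erefl).
by apply: le_trans; exact: ler_norm.
Qed.

Definition polar (r f : R) : R[i] := r%:C * cis f.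

Lemma cder_polar_r (r f : R) : cder (fun r => polar r f) r (cis f).
Proof.
by rewrite -[cis f]mul1r; apply: (@cder_real id); exact: is_derive_id.
Qed.

Lemma cder_polar_f (r f : R) : cder (polar r) f ('i * polar r f).
Proof.
rewrite /polar; have := cder_cst_mul r%:C (cder_cis 1 f).
have -> : r%:C * (1%:C * 'i * cis (1 * f)) = 'i * (r%:C * cis f) by rewrite !mul1r; ring.
by under eq_fun do rewrite mul1r.
Qed.

Lemma normc_polar (r f : R) : 0 <= r -> normc (polar r f) = r.
Proof. by move=> r0; rewrite normcM normcR normc_cis mulr1 ger0_norm. Qed.

End polar_cauchy.

Section polar_cauchy_thm.
Context {R : realType}.
Notation mu := (@lebesgue_measure R).
Implicit Types E : normedModType R[i].

Lemma normc_ray_coef (b r p : R) : normc (ray_coef b r p) = r `^ (- b).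
Proof. by rewrite normcM normcR normc_cis mulr1 ger0_norm ?powR_ge0. Qed.

Lemma normc_arc_coef (b r p : R) : 0 <= r -> normc (arc_coef b r p) = r * r `^ (- b).
Proof.
move=> r0; rewrite !normcM normcR normc_cis normc_i mulr1 mul1r.
by rewrite ger0_norm ?mulr_ge0 ?powR_ge0.
Qed.

Lemma rfun_le E (l : E -> R) M x : (forall x, `|l x| <= M * nrm x) -> 0 <= M ->
  forall (c : R[i]) a b, normc c <= a -> nrm x <= b -> `|l (c *: x)| <= M * (a * b).
Proof.
move=> hM M0 c a b ca xb; rewrite (le_trans (hM _))// ler_wpM2l// nrmZ.
by rewrite ler_pM ?nrm_ge0 ?normc_ge0.
Qed.

(* Cauchy's theorem for z^(-b) f z on an annular sector, by Green's formula in polar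
   coordinates. *)
Lemma polar_cauchy E (K : set R[i]) (f f' : R[i] -> E) (b r0 r1 f0 f1 : R) :
  0 < r0 -> r0 < r1 -> f0 < f1 ->
  (forall r p, r \in `[r0, r1] -> p \in `[f0, f1] -> K (polar r p)) ->
  hol K f f' -> (forall z, K z -> ccont K f' z) ->
  forall l, rfun l ->
  \int[mu]_(p in `[f0, f1]) l (arc_coef b r1 p *: f (polar r1 p)) -
  \int[mu]_(p in `[f0, f1]) l (arc_coef b r0 p *: f (polar r0 p)) =
  \int[mu]_(r in `[r0, r1]) (l (ray_coef b r f1 *: f (polar r f1)) -
                             l (ray_coef b r f0 *: f (polar r f0))).
Proof.
move=> r00 r01 f01 hK hf cf' l hl; have cf := hol_ccont hf.
have [M M0 hM] := polar_bound cf hK; have [M' M'0 hM'] := polar_bound cf' hK.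
have [L L0 hL] := rfun_bound hl.
pose P := r0 `^ (- b) + r1 `^ (- b).
have P0 : 0 <= P by rewrite addr_ge0 ?powR_ge0.
have rpos r : r \in `[r0, r1] -> 0 < r.
  by rewrite in_itv/= => /andP[h _]; exact: lt_le_trans h.
have rle r : r \in `[r0, r1] -> r <= r1 by rewrite in_itv/= => /andP[].
have rP r : r \in `[r0, r1] -> r `^ (- b) <= P by move=> hr; exact: powR_itv_le.
have r1g : 0 < r1 by exact: lt_trans r01.
pose Dv r p : E := ((1 - b)%:C * 'i * ray_coef b r p) *: f (polar r p)
   + ray_coef b r p *: (('i * polar r p) *: f' (polar r p)).
(* The first two summands bound the two terms of [Dv], the third bounds the arc integrand; Green's
   formula asks for a single constant. *)
pose C := L * ((`|1 - b| * P) * M) + L * ((P * r1) * M') + L * ((r1 * P) * M).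
have C1 : 0 <= L * ((`|1 - b| * P) * M) by do !apply: mulr_ge0 => //; exact: ltW.
have C2 : 0 <= L * ((P * r1) * M') by do !apply: mulr_ge0 => //; exact: ltW.
have C3 : 0 <= L * ((r1 * P) * M) by do !apply: mulr_ge0 => //; exact: ltW.
have sub_r r : r \in `]r0, r1[ -> r \in `[r0, r1] by exact: subset_itv_oo_cc.
have sub_f p : p \in `]f0, f1[ -> p \in `[f0, f1] by exact: subset_itv_oo_cc.
have near_oo (x y z : R) (Q : R -> Prop) : z \in `]x, y[ ->
    (forall w, w \in `[x, y] -> Q w) -> \forall w \near z, Q w.
  move=> hz hQ; have := near_in_itvoo hz; apply: filterS => w hw; apply: hQ.
  exact: subset_itv_oo_cc.
have fr r p : r \in `]r0, r1[ -> p \in `[f0, f1] ->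
    is_derive r 1 (fun r => l (arc_coef b r p *: f (polar r p))) (l (Dv r p)).
  move=> hr hp.
  have rg := rpos _ (sub_r _ hr).
  have w1 : wder (f \o (fun r => polar r p)) r (cis p *: f' (polar r p)).
    apply: (@wder_hol R E K f f' (fun r => polar r p) r (cis p) hf (hK _ _ (sub_r _ hr) hp) _ (cder_polar_r r p)).
    by apply: (near_oo r0 r1) => // s hs; exact: hK.
  have := wder_scale (cder_arc b p rg) w1 hl.
  (* The arc coefficient times dz/dr equals the ray coefficient times dz/df, so both partial
     derivatives are [Dv]. *)
  suff -> : arc_coef b r p *: (cis p *: f' (polar r p)) =
      ray_coef b r p *: (('i * polar r p) *: f' (polar r p)) by [].
  rewrite !scalerA -arc_coefE -ray_coefE /polar; congr (_ *: _); ring.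
have ff r p : r \in `[r0, r1] -> p \in `]f0, f1[ ->
    is_derive p 1 (fun p => l (ray_coef b r p *: f (polar r p))) (l (Dv r p)).
  move=> hr hp.
  have w1 : wder (f \o (polar r)) p (('i * polar r p) *: f' (polar r p)).
    apply: (@wder_hol R E K f f' (polar r) p _ hf (hK _ _ hr (sub_f _ hp)) _ (cder_polar_f r p)).
    by apply: (near_oo f0 f1) => // s hs; exact: hK.
  exact: (wder_scale (cder_ray b r p) w1 hl).
have cwf r (g : R[i] -> E) : (forall z, K z -> ccont K g z) -> r \in `[r0, r1] ->
    {within `[f0, f1], continuous (g \o polar r)}.
  move=> cg hr; apply: (ccont_within cg) => p hp; first exact: hK.
  by eexists; exact: cder_polar_f.
have cwr p : p \in `[f0, f1] ->
    {within `[r0, r1], continuous (f \o (fun r => polar r p))}.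
  move=> hp; apply: (ccont_within cf) => r hr; first exact: hK.
  by eexists; exact: cder_polar_r.
have crr p : p \in `[f0, f1] ->
    {within `[r0, r1], continuous (fun r => l (ray_coef b r p *: f (polar r p)))}.
  move=> hp; apply: (within_rfun_scale hl _ (cwr p hp)) => r /rpos rg.
  by eexists; apply: cder_real; exact: is_derive1_powR.
pose pp := fun r q => l (arc_coef b r q *: f (polar r q)).
pose qq := fun r t => l (ray_coef b r t *: f (polar r t)).
pose DD := fun r t => l (Dv r t).
have g0 : forall r t, r \in `]r0, r1[ -> t \in `[f0, f1] ->
     is_derive r 1 (fun r => pp r t) (DD r t) /\ `|DD r t| <= C.
  move=> r p hr hp; split; first exact: fr.
  have hr' := sub_r _ hr; have [lD _ _] := hl.
  rewrite /DD /Dv lD (le_trans (ler_normD _ _))// /C ler_wpDr// lerD//.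
    apply: (rfun_le hL (ltW L0)); last exact: hM.
    rewrite normcM normc_ray_coef normcM normcR normc_i mulr1.
    by rewrite ler_wpM2l// rP// sub_r.
  rewrite scalerA; apply: (rfun_le hL (ltW L0)); last exact: hM'.
  rewrite normcM normc_ray_coef normcM normc_i mul1r.
  rewrite normc_polar; last by rewrite ltW// rpos.
  by apply: ler_pM; rewrite ?powR_ge0 ?rP ?rle// ltW// rpos.
have g1 : forall r t, r \in `]r0, r1[ -> t \in `]f0, f1[ -> is_derive t 1 (qq r) (DD r t).
  by move=> r p hr hp; apply: ff => //; exact: sub_r.
have g2 : forall r, r \in `]r0, r1[ -> {within `[f0, f1], continuous (DD r)} /\
     {within `[f0, f1], continuous (qq r)}.
  move=> r /sub_r hr; split.
    have cc1 := cwf r _ cf hr; have cc2 := cwf r _ cf' hr.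
    apply: (@within_ext _ _ _ (fun p => l (((1 - b)%:C * 'i * ray_coef b r p) *: f (polar r p)) +
      l ((ray_coef b r p * ('i * polar r p)) *: f' (polar r p)))).
      by move=> p _; rewrite /DD /Dv; case: (hl) => -> _ _; rewrite scalerA.
    have k1 : {within `[f0, f1], continuous (fun p =>
        l (((1 - b)%:C * 'i * ray_coef b r p) *: f (polar r p)))}.
      apply: (within_rfun_scale hl _ cc1) => p hp.
      by eexists; apply: cder_cst_mul; exact: cder_ray.
    have k2 : {within `[f0, f1], continuous (fun p =>
        l ((ray_coef b r p * ('i * polar r p)) *: f' (polar r p)))}.
      apply: (within_rfun_scale hl _ cc2) => p hp.
      have -> : (fun p => ray_coef b r p * ('i * polar r p)) =
          (fun p => ((r `^ (- b))%:C * 'i * r%:C) * cis ((1 - b + 1) * p)).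
        apply/funext => q; have -> : (1 - b + 1) * q = (1 - b) * q + q by ring.
        by rewrite cisD /ray_coef /polar; ring.
      by eexists; apply: cder_cst_mul; exact: cder_cis.
    by move=> x; apply: cvgD; [exact: k1|exact: k2].
  apply: (within_rfun_scale hl _ (cwf r _ cf hr)) => p hp.
  by eexists; exact: cder_ray.
have g3 : forall r, r \in `[r0, r1] -> {within `[f0, f1], continuous (pp r)}.
  move=> r hr; apply: (within_rfun_scale hl _ (cwf r _ cf hr)) => p hp.
  have -> : arc_coef b r = fun p => ('i * (r * r `^ (- b))%:C) * cis ((1 - b) * p) by [].
  by eexists; apply: cder_cst_mul; exact: cder_cis.
have g4 : forall t, t \in `[f0, f1] -> {within `[r0, r1], continuous (pp ^~ t)}.
  move=> p hp; apply: (within_rfun_scale hl _ (cwr p hp)) => r /rpos rg.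
  by eexists; exact: cder_arc.
have g5 : forall r t, r \in `[r0, r1] -> t \in `[f0, f1] -> `|pp r t| <= C.
  move=> r p hr hp; have rg := ltW (rpos _ hr).
  rewrite (@le_trans _ _ (L * ((r1 * P) * M)))//; last by rewrite /C lerDr addr_ge0.
  apply: (rfun_le hL (ltW L0)); last exact: hM.
  rewrite normc_arc_coef//.
  by apply: ler_pM; rewrite ?powR_ge0 ?rP ?rle.
have g6 : {within `[r0, r1], continuous (fun r => qq r f1 - qq r f0)}.
  have k1 := crr f1; have k0 := crr f0; move=> x; apply: cvgB.
    by apply: k1; rewrite in_itv/= lexx ltW.
  by apply: k0; rewrite in_itv/= lexx ltW.
exact: (@green_rectangle R pp qq DD r0 r1 f0 f1 C r01 f01 g0 g1 g2 g3 g4 g5 g6).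
Qed.

End polar_cauchy_thm.

(** * Integrals over the half-line *)

Section halfline_integrals.
Context {R : realType}.
Notation mu := (@lebesgue_measure R).
Notation mset := (@measurable _ (measurableTypeR R)).
Notation pos := (`]0%R, +oo[%classic : set R).

(** The scaled push-forward agrees with Lebesgue measure on half-open intervals, and these determine
    it. *)
Lemma lebesgue_dilation (c : R) (A : set R) : 0 < c -> mset A ->
  mu A = (c%:E * mu ((fun x => (c * x)%R) @^-1` A))%E.
Proof.
move=> c0 mA.
pose phi : measurableTypeR R -> measurableTypeR R := fun x => c * x.
have mphi : measurable_fun setT phi by exact: measurable_funM.
have -> : (c%:E * mu ((fun x => (c * x)%R) @^-1` A))%E =
  mscale (NngNum (ltW c0)) (pushforward mu phi) A by [].
apply: lebesgue_measure_unique => //= _ [[a b]] _ <-.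
rewrite /mscale/= /pushforward.
have -> : phi @^-1` `]a, b] = `](a / c), (b / c)]%classic.
  apply/seteqP; split=> x /=; rewrite !in_itv/= /phi.
    by rewrite ltr_pdivrMr// ler_pdivlMr// ![x * c]mulrC.
  by rewrite ltr_pdivrMr// ler_pdivlMr// ![x * c]mulrC.
rewrite !lebesgue_measure_itv/= !lte_fin ltr_pM2r ?invr_gt0//.
case: ifP => _; last by rewrite mule0.
by rewrite -!EFinD -EFinM -mulrBl mulrCA divff ?lt0r_neq0// mulr1.
Qed.

Lemma lebesgue_translation (h : R) (A : set R) : mset A ->
  mu A = mu ((fun x => (x + h)%R) @^-1` A).
Proof.
move=> mA.
pose phi : measurableTypeR R -> measurableTypeR R := fun x => x + h.
have mphi : measurable_fun setT phi by exact: measurable_funD.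
have -> : mu ((fun x => (x + h)%R) @^-1` A) = pushforward mu phi A by [].
apply: lebesgue_measure_unique => //= _ [[a b]] _ <-.
rewrite /pushforward.
have -> : phi @^-1` `]a, b] = `](a - h), (b - h)]%classic.
  by apply/seteqP; split=> x /=; rewrite !in_itv/= /phi ltrBlDr lerBrDr.
rewrite !lebesgue_measure_itv/= !lte_fin ltrD2r.
by case: ifP => _ //; rewrite -!EFinD; congr (_%:E); ring.
Qed.

Lemma ge0_dilation (f : R -> \bar R) (c : R) : 0 < c ->
  @measurable_fun _ _ (measurableTypeR R) _ pos f -> (forall x : R, (0 < x)%R -> 0 <= f x)%E ->
  (c%:E * \int[mu]_(s in pos) f (c * s)%R = \int[mu]_(s in pos) f s)%E.
Proof.
move=> c0 mf f0.
pose phi : measurableTypeR R -> measurableTypeR R := fun x => c * x.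
have mphi : measurable_fun setT phi by exact: measurable_funM.
have E : pos = phi @^-1` pos.
  by apply/seteqP; split=> x /=; rewrite !in_itv/= !andbT /phi pmulr_rgt0.
have f0' : {in pos, forall y, (0 <= f y)%E}.
  by move=> x; rewrite inE/= in_itv/= andbT; exact: f0.
have -> : (\int[mu]_(s in pos) f (c * s)%R)%E = (\int[pushforward mu phi]_(s in pos) f s)%E.
  by rewrite ge0_integral_pushforward// -E.
rewrite -(ge0_integral_mscale _ _ (NngNum (ltW c0)))//; last first.
  by move=> x xp; apply: f0'; rewrite inE.
apply: eq_measure_integral => A mA _.
by first [exact: (lebesgue_dilation c0 mA)|exact/esym/(lebesgue_dilation c0 mA)].
Qed.

Lemma ge0_translation (f : R -> \bar R) (h : R) :
  @measurable_fun _ _ (measurableTypeR R) _ `]h, +oo[%classic f ->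
  (forall x : R, (h < x)%R -> 0 <= f x)%E ->
  (\int[mu]_(s in pos) f (s + h)%R = \int[mu]_(s in `]h, +oo[) f s)%E.
Proof.
move=> mf f0.
pose phi : measurableTypeR R -> measurableTypeR R := fun x => x + h.
have mphi : measurable_fun setT phi by exact: measurable_funD.
have E : pos = phi @^-1` `]h, +oo[%classic.
  by apply/seteqP; split=> x /=; rewrite !in_itv/= !andbT /phi ltrDr.
have f0' : {in `]h, +oo[%classic, forall y, (0 <= f y)%E}.
  by move=> x; rewrite inE/= in_itv/= andbT; exact: f0.
have -> : (\int[mu]_(s in pos) f (s + h)%R)%E =
    (\int[pushforward mu phi]_(s in `]h, +oo[) f s)%E.
  by rewrite ge0_integral_pushforward// -E.
apply: eq_measure_integral => A mA _.
by first [exact: (lebesgue_translation h mA)|exact/esym/(lebesgue_translation h mA)].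
Qed.

(** The positive and negative parts are treated separately by [ge0_dilation]; integrability is the
    same identity for |f|. *)
Lemma dilation (f : R -> R) (c : R) : 0 < c -> mu.-integrable pos (EFin \o f) ->
  mu.-integrable pos (EFin \o (fun s => f (c * s))) /\
  \int[mu]_(s in pos) f (c * s) = c^-1 * \int[mu]_(s in pos) f s.
Proof.
move=> c0 intf.
have mf : @measurable_fun _ _ (measurableTypeR R) _ pos (EFin \o f) := measurable_int _ intf.
have mc : @measurable_fun _ _ (measurableTypeR R) _ pos (EFin \o (fun s => f (c * s))).
  apply: (@measurable_comp _ _ _ _ (measurableTypeR R) _ pos (EFin \o f) pos (fun s => c * s)) => //.
    by move=> _ [x xp <-]; move: xp; rewrite /= !in_itv/= !andbT => h; exact: mulr_gt0.
  exact: measurable_funM.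
have scal (x y : \bar R) : (c%:E * x = y)%E -> (x = (c^-1)%:E * y)%E.
  by move=> <-; rewrite muleA -EFinM mulVf ?lt0r_neq0// mul1e.
have ic : mu.-integrable pos (EFin \o (fun s => f (c * s))).
  apply/integrableP; split => //.
  have ma : @measurable_fun _ _ (measurableTypeR R) _ pos (fun x => `|(f x)%:E|%E).
    exact: measurableT_comp.
  have /scal/= -> := @ge0_dilation _ c c0 ma (fun x _ => abse_ge0 _).
  by rewrite lte_mul_pinfty ?lee_fin ?invr_ge0 ?ltW//; case/integrableP : intf.
split => //; rewrite /Rintegral.
have P := @ge0_dilation (EFin \o f)^\+%E c c0 (measurable_funepos mf) (fun x _ => funepos_ge0 _ _).
have N := @ge0_dilation (EFin \o f)^\-%E c c0 (measurable_funeneg mf) (fun x _ => funeneg_ge0 _ _).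
rewrite integralE [in RHS]integralE.
have -> : (\int[mu]_(s in pos) (fun s => (f (c * s)%R)%:E)^\+ s)%E =
          (\int[mu]_(s in pos) (EFin \o f)^\+ (c * s)%R)%E.
  by apply: eq_integral => s _; rewrite !funeposE.
have -> : (\int[mu]_(s in pos) (fun s => (f (c * s)%R)%:E)^\- s)%E =
          (\int[mu]_(s in pos) (EFin \o f)^\- (c * s)%R)%E.
  by apply: eq_integral => s _; rewrite !funenegE.
rewrite (scal _ _ P) (scal _ _ N).
have mp : mset pos by exact: measurable_itv.
have fp := integrable_fin_num mp (integrable_funepos mp intf).
have fn := integrable_fin_num mp (integrable_funeneg mp intf).
rewrite -muleBr//; last by rewrite fin_num_adde_defr// fn.
by rewrite fineM//= fin_numB fp// fn.
Qed.

Lemma pos_bigcup : pos = \bigcup_n `[n.+1%:R^-1, n.+1%:R]%classic.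
Proof.
apply/seteqP; split=> x /=; rewrite in_itv/= andbT.
  move=> x0.
  have [N1 _ h1] := near_infty_natSinv_lt (PosNum x0).
  pose N := maxn N1 (Num.truncn x); exists N => //=; rewrite in_itv/=; apply/andP; split.
    rewrite (le_trans _ (ltW (h1 N1 (leqnn _))))// lef_pV2 ?posrE ?ltr0n// ler_nat ltnS.
    exact: leq_maxl.
  by rewrite ltW// (lt_le_trans (truncnS_gt x))// ler_nat ltnS leq_maxr.
move=> [n _] /=; rewrite in_itv/= => /andP[h _]; apply: lt_le_trans h.
by rewrite invr_gt0.
Qed.

Lemma pos_exhaust_nd : nondecreasing_seq (fun n => `[n.+1%:R^-1, n.+1%:R]%classic : set R).
Proof.
move=> m n mn; apply/subsetPset => x /=; rewrite !in_itv/= => /andP[h1 h2].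
apply/andP; split.
  by apply: le_trans h1; rewrite lef_pV2 ?posrE ?ltr0n// ler_nat ltnS.
by apply: (le_trans h2); rewrite ler_nat ltnS.
Qed.

(** By the fundamental theorem the integral over [1/n, n] is a difference of two values of [F],
    hence at most [2 * C]; monotone convergence passes to the half-line. *)
Lemma integrable_prim (f F : R -> R) (C : R) :
  (forall s : R, 0 < s -> 0 <= f s) -> (forall s : R, 0 < s -> is_derive s 1 F (f s)) ->
  (forall s : R, 0 < s -> {for s, continuous f}) -> (forall s : R, 0 < s -> `|F s| <= C) ->
  mu.-integrable pos (EFin \o f).
Proof.
move=> f0 dF cf bF.
have pw n : {within `[n.+1%:R^-1, n.+1%:R], continuous f}.
  apply: continuous_in_subspaceT => x; rewrite inE/= in_itv/= => /andP[h _].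
  by apply: cf; apply: lt_le_trans h; rewrite invr_gt0.
have mn n : measurable_fun (`[n.+1%:R^-1, n.+1%:R]%classic : set R) f.
  by apply: subspace_continuous_measurable_fun => //; exact: pw.
have mf : measurable_fun pos f.
  by rewrite pos_bigcup; apply/measurable_fun_bigcup => // n; exact: mn.
have mfe : @measurable_fun _ _ (measurableTypeR R) _ pos (EFin \o f) by exact/measurable_EFinP.
have In n : (\int[mu]_(s in `[(n.+1%:R^-1)%R, n.+1%:R%R]) (f s)%:E <= (2 * C)%:E)%E.
  have h0 : 0 < n.+1%:R^-1 :> R by rewrite invr_gt0.
  have C0 : 0 <= C by apply: le_trans (bF _ h0).
  (* For [n = 0] the segment degenerates to the point 1. *)
  case: n h0 => [|n] h0; first by rewrite invr1 set_itv1 integral_set1 lee_fin mulr_ge0.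
  have ab : n.+2%:R^-1 < n.+2%:R :> R.
    by rewrite (@lt_trans _ _ 1)// ?ltr1n// invf_lt1 ?ltr1n.
  have dF' (x : R) : x \in `]n.+2%:R^-1, n.+2%:R[ -> is_derive x 1 F (f x).
    by rewrite in_itv/= => /andP[h _]; apply: dF; exact: lt_trans h.
  have cF : {within `[n.+2%:R^-1, n.+2%:R], continuous F}.
    apply: continuous_in_subspaceT => x; rewrite inE/= in_itv/= => /andP[h _].
    have [d _] := dF _ (lt_le_trans h0 h).
    exact/differentiable_continuous/derivable1_diffP.
  have ii := cont_integrable (pw n.+1).
  rewrite -(@fineK _ (\int[mu]_(s in _) _)%E); last exact: integrable_fin_num ii.
  rewrite lee_fin; have := Rint_FTC2 ab (pw n.+1) cF dF'; rewrite /Rintegral => ->.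
  have := bF _ (lt_trans h0 ab); have := bF _ h0; rewrite !ler_norml => /andP[? ?] /andP[? ?].
  lra.
apply/integrableP; split => //.
have -> : (\int[mu]_(x in pos) `|(EFin \o f) x|)%E = (\int[mu]_(x in pos) (f x)%:E)%E.
  by apply: eq_integral => x; rewrite inE/= in_itv/= andbT => /f0 h; rewrite ger0_norm.
apply: (@le_lt_trans _ _ (2 * C)%:E); last exact: ltry.
have mI n : mset `[n.+1%:R^-1, n.+1%:R]%classic by exact: measurable_itv.
have mfI n : @measurable_fun _ _ (measurableTypeR R) _ (`[n.+1%:R^-1, n.+1%:R]%classic) (EFin \o f).
  by apply/measurable_EFinP; exact: mn.
have fn0 : forall i x, `[i.+1%:R^-1, i.+1%:R]%classic x -> (0 <= (EFin \o f) x)%E.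
  move=> i x /=; rewrite in_itv/= => /andP[h _]; rewrite lee_fin f0//.
  by apply: lt_le_trans h; rewrite invr_gt0.
have := @ge0_nondecreasing_set_cvg_integral _ (measurableTypeR R) R _ (EFin \o f) mu
  pos_exhaust_nd mI mfI fn0.
rewrite -pos_bigcup => H; rewrite -(cvg_lim _ H)//; apply: lime_le.
  by apply/cvg_ex; eexists; exact: H.
by apply: nearW => n; exact: In.
Qed.

End halfline_integrals.

Section halfline_tools.
Context {R : realType}.
Notation mu := (@lebesgue_measure R).
Notation mR := (measurableTypeR R).
Notation mset := (@measurable _ (measurableTypeR R)).
Notation pos := (`]0%R, +oo[%classic : set R).

Lemma posE (x : R) : pos x = (0 < x).
Proof. by rewrite /= in_itv/= andbT. Qed.

Lemma mpos : mset pos. Proof. exact: measurable_itv. Qed.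

Lemma cont_pos_measurable (f : R -> R) : (forall s : R, 0 < s -> {for s, continuous f}) ->
  @measurable_fun _ _ mR _ pos f.
Proof.
move=> cf; have : measurable_fun pos f.
  apply: subspace_continuous_measurable_fun => //.
  by apply: continuous_in_subspaceT => x; rewrite inE posE; exact: cf.
by [].
Qed.

Lemma pos_integrable_le (f g : R -> R) : @measurable_fun _ _ mR _ pos f ->
  (forall s : R, 0 < s -> `|f s| <= g s) -> mu.-integrable pos (EFin \o g) ->
  mu.-integrable pos (EFin \o f).
Proof.
move=> mf fg ig; apply: (le_integrable mpos _ _ ig).
  exact/measurable_EFinP.
move=> s; rewrite posE => s0 /=; rewrite lee_fin (le_trans (fg _ s0))//.
exact: ler_norm.
Qed.

Lemma pos_integrableZ (f : R -> R) (c : R) : mu.-integrable pos (EFin \o f) ->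
  mu.-integrable pos (EFin \o (fun s => c * f s)).
Proof. by move=> h; have := integrableZl mpos c h. Qed.

Lemma pos_integrableD (f g : R -> R) : mu.-integrable pos (EFin \o f) ->
  mu.-integrable pos (EFin \o g) -> mu.-integrable pos (EFin \o (fun s => f s + g s)).
Proof. by move=> h k; have := integrableD mpos h k. Qed.

Lemma cont_powR (a s : R) : 0 < s -> {for s, continuous (fun x : R => x `^ a)}.
Proof.
move=> s0; have [d _] := is_derive1_powR a s0.
exact/differentiable_continuous/derivable1_diffP.
Qed.

Lemma cont_add1 (s : R) : {for s, continuous (fun x : R => 1 + x)}.
Proof. by apply: cvgD; [exact: cvg_cst|exact: cvg_id]. Qed.

Lemma cont_powR1 (a s : R) : 0 < s -> {for s, continuous (fun x : R => (1 + x) `^ a)}.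
Proof.
move=> s0; apply: (@continuous_comp R R R (fun x : R => 1 + x) (fun x : R => x `^ a) s).
  exact: cont_add1.
by apply: cont_powR; lra.
Qed.

Lemma cont_expRN (w s : R) : {for s, continuous (fun x : R => expR (- w * x))}.
Proof.
apply: (@continuous_comp R R R (fun x : R => - w * x) expR s); last exact: continuous_expR.
by apply: cvgM; [exact: cvg_cst|exact: cvg_id].
Qed.

Lemma powR_N_anti (p x y : R) : 0 <= p -> 0 < x -> x <= y -> y `^ (- p) <= x `^ (- p).
Proof.
move=> p0 x0 xy; have y0 : 0 < y by exact: lt_le_trans xy.
by rewrite !powRN lef_pV2 ?posrE ?powR_gt0// ge0_ler_powR// nnegrE ltW.
Qed.

(** The derivative of the bounded function (s / (1 + s))^(1 - p): a comparison function with
    singularity s^(-p) at 0 and decay s^(-2) at infinity, integrable by [integrable_prim]. *)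
Let f0 (p s : R) : R := (1 - p) * (s * (1 + s)^-1) `^ (- p) * (1 + s) ^- 2.

Let int_f0 (p : R) : 0 <= p < 1 -> mu.-integrable pos (EFin \o f0 p).
Proof.
move=> /andP[p0 p1].
have g0 (s : R) : 0 < s -> 0 < s * (1 + s)^-1.
  by move=> s0; rewrite mulr_gt0// invr_gt0; lra.
have cg (s : R) : 0 < s -> {for s, continuous (fun s : R => s * (1 + s)^-1)}.
  move=> s0; apply: cvgM; first exact: cvg_id.
  by apply: cvgV; [rewrite lt0r_neq0//; lra|exact: cont_add1].
apply: (@integrable_prim R (f0 p) (fun s => (s * (1 + s)^-1) `^ (1 - p)) 1).
- by move=> s s0; rewrite /f0 !mulr_ge0 ?powR_ge0 ?invr_ge0 ?exprn_ge0//; lra.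
- move=> s s0; have s1 : 1 + s != 0 by rewrite lt0r_neq0//; lra.
  have d1 : is_derive s 1 (fun s : R => s * (1 + s)^-1) ((1 + s) ^- 2).
    have dv : is_derive s 1 (fun s : R => (1 + s)^-1) (- (1 + s) ^- 2).
      have da : is_derive s 1 (fun s : R => 1 + s) 1.
        by rewrite -[X in is_derive _ _ _ X]add0r; exact: is_deriveD.
      by have := is_deriveV s1 da; rewrite /GRing.scale/= mulr1.
    apply: is_derive_eq; rewrite /GRing.scale/=; field; exact: s1.
  have d2 := is_derive1_powR (1 - p) (g0 _ s0).
  have := @is_derive1_comp R (fun x => x `^ (1 - p)) (fun s => s * (1 + s)^-1) s _ _ d2 d1.
  by rewrite /f0 addrAC subrr add0r.
- move=> s s0; apply: cvgM; last first.
    apply: cvgV; first by rewrite lt0r_neq0// exprn_gt0//; lra.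
    apply: (@continuous_comp R R R (fun s : R => 1 + s) (fun x : R => x ^+ 2) s).
      exact: cont_add1.
    exact: exprn_continuous.
  apply: cvgM; first exact: cvg_cst.
  apply: (@continuous_comp R R R (fun s : R => s * (1 + s)^-1) (fun x : R => x `^ (- p)) s).
    exact: cg.
  by apply: cont_powR; exact: g0.
- move=> s s0; rewrite ger0_norm ?powR_ge0//.
  have h : 0 < s * (1 + s)^-1 <= 1.
    by rewrite g0// ler_pdivrMr ?mul1r; lra.
  have p1' : 0 <= 1 - p by lra.
  by have := ger_powR h p1'; rewrite powRr0.
Qed.

Let f0_ge (p s : R) : 0 <= p < 1 -> 0 < s ->
  s `^ (- p) * (1 + s) ^- 2 <= (1 - p)^-1 * f0 p s.
Proof.
move=> /andP[p0 p1] s0.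
rewrite /f0 !mulrA mulVf ?mul1r; last by rewrite lt0r_neq0//; lra.
rewrite ler_wpM2r ?invr_ge0 ?exprn_ge0//; first by lra.
apply: powR_N_anti => //; first by rewrite mulr_gt0// invr_gt0; lra.
by rewrite ler_pdivrMr; [rewrite ler_peMr//; lra|lra].
Qed.

Lemma integrable_pow_exp (p w : R) : 0 <= p < 1 -> 0 < w ->
  mu.-integrable pos (EFin \o (fun s => s `^ (- p) * expR (- w * s))).
Proof.
(* Chosen so that 1 + s <= m e^(w s / 2), whence e^(- w s) <= m^2 (1 + s)^(-2). *)
move=> p01 w0; pose m := 1 + 2 / w.
have m0 : 0 < m by rewrite /m addr_gt0// divr_gt0.
apply: (@pos_integrable_le _ (fun s => m ^+ 2 * ((1 - p)^-1 * f0 p s))).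
- apply: cont_pos_measurable => s s0; apply: cvgM; first exact: cont_powR.
  exact: cont_expRN.
- move=> s s0; rewrite ger0_norm ?mulr_ge0 ?powR_ge0 ?expR_ge0//.
  apply: (@le_trans _ _ (m ^+ 2 * (s `^ (- p) * (1 + s) ^- 2))); last first.
    by rewrite ler_wpM2l ?f0_ge// exprn_ge0// ltW.
  rewrite mulrCA ler_wpM2l ?powR_ge0// mulNr expRN.
  have s1 : 0 < 1 + s by lra.
  rewrite ler_pdivlMr ?exprn_gt0// mulrC ler_pdivrMr ?expR_gt0//.
  have e2 : w * s = 2%:R * (w * s / 2) by field.
  rewrite e2 expRM_natl -exprMn.
  have h1 : 0 < 2 / w by rewrite divr_gt0.
  have h2 : 0 < w * s / 2 by rewrite divr_gt0// mulr_gt0.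
  have h3 : 1 + s <= m * expR (w * s / 2).
    rewrite (@le_trans _ _ (m * (1 + w * s / 2)))//; last by rewrite ler_wpM2l ?expR_ge1Dx// ltW.
    have -> : m * (1 + w * s / 2) = 1 + s + 2 / w + w * s / 2.
      by rewrite /m; field; exact: lt0r_neq0.
    by lra.
  by rewrite lerXn2r ?nnegrE ?(ltW s1)// mulr_ge0 ?expR_ge0// ltW.
- by apply: pos_integrableZ; apply: pos_integrableZ; exact: int_f0.
Qed.

Lemma integrable_pow1 (q : R) : 0 < q ->
  mu.-integrable pos (EFin \o (fun s => (1 + s) `^ (- q - 1))).
Proof.
move=> q0.
apply: (@integrable_prim R _ (fun s => (- q^-1) * (1 + s) `^ (- q)) q^-1).
- by move=> s s0; exact: powR_ge0.
- move=> s s0; have s1 : 0 < 1 + s by lra.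
  have da : is_derive s 1 (fun s : R => 1 + s) 1.
    by rewrite -[X in is_derive _ _ _ X]add0r; exact: is_deriveD.
  have h := @is_derive1_comp R (fun x => x `^ (- q)) (fun s => 1 + s) s _ _ (is_derive1_powR (- q) s1) da.
  have := is_deriveZ (- q^-1) h; rewrite /GRing.scale/= mulr1 mulrA mulrNN mulVf ?mul1r//.
  exact: lt0r_neq0.
- by move=> s s0; exact: cont_powR1.
- move=> s s0; rewrite normrM normrN normfV (gtr0_norm q0) ger0_norm ?powR_ge0//.
  rewrite ler_piMr ?invr_ge0 ?(ltW q0)//.
  have s1 : 1 <= 1 + s by lra.
  by have := @powR_N_anti q 1 (1 + s) (ltW q0) ltr01 s1; rewrite powR1.
Qed.

Lemma integrable_beta (q : R) : 0 < q < 1 ->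
  mu.-integrable pos (EFin \o (fun s => s `^ (- q) * (1 + s)^-1)).
Proof.
move=> /andP[q0 q1].
(* The first summand dominates for s > 1, where s >= (1 + s) / 2, and the second for s <= 1. *)
apply: (@pos_integrable_le _ (fun s => 2 * (1 + s) `^ (- q - 1) + 4 * ((1 - q)^-1 * f0 q s))).
- apply: cont_pos_measurable => s s0; apply: cvgM; first exact: cont_powR.
  by apply: cvgV; [rewrite lt0r_neq0//; lra|exact: cont_add1].
- move=> s s0; have s1 : 0 < 1 + s by lra.
  rewrite ger0_norm ?mulr_ge0 ?powR_ge0 ?invr_ge0 ?(ltW s1)//.
  have t1 : 0 <= 2 * (1 + s) `^ (- q - 1) by rewrite mulr_ge0// powR_ge0.
  have t2 : 0 <= 4 * (s `^ (- q) * (1 + s) ^- 2).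
    by rewrite !mulr_ge0// ?powR_ge0// invr_ge0 exprn_ge0// ltW.
  have t3 : 4 * (s `^ (- q) * (1 + s) ^- 2) <= 4 * ((1 - q)^-1 * f0 q s).
    by rewrite ler_wpM2l// f0_ge// ltW.
  have [sl|sg] := leP s 1.
    apply: (@le_trans _ _ (4 * (s `^ (- q) * (1 + s) ^- 2))); last by lra.
    rewrite mulrCA ler_wpM2l ?powR_ge0// -exprVn expr2 mulrA ler_peMl ?invr_ge0 ?(ltW s1)//.
    by rewrite ler_pdivlMr// mul1r; lra.
  apply: (@le_trans _ _ (2 * (1 + s) `^ (- q - 1))); last by lra.
  rewrite powRB; last by rewrite (lt0r_neq0 s1) implybT.
  rewrite powRr1 ?(ltW s1)// mulrA ler_wpM2r ?invr_ge0 ?(ltW s1)//.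
  apply: (@le_trans _ _ (((1 + s) / 2) `^ (- q))).
    by apply: powR_N_anti; [exact: ltW|lra|lra].
  rewrite powRM ?(ltW s1)// mulrC ler_wpM2r ?powR_ge0//.
  have -> : 2^-1 `^ (- q) = 2 `^ q :> R by rewrite -powR_inv1// -powRrM mulN1r opprK.
  have : 2 `^ q <= 2 `^ 1 :> R by rewrite ler_powR//; lra.
  by rewrite powRr1.
- apply: pos_integrableD; first by apply: pos_integrableZ; exact: integrable_pow1.
  by apply: pos_integrableZ; apply: pos_integrableZ; apply: int_f0; rewrite ltW.
Qed.

End halfline_tools.

Section halfline_fubini.
Context {R : realType}.
Notation mu := (@lebesgue_measure R).
Notation mR := (measurableTypeR R).
Notation mset := (@measurable _ (measurableTypeR R)).
Notation pos := (`]0%R, +oo[%classic : set R).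

Lemma translation (f : R -> R) (h : R) : 0 <= h -> mu.-integrable pos (EFin \o f) ->
  \int[mu]_(s in pos) f (s + h) = \int[mu]_(s in `]h, +oo[) f s.
Proof.
move=> h0 intf.
have sub : `]h, +oo[%classic `<=` pos.
  by move=> x; rewrite posE /= in_itv/= andbT; exact: le_lt_trans.
have mh : mset `]h, +oo[%classic by exact: measurable_itv.
have intfh := integrableS mpos mh sub intf.
have mf : @measurable_fun _ _ mR _ `]h, +oo[%classic (EFin \o f) := measurable_int _ intfh.
rewrite /Rintegral.
have P := @ge0_translation _ (EFin \o f)^\+%E h (measurable_funepos mf) (fun x _ => funepos_ge0 _ _).
have N := @ge0_translation _ (EFin \o f)^\-%E h (measurable_funeneg mf) (fun x _ => funeneg_ge0 _ _).
rewrite integralE [in RHS]integralE -P -N.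
by congr (fine (_ - _)%E); apply: eq_integral => s _; rewrite ?funeposE ?funenegE.
Qed.

(** [F] is extended by zero to the plane, and Tonelli reduces its integrability there to the last
    hypothesis. The integrability of the sections keeps [fine] from turning an infinite inner
    integral into 0. *)
Lemma quad_fubini (F : R -> R -> R) :
  measurable_fun (pos `*` pos : set (mR * mR)) (fun z : mR * mR => F z.1 z.2) ->
  (forall r, 0 < r -> mu.-integrable pos (EFin \o F r)) ->
  (forall s, 0 < s -> mu.-integrable pos (EFin \o (F ^~ s))) ->
  mu.-integrable pos (EFin \o (fun s => \int[mu]_(r in pos) `|F r s|)) ->
  mu.-integrable pos (EFin \o (fun r => \int[mu]_(s in pos) F r s)) /\
  \int[mu]_(r in pos) \int[mu]_(s in pos) F r s =
  \int[mu]_(s in pos) \int[mu]_(r in pos) F r s.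
Proof.
move=> mF iF1 iF2 iF.
pose Q : set (mR * mR) := pos `*` pos.
have mQ : measurable Q by apply: measurableX; exact: mpos.
pose G : mR * mR -> \bar R := (fun z => (F z.1 z.2)%:E) \_ Q.
have mG : measurable_fun setT G.
  apply/(measurable_restrictT _ mQ).
  exact/measurable_EFinP.
have GE r s : G (r, s) = if (r \in pos) && (s \in pos) then (F r s)%:E else 0%E.
  by rewrite /G patchE in_setX.
have G1 r : (\int[mu]_s G (r, s) = ((fun r => (\int[mu]_(s in pos) F r s)%:E) \_ pos) r)%E.
  rewrite patchE; case: ifPn => rp.
    transitivity (\int[mu]_(s in pos) (F r s)%:E)%E.
      rewrite [RHS]integral_mkcond; apply: eq_integral => s _.
      by rewrite GE patchE rp.
    rewrite /Rintegral fineK//.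
    by apply: integrable_fin_num; [exact: mpos|apply: iF1; rewrite -posE -inE].
  by apply: integral0_eq => s _; rewrite GE (negbTE rp).
have G2 s : (\int[mu]_r G (r, s) = ((fun s => (\int[mu]_(r in pos) F r s)%:E) \_ pos) s)%E.
  rewrite patchE; case: ifPn => sp.
    transitivity (\int[mu]_(r in pos) (F r s)%:E)%E.
      rewrite [RHS]integral_mkcond; apply: eq_integral => r _.
      by rewrite GE patchE sp andbT.
    rewrite /Rintegral fineK//.
    by apply: integrable_fin_num; [exact: mpos|apply: iF2; rewrite -posE -inE].
  by apply: integral0_eq => r _; rewrite GE (negbTE sp) andbF.
have G2a s : (\int[mu]_r `|G (r, s)| = ((fun s => (\int[mu]_(r in pos) `|F r s|)%:E) \_ pos) s)%E.
  rewrite patchE; case: ifPn => sp.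
    transitivity (\int[mu]_(r in pos) `|(F r s)%:E|)%E.
      rewrite [RHS]integral_mkcond; apply: eq_integral => r _.
      by rewrite GE patchE sp andbT; case: ifP => //; rewrite abse0.
    rewrite /Rintegral fineK//; apply: integrable_fin_num; first exact: mpos.
    have i2 : mu.-integrable pos (EFin \o (F ^~ s)) by apply: iF2; rewrite -posE -inE.
    by have := integrable_norm i2.
  by apply: integral0_eq => r _; rewrite GE (negbTE sp) andbF abse0.
have iG : (mu \x mu)%E.-integrable setT G.
  apply: (@integrable21ltyP _ _ mR mR R mu mu G mG).2.
  under eq_integral do rewrite G2a.
  rewrite -integral_mkcond; case/integrableP : iF => _.
  pose N s := \int[mu]_(r in pos) `|F r s|.
  suff -> : (\int[mu]_(x in pos) `|(N x)%:E| = \int[mu]_(s in pos) (N s)%:E)%E by [].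
  by apply: eq_integral => s _; rewrite gee0_abs// lee_fin Rintegral_ge0.
have H1 := integrable_fubini_F iG.
have H := Fubini iG.
split.
  apply/(integrable_mkcond _ mpos).
  by apply: eq_integrable H1 => // r _; rewrite /fubini_F G1.
rewrite /Rintegral; congr fine.
rewrite [LHS]integral_mkcond [RHS]integral_mkcond.
transitivity (\int[mu]_r \int[mu]_s G (r, s))%E.
  by apply: eq_integral => r _; rewrite G1.
rewrite H; apply: eq_integral => s _; by rewrite G2.
Qed.

End halfline_fubini.

(** * Laplace transform of a stable semigroup *)

Section semigroup.
Context {R : realType}.
Notation mu := (@lebesgue_measure R).
Notation mR := (measurableTypeR R).
Notation mset := (@measurable _ (measurableTypeR R)).
Notation pos := (`]0%R, +oo[%classic : set R).

Lemma nrm_normc (z : R[i]) : nrm (z : R[i]^o) = normc z.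
Proof. by rewrite /nrm normc_def; case: z. Qed.

Lemma cvg_scale_nrm (V : normedModType R[i]) {T : Type} {F : set_system T} {FF : Filter F}
  (c : T -> R[i]) (c0 : R[i]) (f : T -> V) (v : V) :
  (forall e : R, 0 < e -> \forall t \near F, normc (c t - c0) < e) ->
  f @ F --> v -> c t *: f t @[t --> F] --> c0 *: v.
Proof.
move=> hc fv; apply: cvgZ => //.
have : (c : T -> R[i]^o) @ F --> (c0 : R[i]^o).
  apply/cvg_nrmP => e e0; apply: filterS (hc e e0) => t.
  by rewrite nrmB nrm_normc.
by [].
Qed.

Lemma within_scale (V : normedModType R[i]) (c : R -> R[i]) (F : R -> V) (D : set R) :
  (forall t, D t -> exists c', cder c t c') ->
  {within D, continuous F} -> {within D, continuous (fun t => c t *: F t)}.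
Proof.
move=> hc /subspace_continuousP cF; apply/subspace_continuousP => t Dt.
apply: cvg_scale_nrm; last exact: cF.
move=> e e0; have [c' h] := hc t Dt.
by apply: cvg_within; exact: cder_cont h _ e0.
Qed.

Lemma integrable_exp (c : R) : 0 < c -> mu.-integrable pos (EFin \o (fun s => expR (- c * s))).
Proof.
move=> c0; have p01 : 0 <= (0 : R) < 1 by rewrite lexx ltr01.
suff -> : (fun s => expR (- c * s)) = (fun s => s `^ (- 0) * expR (- c * s)).
  exact: integrable_pow_exp.
by apply/funext => s; rewrite oppr0 powRr0 mul1r.
Qed.

Lemma pint_pos_exists (V : completeNormedModType R[i]) (f : R -> V) (g : R -> R) :
  norming V -> {within pos, continuous f} ->
  (forall s : R, 0 < s -> nrm (f s) <= g s) -> mu.-integrable pos (EFin \o g) ->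
  exists v, pint pos f v.
Proof.
move=> nV cf fg; rewrite pos_bigcup => ig.
apply: (pint_exists nV _ pos_exhaust_nd _ ig).
- move=> n; rewrite (@le_trans _ _ 1)// ?ler1n// invf_le1 ?ler1n//.
- move=> n; apply: continuous_subspaceW cf => x /=; rewrite !in_itv/= andbT => /andP[h _].
  by apply: lt_le_trans h; rewrite invr_gt0.
- by move=> t; rewrite -pos_bigcup posE; exact: fg.
Qed.

(** The exponential e^(z s). *)
Definition ez (z : R[i]) (s : R) : R[i] := (expR (complex.Re z * s))%:C * cis (complex.Im z * s).

Lemma ezD z s t : ez z (s + t) = ez z s * ez z t.
Proof. by rewrite /ez !mulrDr expRD cisD rmorphM/=; ring. Qed.

Lemma ez0 z : ez z 0 = 1.
Proof. by rewrite /ez !mulr0 expR0 cis0 mul1r. Qed.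

Lemma normc_ez z s : normc (ez z s) = expR (complex.Re z * s).
Proof. by rewrite normcM normcR normc_cis mulr1 ger0_norm ?expR_ge0. Qed.

Lemma cder_ez z t : cder (ez z) t (z * ez z t).
Proof.
have dl (a : R) : is_derive t 1 (fun s : R => a * s) a.
  by rewrite -[X in is_derive _ _ _ X]mulr1; exact: is_deriveZ.
have h0 := @is_derive1_comp R expR _ t _ _ (is_derive_expR _) (dl (complex.Re z)).
have h1 := @is_derive1_comp R cos _ t _ _ (is_derive_cos _) (dl (complex.Im z)).
have h2 := @is_derive1_comp R sin _ t _ _ (is_derive_sin _) (dl (complex.Im z)).
have k1 := is_deriveM h0 h1; have k2 := is_deriveM h0 h2.
rewrite /ez; split.
  have -> : (fun s => complex.Re ((expR (complex.Re z * s))%:C * cis (complex.Im z * s))) =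
    (expR \o (fun s => complex.Re z * s)) * (cos \o (fun s => complex.Im z * s)).
    by apply/funext => s; rewrite ReM /= mul0r subr0.
  apply: (is_derive_eq k1); rewrite /GRing.scale/= !ReM ImM /=; ring.
have -> : (fun s => complex.Im ((expR (complex.Re z * s))%:C * cis (complex.Im z * s))) =
    (expR \o (fun s => complex.Re z * s)) * (sin \o (fun s => complex.Im z * s)).
  by apply/funext => s; rewrite ImM /= mul0r addr0.
apply: (is_derive_eq k2); rewrite /GRing.scale/= !ImM ReM /=; ring.
Qed.

Lemma cder_quot (c : R -> R[i]) c' : cder c 0 c' ->
  forall e : R, 0 < e -> \forall h \near 0^'+, normc ((h%:C)^-1 * (c h - c 0) - c') < e.
Proof.
move=> [[d1 v1] [d2 v2]] e e0; have e2 : 0 < e / 2 by rewrite divr_gt0.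
have q (g : R -> R) (v : R) : derivable g 0 1 -> 'D_1 g 0 = v ->
    \forall h \near 0^'+, `|h^-1 * (g h - g 0) - v| < e / 2.
  move=> dg <-.
  have : h^-1 *: (g (h *: 1 + 0) - g 0) @[h --> 0^'] --> 'D_1 g 0 by exact: dg.
  move=> /cvgrPdist_lt/(_ _ e2)[d /= d0 hd]; exists d => //= h hh hp.
  have := hd h hh (lt0r_neq0 hp).
  by rewrite distrC addr0 /GRing.scale/= mulr1.
have := q _ _ d1 v1; have := q _ _ d2 v2.
apply: filterS2 => h h2 h1; rewrite (le_lt_trans (normc_le _))// [ltRHS]splitr ltrD//.
  have -> : complex.Re ((h%:C)^-1 * (c h - c 0) - c') =
    h^-1 * (complex.Re (c h) - complex.Re (c 0)) - complex.Re c' => //.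
  rewrite -fmorphV; case: (c h) => ? ?; case: (c 0) => ? ?; case: (c') => ? ? /=; ring.
have -> : complex.Im ((h%:C)^-1 * (c h - c 0) - c') =
    h^-1 * (complex.Im (c h) - complex.Im (c 0)) - complex.Im c' => //.
rewrite -fmorphV; case: (c h) => ? ?; case: (c 0) => ? ?; case: (c') => ? ? /=; ring.
Qed.

End semigroup.

Section laplace.
Context {R : realType}.
Notation mu := (@lebesgue_measure R).
Notation mR := (measurableTypeR R).
Notation mset := (@measurable _ (measurableTypeR R)).
Notation pos := (`]0%R, +oo[%classic : set R).

Lemma resolvent_uniq (V : normedModType R[i]) (A : unbop V V) z (Q Q' : V -> V) :
  is_resolvent A z Q -> is_resolvent A z Q' -> Q = Q'.
Proof.
move=> [_ h1 h2] [_ k1 k2]; apply/funext => y.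
have [d e] := h1 y; by rewrite -(k2 _ d) e.
Qed.

Lemma resolventE (V : normedModType R[i]) (A : unbop V V) z (Q : V -> V) :
  is_resolvent A z Q -> resolvent A z = Q.
Proof.
by move=> h; apply: xget_unique => // Q' h'; exact: (resolvent_uniq h' h).
Qed.

Lemma resolventP (V : normedModType R[i]) (A : unbop V V) z :
  resolvent_set A z -> is_resolvent A z (resolvent A z).
Proof. by move=> [Q hQ]; rewrite (resolventE hQ). Qed.

Lemma cvg_ext_near {T : Type} {U : nbhsType} {F : set_system T} {FF : Filter F}
  (f g : T -> U) (l : U) : (\forall t \near F, f t = g t) -> f @ F --> l -> g @ F --> l.
Proof.
move=> fg fl A /fl; rewrite /nbhs/= => fA.
by apply: filterS2 fg fA => t /= e; rewrite /preimage/= e.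
Qed.

Lemma Rint_cst_oc (h c : R) : 0 <= h -> \int[mu]_(t in `]0, h]) c = h * c.
Proof.
move=> h0; have mh : mset `]0, h]%classic by exact: measurable_itv.
have mI : mu `]0, h] = h%:E.
  rewrite lebesgue_measure_itv/= lte_fin oppr0 addr0.
  by case: ltP h0 => // h1 h2; congr (_%:E); apply/eqP; rewrite eq_le h1 h2.
have := Rintegral_cst mu mh c; set m := fine _.
have -> : m = h by exact: (congr1 fine mI).
by move=> H; rewrite mulrC; exact: H.
Qed.

Lemma integrable_cst_oc (h c : R) : mu.-integrable `]0, h]%classic (EFin \o (fun=> c : R)).
Proof.
apply: (@integrableS _ _ _ mu `[0, h]%classic) => //; first exact: subset_itv_oc_cc.
by apply: cont_integrable => y; exact: cvg_cst.
Qed.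

Lemma pint_cst (V : normedModType R[i]) (h : R) (x : V) : 0 <= h ->
  pint `]0, h]%classic (fun=> x) (h%:C *: x).
Proof.
move=> h0 l hl; split; first exact: integrable_cst_oc.
by rewrite Rint_cst_oc//; case: (hl) => _ -> _.
Qed.

Variables (E : completeNormedModType R[i]) (nE : norming E) (S : R -> E -> E).
Hypothesis hS : C0_semigroup S.
Variables (M w : R).
Hypotheses (M0 : 0 < M) (w0 : 0 < w).
Hypothesis bS : forall t x, 0 <= t -> nrm (S t x) <= M * expR (- w * t) * nrm x.

Lemma sg_bl t : 0 <= t -> bounded_linear (S t).
Proof. by case: hS => h _ _ _; exact: h. Qed.

Lemma sgD s t x : 0 <= s -> 0 <= t -> S (s + t) x = S s (S t x).
Proof. by case: hS => _ _ h _ s0 t0; rewrite h. Qed.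

Lemma sg0 x : S 0 x = x.
Proof. by case: hS => _ -> _ _. Qed.

Lemma sg_le t x : 0 <= t -> nrm (S t x) <= M * nrm x.
Proof.
move=> t0; rewrite (le_trans (bS x t0))// ler_wpM2r ?nrm_ge0// ler_piMr ?(ltW M0)//.
by rewrite expR_le1 mulNr oppr_le0 mulr_ge0// ltW.
Qed.

Lemma sg_cont x : {within `[0, +oo[, continuous (S^~ x)}.
Proof.
apply/within_nrmP => t; rewrite /= in_itv/= andbT => t0 e e0.
have [_ _ _ /(_ x)/cvg_nrmP/(_ (e / M))] := hS; rewrite divr_gt0// => /(_ isT).
move=> [d /= d0 hd]; exists d => // s; rewrite in_itv/= andbT => s0 st.
wlog ts : s t s0 t0 st / t <= s.
  move=> H; have [|/ltW] := leP t s; first exact: H.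
  by move=> h; rewrite nrmB; apply: H => //; rewrite distrC.
have : t = s \/ t < s by move: ts; rewrite le_eqVlt => /predU1P.
move=> [->|lts]; first by rewrite subrr nrm0.
have -> : s = t + (s - t) by ring.
rewrite sgD ?subr_ge0// -(blB _ _ (sg_bl t0)) (le_lt_trans (sg_le _ t0))//.
rewrite -ltr_pdivlMl// mulrC; apply: hd; last by rewrite subr_gt0.
by rewrite /= sub0r normrN distrC.
Qed.

Lemma sg_cont_pos x : {within pos, continuous (S^~ x)}.
Proof.
apply: (continuous_subspaceW _ (@sg_cont x)).
by apply: subset_itvr; rewrite bnd_simp.
Qed.

Let f z x s : E := ez z s *: S s x.

Lemma lap_integrand_le z x s : 0 <= s ->
  nrm (f z x s) <= M * nrm x * expR (- (w - complex.Re z) * s).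
Proof.
move=> s0; rewrite /f nrmZ normc_ez.
rewrite (le_trans (ler_wpM2l (expR_ge0 _) (bS x s0)))//.
rewrite opprB mulrBl expRD -mulNr le_eqVlt; apply/orP; left; apply/eqP; ring.
Qed.

Lemma lap_cont z x : {within `[0, +oo[, continuous (f z x)}.
Proof.
apply: within_scale; last exact: sg_cont.
by move=> t _; eexists; exact: cder_ez.
Qed.

(** With A the generator of [S], this is (- z - A)^-1 x, the Laplace transform of the semigroup at -
    z; its negative is the resolvent of - A at z. *)
Definition lap z x : E := xget 0 [set v | pint pos (f z x) v].

Lemma lapP z x : complex.Re z < w -> pint pos (f z x) (lap z x).
Proof.
move=> zw; apply: xgetPex.
apply: (@pint_pos_exists _ _ _ (fun s => M * nrm x * expR (- (w - complex.Re z) * s))) => //.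
- by apply: (continuous_subspaceW _ (@lap_cont z x)); apply: subset_itvr; rewrite bnd_simp.
- by move=> s s0; apply: lap_integrand_le; exact: ltW.
- by apply: pos_integrableZ; apply: integrable_exp; rewrite subr_gt0.
Qed.

Lemma lap_le z x : complex.Re z < w ->
  nrm (lap z x) <= M * nrm x * \int[mu]_(s in pos) expR (- (w - complex.Re z) * s).
Proof.
move=> zw; have ie : mu.-integrable pos (EFin \o (fun s => expR (- (w - complex.Re z) * s))).
  by apply: integrable_exp; rewrite subr_gt0.
rewrite -RintegralZl//.
apply: (pint_le nE mpos (lapP x zw)); first exact: pos_integrableZ.
by move=> t; rewrite posE => t0; apply: lap_integrand_le; exact: ltW.
Qed.

Lemma lap_linear z : complex.Re z < w -> linear (lap z).
Proof.
move=> zw c x y; apply: (pint_uniq nE (lapP _ zw)).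
have := pintD mpos (pintZ c (lapP x zw)) (lapP y zw); apply: pint_ext mpos _ => t.
rewrite posE => t0; rewrite /f (bl_add _ _ (sg_bl (ltW t0))) (blZ _ _ (sg_bl (ltW t0))).
by rewrite scalerDr !scalerA mulrC.
Qed.

Lemma lap_bl z : complex.Re z < w -> bounded_linear (lap z).
Proof.
move=> zw; split; first exact: lap_linear.
exists (M * \int[mu]_(s in pos) expR (- (w - complex.Re z) * s)) => x.
by rewrite mulrAC lap_le.
Qed.

Lemma lap_comm z t x : complex.Re z < w -> 0 <= t -> lap z (S t x) = S t (lap z x).
Proof.
move=> zw t0; apply: (pint_uniq nE (lapP _ zw)).
have := pint_map (sg_bl t0) (lapP x zw); apply: pint_ext mpos _ => s; rewrite posE => s0.
by rewrite /f /= (blZ _ _ (sg_bl t0)) -!sgD ?(ltW s0)// addrC.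
Qed.

(** By translation, the part of the integral over (h, oo) is e^(z h) S(h) applied to the whole. *)
Lemma lap_tail z x h : complex.Re z < w -> 0 <= h ->
  pint `]0, h]%classic (f z x) (lap z x - ez z h *: S h (lap z x)).
Proof.
move=> zw h0; have mh : mset `]h, +oo[%classic by exact: measurable_itv.
have sub : `]h, +oo[%classic `<=` pos.
  by move=> y; rewrite posE /= in_itv/= andbT; exact: le_lt_trans.
have -> : `]0, h]%classic = pos `\` `]h, +oo[%classic.
  apply/seteqP; split=> y /=; rewrite !in_itv/= !andbT.
    by move=> /andP[-> yh]; split => //; apply/negP; rewrite -leNgt.
  by move=> [-> /negP]; rewrite -leNgt.
apply: (pint_setD mpos mh sub (lapP x zw)) => l hl.
have [i1 _] := lapP x zw hl; split; first exact: integrableS i1.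
rewrite -(translation h0 i1).
have := pintZ (ez z h) (pint_map (sg_bl h0) (lapP x zw)) hl => -[_ <-].
apply: eq_Rintegral => s; rewrite inE posE => s0.
by rewrite /f /= (blZ _ _ (sg_bl h0)) scalerA -ezD -sgD// ?(ltW s0)// addrC.
Qed.

(** Let [A h] be the integral over (0, h]; then A h / h tends to x, by continuity of the integrand
    at 0. Solving [lap_tail] for S(h) Y gives S(h) Y - Y = (e^(- z h) - 1) Y - e^(- z h) A h, which
    is divided by h. *)
Lemma lap_gen_cvg z x : complex.Re z < w ->
  (h%:C)^-1 *: (S h (lap z x) - lap z x) @[h --> 0^'+] --> - x - z *: lap z x.
Proof.
move=> zw; set Y := lap z x; pose A h := Y - ez z h *: S h Y.
have cA : (h%:C)^-1 *: A h @[h --> 0^'+] --> x.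
  apply/cvg_nrmP => e e0; have e2 : 0 < e / 2 by rewrite divr_gt0.
  have /within_nrmP/(_ 0) := @lap_cont z x; rewrite /= in_itv/= lexx => /(_ isT _ e2)[d d0 hd].
  exists d => // h hh h0.
  have hh' : h < d.
    by move: hh; rewrite /= sub0r normrN; apply: le_lt_trans; exact: ler_norm.
  have mh : mset `]0, h]%classic by exact: measurable_itv.
  have := pintD mh (pint_cst x (ltW h0)) (pintZ (-1) (lap_tail x zw (ltW h0))).
  rewrite scaleN1r -/Y -/(A h) => P.
  have := pint_le nE mh P (integrable_cst_oc h (e / 2)); rewrite Rint_cst_oc ?(ltW h0)//.
  have gen (y : E) : x - (h%:C)^-1 *: y = (h%:C)^-1 *: (h%:C *: x - y).
    rewrite scalerBr scalerA mulVf ?scale1r//.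
    by apply: contra_neq (lt0r_neq0 h0) => -[].
  rewrite gen.
  move=> H; rewrite -fmorphV nrmZr gtr0_norm ?invr_gt0// mulrC ltr_pdivrMr//.
  rewrite (le_lt_trans (H _))//; last by rewrite mulrC ltr_pM2r// ltr_pdivrMr// ltr_pMr// ltr1n.
  move=> t /=; rewrite in_itv/= => /andP[t0 th].
  have ht1 : `[0, +oo[%classic t by rewrite /= in_itv/= (ltW t0).
  have ht2 : `|0 - t| < d by rewrite sub0r normrN gtr0_norm// (le_lt_trans th).
  have := hd t ht1 ht2.
  by rewrite {1}/f ez0 scale1r sg0 scaleN1r => /ltW.
have cez : forall e : R, 0 < e -> \forall h \near 0^'+, normc (ez (- z) h - 1) < e.
  move=> e e0; have := cder_cont (cder_ez (- z) 0) e0; rewrite ez0.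
  by apply: filterS.
have cq := cder_quot (cder_ez (- z) 0); rewrite ez0 mulr1 in cq.
have k1 : (t%:C^-1 * (ez (- z) t - 1)) *: Y @[t --> 0^'+] --> - z *: Y.
  exact: (cvg_scale_nrm cq (cvg_cst Y)).
have k2 : ez (- z) t *: (t%:C^-1 *: A t) @[t --> 0^'+] --> 1 *: x.
  exact: (cvg_scale_nrm cez cA).
have k3 : (t%:C^-1 * (ez (- z) t - 1)) *: Y - ez (- z) t *: (t%:C^-1 *: A t)
    @[t --> 0^'+] --> - z *: Y - 1 *: x by exact: (cvgB k1 k2).
have <- : - z *: Y - 1 *: x = - x - z *: Y by rewrite scale1r scaleNr addrC.
refine (cvg_ext_near _ k3); near=> h.
have h0 : 0 < h by near: h; exact: nbhs_right_gt.
have inv : ez (- z) h * ez z h = 1.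
  rewrite /ez mulrACA -rmorphM/= -expRD -cisD; case: (z) => a b /=.
  by rewrite !mulNr !addNr expR0 cis0 mulr1.
have e2 (a : E) : ez (- z) h *: ((h%:C)^-1 *: a) = (h%:C)^-1 *: (ez (- z) h *: a).
  by rewrite !scalerA mulrC.
rewrite e2 -scalerA -scalerBr; congr (_ *: _).
rewrite /A scalerBr scalerA inv scale1r scalerBl scale1r opprB.
by rewrite addrC addrA subrK.
Unshelve. all: by end_near. Qed.

Lemma lap_gen z x : complex.Re z < w ->
  dom (generator S) (lap z x) /\ generator S (lap z x) = - x - z *: lap z x.
Proof.
move=> zw; have h := @lap_gen_cvg z x zw; split; last exact: cvg_lim h.
by apply/cvg_ex; eexists; exact: h.
Qed.

Lemma lap_resolvent z : complex.Re z < w ->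
  is_resolvent (opN (generator S)) z (fun x => - lap z x).
Proof.
move=> zw; have hl := lap_bl zw; split.
- have := bl_comp (bl_scale E (-1)) hl.
  suff -> : (fun x => - lap z x) = lap z \o (fun x => -1 *: x) by [].
  by apply/funext => x /=; rewrite (blZ _ _ hl) scaleN1r.
- move=> y; rewrite -(blN _ hl); have [h1 h2] := lap_gen (- y) zw.
  have e : opN (generator S) (lap z (- y)) = - generator S (lap z (- y)) by [].
  by split; [exact: h1|rewrite e h2 !opprK addrC subrK].
- move=> x dx.
  have -> : opN (generator S) x = - generator S x by [].
  rewrite -(blN _ hl) opprK opprD (blB _ _ hl) (blN _ hl) (blZ _ _ hl).
  (* Since [lap z] is bounded and commutes with [S h], the difference quotients of [lap z x] have
     two limits, [lap z (generator S x)] and the one of [lap_gen_cvg]; their equality is the left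
     inverse property. *)
  have c1 : lap z ((h%:C)^-1 *: (S h x - x)) @[h --> 0^'+] --> lap z (generator S x).
    by apply: bl_cvg hl _; exact: dx.
  have c2 : lap z ((h%:C)^-1 *: (S h x - x)) @[h --> 0^'+] --> - x - z *: lap z x.
    refine (cvg_ext_near _ (@lap_gen_cvg z x zw)); near=> h.
    have h0 : 0 <= h by near: h; exact: nbhs_right_ge.
    by rewrite (blZ _ _ hl) (blB _ _ hl) lap_comm.
  have hE := @norm_hausdorff _ E.
  have -> : lap z (generator S x) = - x - z *: lap z x.
    by rewrite -(cvg_lim hE c1) (cvg_lim hE c2).
  by rewrite opprB opprK addKr.
Unshelve. all: by end_near. Qed.

Lemma resolvent_lap z : complex.Re z < w ->
  resolvent_set (opN (generator S)) z /\
  resolvent (opN (generator S)) z = (fun x => - lap z x).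
Proof.
move=> zw; have h := lap_resolvent zw; split; first by exists (fun x => - lap z x).
exact: resolventE.
Qed.

End laplace.

(** * Holomorphy of the resolvent *)

Section resolvent_hol.
Context {R : realType}.
Variables (V : normedModType R[i]) (A : unbop V V).
Let rho := resolvent_set A.
Let Q := resolvent A.

Lemma res_bl z : rho z -> bounded_linear (Q z).
Proof. by move=> /resolventP[]. Qed.

(** The first resolvent identity, arranged as the factorisation that [hol] asks for. *)
Lemma res_id z v x : rho z -> rho v -> Q v x - Q z x = (v - z) *: - Q v (Q z x).
Proof.
move=> hz hv; have [_ h1 _] := resolventP hz; have [bv _ h2] := resolventP hv.
have [d e] := h1 x.
have gen (u : V) : v *: u - A u = (z *: u - A u) + (v - z) *: u.
  by rewrite scalerBl [RHS]addrC addrA subrK.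
have E := gen (Q z x); rewrite {}e in E.
have H : Q v x + (v - z) *: Q v (Q z x) = Q z x.
  by rewrite -(blZ _ _ bv) -(bl_add _ _ bv) -E h2.
by rewrite -[X in _ - X]H opprD addNKr scalerN.
Qed.

(** For |v - z| < 1 / (2 K) the resolvent identity gives |Q v y| <= |Q z y| + |Q v y| / 2, and the
    last term is absorbed. In the witness, [2 * K] serves the bound and [2 * K * K] the Lipschitz
    estimate. *)
Lemma res_bound z : rho z -> exists K d : R, [/\ 0 < K, 0 < d &
  forall v y, rho v -> normc (v - z) < d ->
    nrm (Q v y) <= K * nrm y /\ nrm (Q v y - Q z y) <= normc (v - z) * (K * nrm y)].
Proof.
move=> hz; have [K K0 hK] := bl_bound (res_bl hz).
exists (2 * K + 2 * K * K), (2 * K)^-1; split.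
- by rewrite addr_gt0 ?mulr_gt0.
- by rewrite invr_gt0 mulr_gt0.
move=> v y hv v1.
have E : Q v y - Q z y = (v - z) *: - Q z (Q v y).
  by rewrite -opprB (res_id y hv hz) -scaleNr opprB.
have E2 : nrm (Q v y - Q z y) <= normc (v - z) * (K * nrm (Q v y)).
  by rewrite E nrmZ nrmN ler_wpM2l ?normc_ge0.
have h : nrm (Q v y) <= nrm (Q z y) + nrm (Q v y - Q z y).
  by rewrite addrC -{1}(subrK (Q z y) (Q v y)) nrmD.
have h2 : normc (v - z) * (K * nrm (Q v y)) <= nrm (Q v y) / 2.
  apply: (@le_trans _ _ ((2 * K)^-1 * (K * nrm (Q v y)))).
    by rewrite ler_wpM2r ?mulr_ge0 ?nrm_ge0 ?(ltW K0)// ltW.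
  rewrite le_eqVlt; apply/orP; left; apply/eqP; field; exact: lt0r_neq0.
have b : nrm (Q v y) <= 2 * K * nrm y by have := hK y; lra.
have q0 : 0 <= 2 * K * K * nrm y by rewrite !mulr_ge0 ?nrm_ge0 ?(ltW K0).
have q1 : 0 <= 2 * K * nrm y by rewrite !mulr_ge0 ?nrm_ge0 ?(ltW K0).
split.
  rewrite [X in _ <= X](_ : _ = 2 * K * nrm y + 2 * K * K * nrm y); last by ring.
  by rewrite (le_trans b)// lerDl.
apply: (le_trans E2); rewrite ler_wpM2l ?normc_ge0//.
apply: (le_trans (ler_wpM2l (ltW K0) b)).
have -> : K * (2 * K * nrm y) = 2 * K * K * nrm y by ring.
by rewrite [X in _ <= X](_ : _ = 2 * K * nrm y + 2 * K * K * nrm y) ?lerDr//; ring.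
Qed.

Lemma res_ccont y z : rho z -> ccont rho (fun v => Q v y) z.
Proof.
move=> hz e e0; have [K [d [K0 d0 hK]]] := res_bound hz.
pose L := K * nrm y + 1.
have L0 : 0 < L by rewrite ltr_wpDl// mulr_ge0 ?nrm_ge0 ?(ltW K0).
exists (Num.min d (e / L)); first by rewrite lt_min d0 divr_gt0.
move=> v hv; rewrite lt_min => /andP[v1 v2].
have [_ h] := hK v y hv v1; apply: (le_lt_trans h).
apply: (@le_lt_trans _ _ (normc (v - z) * L)); last by rewrite -ltr_pdivlMr.
by rewrite ler_wpM2l ?normc_ge0// lerDl.
Qed.

Lemma res_hol x : hol rho (fun v => Q v x) (fun v => - Q v (Q v x)).
Proof.
move=> z hz; exists (fun v => - Q v (Q z x)); split => //.
  by move=> v hv; exact: res_id.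
move=> e e0; have [d d0 hd] := res_ccont (Q z x) hz e0.
by exists d => // v hv vz; rewrite -opprD nrmN hd.
Qed.

Lemma res_ccont2 x z : rho z -> ccont rho (fun v => - Q v (Q v x)) z.
Proof.
move=> hz e e0; have e2 : 0 < e / 2 by rewrite divr_gt0.
have [K [d [K0 d0 hK]]] := res_bound hz.
have [d1 d10 h1] := res_ccont (Q z x) hz e2.
have [d2 d20 h2] := res_ccont x hz (divr_gt0 e2 K0).
exists (Num.min d (Num.min d1 d2)); first by rewrite !lt_min d0 d10 d20.
move=> v hv; rewrite !lt_min => /and3P[v0 v1 v2].
have bv := res_bl hv.
have -> : - Q v (Q v x) - - Q z (Q z x) =
   - (Q v (Q v x - Q z x) + (Q v (Q z x) - Q z (Q z x))).
  by rewrite (blB _ _ bv) subrKA opprB opprK addrC.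
rewrite nrmN (le_lt_trans (nrmD _ _))// [ltRHS]splitr ltrD// ?h1//.
have [h _] := hK v (Q v x - Q z x) hv v0; apply: (le_lt_trans h).
by rewrite mulrC -ltr_pdivlMr// h2.
Qed.

End resolvent_hol.

(** * Improper Riemann integrals on a ray *)

Section improper.
Context {R : realType}.
Notation mu := (@lebesgue_measure R).
Notation mset := (@measurable _ (measurableTypeR R)).

Lemma ray_bigcup (d : R) : `]d, +oo[%classic = \bigcup_n `]d, (d + n.+1%:R)]%classic.
Proof.
apply/seteqP; split=> x /=.
  rewrite in_itv/= andbT => dx; exists (Num.truncn (x - d)) => //=.
  by rewrite in_itv/= dx/= -lerBlDl ltW// truncnS_gt.
by move=> [n _] /=; rewrite !in_itv/= => /andP[-> _].
Qed.

Lemma ray_exhaust_nd (d : R) : nondecreasing_seq (fun n => `]d, (d + n.+1%:R)]%classic : set R).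
Proof.
move=> m n mn; apply/subsetPset => x /=; rewrite !in_itv/= => /andP[-> h].
by rewrite (le_trans h)// lerD2l ler_nat ltnS.
Qed.

Lemma ray_cc_bigcup (d : R) :
  `]d, +oo[%classic = \bigcup_n `[(d + n.+1%:R^-1), (d + n.+1%:R)]%classic.
Proof.
have := congr1 (fun D : set R => (fun x => x - d) @^-1` D) (@pos_bigcup R).
rewrite preimage_bigcup => H.
transitivity ((fun x : R => x - d) @^-1` `]0, +oo[%classic).
  by apply/seteqP; split=> x /=; rewrite !in_itv/= !andbT subr_gt0.
rewrite H; apply: eq_bigcup => // n _.
by apply/seteqP; split=> x /=; rewrite !in_itv/= lerBrDl lerBlDl.
Qed.

Lemma pint_oc_of_cc (V : normedModType R[i]) (f : R -> V) a b v :
  pint `[a, b]%classic f v -> pint `]a, b]%classic f v.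
Proof.
move=> h l hl; have [i1 i2] := h l hl.
have i3 : mu.-integrable `]a, b]%classic (EFin \o (l \o f)).
  apply: integrableS i1 => //; exact: subset_itv_oc_cc.
split => //; rewrite -i2; exact: (Rintegral_itv_obnd_cbnd i3).
Qed.

(** The weak integral over the whole ray is constructed by exhaustion; its distance to the integral
    over [d, b] is at most the tail integral of [g]. *)
Lemma improper_rint (V : completeNormedModType R[i]) (f : R -> V) (g : R -> R) (d : R) :
  norming V -> (forall b, {within `[d, b], continuous f}) ->
  (forall r, d < r -> nrm (f r) <= g r) -> mu.-integrable `]d, +oo[%classic (EFin \o g) ->
  exists v, pint `]d, +oo[%classic f v /\ rint f d b @[b --> +oo] --> v.
Proof.
move=> nV cf fg ig.
have mD (b : R) : mset `]b, +oo[%classic by exact: measurable_itv.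
have [v hv] : exists v, pint `]d, +oo[%classic f v.
  rewrite ray_cc_bigcup; apply: (@pint_exists _ _ _ g) => //.
  - move=> n; rewrite lerD2l (@le_trans _ _ 1)// ?ler1n// invf_le1 ?ler1n//.
  - move=> m n mn; apply/subsetPset => x /=; rewrite !in_itv/= => /andP[h1 h2].
    apply/andP; split.
      by apply: le_trans h1; rewrite lerD2l lef_pV2 ?posrE ?ltr0n// ler_nat ltnS.
    by apply: (le_trans h2); rewrite lerD2l ler_nat ltnS.
  - move=> n; apply: (continuous_subspaceW _ (@cf (d + n.+1%:R))).
    by apply: subset_itvr; rewrite bnd_simp lerDl invr_ge0.
  - by rewrite -ray_cc_bigcup.
  - by move=> t; rewrite -ray_cc_bigcup /= in_itv/= andbT; exact: fg.
exists v; split => //; apply/cvg_nrmP => e e0.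
have ig' := ig; rewrite ray_bigcup in ig'.
have := Rint_exhaust (@ray_exhaust_nd d) (fun=> measurable_itv _) ig'.
rewrite -ray_bigcup => /cvgrPdist_lt/(_ e e0)[N _ /(_ N (leqnn _)) hN].
exists (d + N.+1%:R); split; first exact: num_real.
move=> b hb; have db : d < b by apply: lt_trans hb; rewrite ltrDl.
have [vb [h1 h2]] := rint_exists nV (ltW db) (cf b).
rewrite (rintE (ltW db) h1).
have moc (c : R) : mset `]d, c]%classic by exact: measurable_itv.
have sub (c : R) : `]d, c]%classic `<=` `]d, +oo[%classic.
  by move=> x /=; rewrite !in_itv/= => /andP[->].
have P := pint_setD (mD d) (moc b) (sub b) hv (pint_oc_of_cc h2).
have mdf (c : R) : mset (`]d, +oo[%classic `\` `]d, c]%classic) by exact: measurableD.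
have igd (c : R) : mu.-integrable (`]d, +oo[%classic `\` `]d, c]%classic) (EFin \o g).
  by apply: (integrableS (mD d) (mdf c) _ ig) => x [].
have := pint_le nV (mdf b) P (igd b).
have fgd t : (`]d, +oo[%classic `\` `]d, b]%classic) t -> nrm (f t) <= g t.
  by move=> [/=]; rewrite in_itv/= andbT => dt _; exact: fg.
move=> /(_ fgd) /le_lt_trans; apply.
pose c := d + N.+1%:R.
apply: (@le_lt_trans _ _ (\int[mu]_(t in `]d, +oo[%classic `\` `]d, c]%classic) g t)).
  have sub2 : `]d, +oo[%classic `\` `]d, b]%classic `<=` `]d, +oo[%classic `\` `]d, c]%classic.
    move=> x [/= h3 h4]; split => // h5; apply: h4; move: h5; rewrite !in_itv/= => /andP[-> h6].
    by rewrite (le_trans h6)// ltW.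
  rewrite -lee_fin /Rintegral !fineK ?integrable_fin_num//.
  apply: ge0_subset_integral => //.
    by have := measurable_int _ (igd c).
  move=> x [/=]; rewrite in_itv/= andbT => dx _; rewrite lee_fin.
  by apply: le_trans (fg x dx); exact: nrm_ge0.
have DE : `]d, +oo[%classic = `]d, c]%classic `|` (`]d, +oo[%classic `\` `]d, c]%classic).
  by rewrite setDUK.
move: hN; rewrite {1}DE Rintegral_setU//.
- by rewrite addrAC subrr add0r; apply: le_lt_trans; exact: ler_norm.
- by rewrite -DE.
- by apply/disj_setPS => x [Ex []].
Qed.

End improper.

(** * Deformation of the contour *)

Section contour.
Context {R : realType}.
Notation mu := (@lebesgue_measure R).
Notation mR := (measurableTypeR R).
Notation mset := (@measurable _ (measurableTypeR R)).
Notation pos := (`]0%R, +oo[%classic : set R).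

Variables (E : completeNormedModType R[i]) (nE : norming E) (S : R -> E -> E).
Hypothesis hS : C0_semigroup S.
Variables (M w : R).
Hypotheses (M0 : 0 < M) (w0 : 0 < w).
Hypothesis bS : forall t x, 0 <= t -> nrm (S t x) <= M * expR (- w * t) * nrm x.
Let B := opN (generator S).
Let G0 := \int[mu]_(s in pos) expR (- s).

Lemma Rint_exp (c : R) : 0 < c -> \int[mu]_(s in pos) expR (- c * s) = c^-1 * G0.
Proof.
move=> c0; have i1 : mu.-integrable pos (EFin \o (fun s => expR (- s))).
  have := @integrable_exp R 1 ltr01.
  by have -> : (fun s : R => expR (- 1 * s)) = (fun s => expR (- s)) by apply/funext => s; rewrite mulN1r.
have [_ <-] := dilation c0 i1.
by apply: eq_Rintegral => s _; rewrite mulNr.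
Qed.

Lemma G0_ge0 : 0 <= G0.
Proof. by apply: Rintegral_ge0 => s _; exact: expR_ge0. Qed.

Lemma res_lap_le z x : complex.Re z < w ->
  nrm (resolvent B z x) <= M * nrm x * ((w - complex.Re z)^-1 * G0).
Proof.
move=> zw; have [_ ->] := resolvent_lap nE hS M0 w0 bS zw.
by rewrite nrmN -Rint_exp ?subr_gt0//; apply: lap_le.
Qed.

Lemma Re_le_normc (z : R[i]) : complex.Re z <= normc z.
Proof.
case: z => a b /=; rewrite (le_trans (ler_norm a))// -sqrtr_sqr ler_wsqrtr// lerDl.
exact: sqr_ge0.
Qed.

(** The half-plane Re z < w lies in the resolvent set, which settles the disc of radius w / 2. For
    |arg z| >= 3 pi / 4 one has Re z <= - |z| sin (pi / 4), so the Laplace bound 1 / (w - Re z)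
    becomes a multiple of 1 / |z|. *)
Lemma admissible_exists : exists c, admissible_contour B c.
Proof.
pose t0 : R := pi / 4 + pi / 2.
have pi0 := @pi_gt0 R.
exists (t0, w / 2); split => /=.
- by rewrite /t0; lra.
- by rewrite divr_gt0.
- move=> z; rewrite normc_def lecR => hz.
  have zw : complex.Re z < w.
    rewrite (le_lt_trans (Re_le_normc z))//.
    have -> : normc z = Num.sqrt (complex.Re z ^+ 2 + complex.Im z ^+ 2) by case: (z).
    by rewrite (le_lt_trans hz)// ltr_pdivrMr// ltr_pMr// ltr1n.
  by have [] := resolvent_lap nE hS M0 w0 bS zw.
- pose k : R := sin (pi / 4).
  have k0 : 0 < k by apply: sin_gt0_pi; lra.
  have hcos phi : t0 <= `|phi| <= pi -> cos phi <= - k.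
    move=> /andP[h1 h2]; have -> : cos phi = cos `|phi|.
      by case: (ger0P phi) => h //; rewrite cosN.
    have -> : - k = cos t0 by rewrite /t0 cosDpihalf.
    have [->|ne] := eqVneq `|phi| t0; first by [].
    apply/ltW; rewrite ltr_cos ?in_itv/= ?h2 ?normr_ge0//; last by rewrite /t0; lra.
    by rewrite lt_neqAle eq_sym ne.
  exists (M * (k^-1 * G0)) => r phi r0 hphi.
  have hc := hcos _ hphi.
  have re : complex.Re (r%:C * cis phi) = r * cos phi by rewrite /cis/= mul0r subr0.
  have rk : r * cos phi <= - (r * k) by rewrite -mulrN ler_pM2l.
  have rk0 : 0 < r * k by rewrite mulr_gt0.
  have zw : complex.Re (r%:C * cis phi) < w.
    by rewrite re (le_lt_trans rk)// (lt_trans _ w0)// oppr_lt0.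
  split; first by have [] := resolvent_lap nE hS M0 w0 bS zw.
  move=> x; have := res_lap_le x zw; rewrite re => H.
  have H2 : nrm (resolvent B (r%:C * cis phi) x) <= M * nrm x * ((r * k)^-1 * G0).
    apply: (le_trans H); rewrite ler_wpM2l ?mulr_ge0 ?nrm_ge0 ?(ltW M0)//.
    have zw' : 0 < w - r * cos phi by move: zw; rewrite re subr_gt0.
    rewrite ler_wpM2r ?G0_ge0// lef_pV2 ?posrE//.
    by rewrite -[leLHS]add0r lerD ?(ltW w0)// lerNr.
  apply: (le_trans (ler_wpM2l (ltW r0) H2)).
  rewrite le_eqVlt; apply/orP; left; apply/eqP; field.
  by rewrite !lt0r_neq0.
Qed.

Lemma contourP : admissible_contour B (contour B).
Proof. by have [c hc] := admissible_exists; apply: xgetPex; exists c. Qed.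

Variables (al : R).
Hypothesis al01 : 0 < al < 1.
Variables (th de : R).
Hypothesis adm : admissible_contour B (th, de).
Let Q := resolvent B.
Let rho := resolvent_set B.

Let th0 : 0 < th. Proof. by case: adm => /andP[]. Qed.
Let thpi : th < pi. Proof. by case: adm => /andP[]. Qed.
Let de0 : 0 < de. Proof. by case: adm. Qed.

Lemma disc_rho z : normc z <= de -> rho z.
Proof.
case: adm => _ _ h _ hz; apply: h; rewrite normc_def lecR.
by move: hz; case: (z).
Qed.

Lemma sector_bound : exists2 K : R, 0 < K & forall r phi x, 0 < r -> th <= `|phi| <= pi ->
  rho (polar r phi) /\ nrm (Q (polar r phi) x) <= K * nrm x / r.
Proof.
case: adm => _ _ _ [K hK]; exists (`|K| + 1); first by rewrite ltr_wpDl.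
move=> r phi x r0 hphi; have [h1 /(_ x) h2] := hK r phi r0 hphi; split => //.
rewrite ler_pdivlMr// mulrC (le_trans h2)// ler_wpM2r ?nrm_ge0//.
by rewrite (le_trans (ler_norm K))// lerDl.
Qed.

Let rayf x phi r := ray_coef al r phi *: Q (polar r phi) x.
Let arcf x r phi := arc_coef al r phi *: Q (polar r phi) x.

Lemma integrable_ray (d c : R) : 0 < d ->
  mu.-integrable `]d, +oo[%classic (EFin \o (fun r => c * (r `^ (- al) / r))).
Proof.
move=> d0; have al0 : 0 < al by case/andP: al01.
have mD : mset `]d, +oo[%classic by exact: measurable_itv.
have sub : `]d, +oo[%classic `<=` pos.
  by move=> y; rewrite posE /= in_itv/= andbT; exact: lt_trans.
have mf : @measurable_fun _ _ mR _ pos (fun r => c * (r `^ (- al) / r)).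
  apply: cont_pos_measurable => s s0; apply: cvgM; first exact: cvg_cst.
  apply: cvgM; first exact: cont_powR.
  by apply: cvgV; [exact: lt0r_neq0|exact: cvg_id].
(* For r > d one has 1 + r <= m r, which reduces the integrand to a power of 1 + r. *)
pose m := 1 + d^-1; have dv0 : 0 < d^-1 by rewrite invr_gt0.
have m0 : 0 < m by rewrite /m; lra.
have ig := pos_integrableZ (`|c| * m `^ (al + 1)) (integrable_pow1 al0).
have igd := integrableS mpos mD sub ig.
apply: (le_integrable mD _ _ igd).
  by apply/measurable_EFinP; apply: measurable_funS mf => //; exact: mpos.
move=> r; rewrite /= in_itv/= andbT => dr; have r0 : 0 < r by exact: lt_trans dr.
have r1 : 0 < 1 + r by lra.
rewrite lee_fin (le_trans _ (ler_norm _))// normrM -mulrA ler_wpM2l//.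
rewrite ger0_norm ?mulr_ge0 ?powR_ge0 ?invr_ge0 ?(ltW r0)//.
have -> : r `^ (- al) / r = r `^ (- (al + 1)).
  by rewrite opprD powRB ?powRr1 ?(ltW r0)// (lt0r_neq0 r0) implybT.
have -> : - al - 1 = - (al + 1) by ring.
rewrite !powRN -ler_pdivrMl ?powR_gt0//.
rewrite -invfM lef_pV2 ?posrE ?mulr_gt0 ?powR_gt0// -powRM ?(ltW m0) ?(ltW r0)//.
apply: ge0_ler_powR; rewrite ?nnegrE ?mulr_ge0 ?(ltW m0) ?(ltW r0) ?(ltW r1)//; first by lra.
rewrite /m mulrDl mul1r addrC lerD2l mulrC ler_pdivlMr// mul1r; exact: ltW.
Qed.

Lemma ray_exists phi x : th <= `|phi| <= pi ->
  exists v, ray_integral B al de phi x = v /\ pint `]de, +oo[%classic (rayf x phi) v.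
Proof.
move=> hphi; have [K K0 hK] := sector_bound.
have cf b : {within `[de, b], continuous (rayf x phi)}.
  have rp r : `[de, b]%classic r -> 0 < r.
    by rewrite /= in_itv/= => /andP[h _]; exact: lt_le_trans h.
  apply: within_scale.
    by move=> r /rp r0; eexists; apply: cder_real; exact: is_derive1_powR.
  apply: (@ccont_within _ _ rho (fun z => Q z x) (fun r => polar r phi)).
  - by move=> z hz; exact: res_ccont.
  - by move=> r /rp r0; have [] := hK r phi x r0 hphi.
  - by move=> r _; eexists; exact: cder_polar_r.
have fg r : de < r -> nrm (rayf x phi r) <= K * nrm x * (r `^ (- al) / r).
  move=> dr; have r0 : 0 < r by exact: lt_trans dr.
  rewrite /rayf nrmZ normc_ray_coef; have [_ h] := hK r phi x r0 hphi.
  rewrite (le_trans (ler_wpM2l (powR_ge0 _ _) h))// le_eqVlt; apply/orP; left; apply/eqP; ring.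
have [v [h1 h2]] := improper_rint nE cf fg (integrable_ray (K * nrm x) de0).
exists v; split => //; rewrite /ray_integral; apply: cvg_lim; first exact: norm_hausdorff.
have -> : (fun r => (cpowN al r phi * cis phi) *: resolvent B (r%:C * cis phi) x) = rayf x phi.
  by apply/funext => r; rewrite /rayf ray_coefE.
exact: h2.
Qed.

Lemma arc_exists x : pint `[- th, th]%classic (arcf x de) (arc_integral B al th de x).
Proof.
have cf : {within `[- th, th], continuous (arcf x de)}.
  apply: within_scale.
    by move=> p _; eexists; apply: cder_cst_mul; exact: cder_cis.
  apply: (@ccont_within _ _ rho (fun z => Q z x) (polar de)).
  - by move=> z hz; exact: res_ccont.
  - by move=> p _; apply: disc_rho; rewrite normc_polar// ltW.
  - by move=> p _; eexists; exact: cder_polar_f.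
have ab : - th <= th by have := th0; lra.
have [v [h1 h2]] := rint_exists nE ab cf.
suff -> : arc_integral B al th de x = v by [].
rewrite /arc_integral.
have -> : (fun phi => (cpowN al de phi * ('i * de%:C * cis phi)) *:
                   resolvent B (de%:C * cis phi) x) = arcf x de.
  by apply/funext => p; rewrite /arcf arc_coefE.
exact: rintE.
Qed.

Lemma cvg_powN (al' : R) : 0 < al' -> forall e : R, 0 < e ->
  exists2 d : R, 0 < d & forall a, 0 < a -> a < d -> a `^ al' < e.
Proof.
move=> a0 e e0; have /cvgrPdist_lt/(_ e e0)[d /= d0 hd] := powR_cvg0 a0.
exists d => // a ap ad; have := hd a; rewrite /= sub0r normrN gtr0_norm// => /(_ ad ap).
by rewrite sub0r normrN; apply: le_lt_trans; exact: ler_norm.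
Qed.

(** Cauchy's theorem on the sector between the angles [f0] and [f1] and the radii [de] and [b n].
    The sectorial bound makes the outer arc of order (b n)^(-al), so it disappears in the limit. *)
Lemma arc_sector (l : E -> R) x f0 f1 v0 v1 : rfun l -> f0 < f1 ->
  (forall p, p \in `[f0, f1] -> th <= `|p| <= pi) ->
  pint `]de, +oo[%classic (rayf x f0) v0 -> pint `]de, +oo[%classic (rayf x f1) v1 ->
  l v1 - l v0 = - \int[mu]_(p in `[f0, f1]) l (arcf x de p).
Proof.
move=> hl f01 hp h0 h1; have [K K0 hK] := sector_bound.
have al0 : 0 < al by case/andP: al01.
have [L L0 hL] := rfun_bound hl.
have [i0 e0] := h0 l hl; have [i1 e1] := h1 l hl.
have mD : mset `]de, +oo[%classic by exact: measurable_itv.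
have ib : mu.-integrable `]de, +oo[%classic (EFin \o (fun r => l (rayf x f1 r) - l (rayf x f0 r))).
  by have := integrableB mD i1 i0.
have eb : \int[mu]_(r in `]de, +oo[) (l (rayf x f1 r) - l (rayf x f0 r)) = l v1 - l v0.
  by rewrite -e0 -e1 -RintegralB.
pose b n : R := de + n.+1%:R.
have ib' := ib; rewrite ray_bigcup in ib'.
have c1 := Rint_exhaust (@ray_exhaust_nd R de) (fun=> measurable_itv _) ib'.
rewrite -ray_bigcup eb in c1.
have bde n : de < b n by rewrite ltrDl.
have b0 n : 0 < b n by exact: lt_trans (bde n).
have cwf r : 0 < r -> {within `[f0, f1], continuous (arcf x r)}.
  move=> r0; apply: within_scale.
    by move=> p _; eexists; apply: cder_cst_mul; exact: cder_cis.
  apply: (@ccont_within _ _ rho (fun z => Q z x) (polar r)).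
  - by move=> z hz; exact: res_ccont.
  - by move=> p pp; have [] := hK r p x r0 (hp p pp).
  - by move=> p _; eexists; exact: cder_polar_f.
have c2 n : \int[mu]_(r in `]de, (b n)]) (l (rayf x f1 r) - l (rayf x f0 r)) =
    \int[mu]_(p in `[f0, f1]) l (arcf x (b n) p) - \int[mu]_(p in `[f0, f1]) l (arcf x de p).
  rewrite /arcf (@polar_cauchy R E rho (fun z => Q z x) (fun v => - Q v (Q v x)) al de (b n) f0 f1
     de0 (bde n) f01)//.
  - apply: Rintegral_itv_obnd_cbnd; apply: integrableS ib => //.
    by move=> r /=; rewrite !in_itv/= => /andP[->].
  - move=> r p; rewrite in_itv/= => /andP[hr _] pp.
    by have [] := hK r p x (lt_le_trans de0 hr) (hp p pp).
  - exact: res_hol.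
  - by move=> z hz; exact: res_ccont2.
pose I n := \int[mu]_(p in `[f0, f1]) l (arcf x (b n) p).
have cI : I n @[n --> \oo] --> (0 : R).
  apply/cvgrPdist_lt => e ep.
  (* The outer arc contributes at most W (b n)^(-al); the added 1 makes [W] positive. *)
  pose W := L * (K * nrm x) * (f1 - f0) + 1.
  have W0 : 0 < W by rewrite ltr_wpDl// !mulr_ge0 ?nrm_ge0 ?(ltW L0) ?(ltW K0)// subr_ge0 ltW.
  have [d d0 hd] := cvg_powN al0 (divr_gt0 ep W0).
  have [N _ hN] := near_infty_natSinv_lt (PosNum d0).
  exists N => // n /= Nn; rewrite sub0r normrN.
  have bi : (b n)^-1 < d.
    apply: le_lt_trans (hN n Nn); rewrite lef_pV2 ?posrE ?ltr0n// lerDr; exact: ltW.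
  have := hd (b n)^-1; rewrite invr_gt0 => /(_ (b0 n) bi).
  have -> : (b n)^-1 `^ al = (b n) `^ (- al).
    by rewrite -powR_inv1 ?(ltW (b0 n))// -powRrM mulN1r.
  rewrite ltr_pdivlMr// => H; apply: le_lt_trans H.
  pose C := (b n) `^ (- al) * (L * (K * nrm x)).
  have C0 : 0 <= C by rewrite !mulr_ge0 ?powR_ge0 ?nrm_ge0 ?(ltW L0) ?(ltW K0).
  have bd p : `[f0, f1]%classic p -> `|l (arcf x (b n) p)| <= C.
    move=> pp; rewrite (le_trans (hL _))// /arcf nrmZ normc_arc_coef ?(ltW (b0 n))//.
    have [_ h] := hK (b n) p x (b0 n) (hp p pp).
    apply: (@le_trans _ _ (L * (b n * b n `^ (- al) * (K * nrm x / b n)))).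
      by rewrite ler_wpM2l ?(ltW L0)// ler_wpM2l// mulr_ge0 ?powR_ge0 ?(ltW (b0 n)).
    rewrite /C le_eqVlt; apply/orP; left; apply/eqP; field; exact: lt0r_neq0.
  have ia := cont_integrable (rfun_within hl (cwf _ (b0 n))).
  have ic : mu.-integrable `[f0, f1]%classic (EFin \o (fun=> C)).
    by apply: cont_integrable => y; exact: cvg_cst.
  apply: (le_trans (le_normr_Rintegral _ ia)) => //.
  apply: (@le_trans _ _ (\int[mu]_(p in `[f0, f1]) C)).
    by apply: le_Rintegral => //; exact: (integrable_norm ia).
  have -> : \int[mu]_(p in `[f0, f1]) C = C * (f1 - f0).
    have mI : mu `[f0, f1]%classic = (f1 - f0)%:E.
      by rewrite lebesgue_measure_itv/= lte_fin f01.
    have := Rintegral_cst mu (measurable_itv `[f0, f1] : mset _) C; set m := fine _.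
    by have -> : m = f1 - f0 by exact: (congr1 fine mI).
  have -> : C * (f1 - f0) = b n `^ (- al) * (L * (K * nrm x) * (f1 - f0)) by rewrite /C; ring.
  by rewrite ler_wpM2l ?powR_ge0// /W lerDl.
have c3 : I n - \int[mu]_(p in `[f0, f1]) l (arcf x de p) @[n --> \oo] -->
    0 - \int[mu]_(p in `[f0, f1]) l (arcf x de p).
  by apply: cvgB => //; exact: cvg_cst.
rewrite sub0r in c3.
rewrite -(cvg_lim (@Rhausdorff R) c1) -(cvg_lim (@Rhausdorff R) c3); congr (lim (_ @ \oo)).
by apply/funext => n; rewrite c2.
Qed.

(** The jump of the ray coefficient across the cut, apart from the factor r^(-al); it equals 2 i sin
    ((1 - al) pi). *)
Let c0 : R[i] := cis ((1 - al) * pi) - cis ((1 - al) * - pi).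
Let D (l : E -> R) x r := l (rayf x pi r) - l (rayf x (- pi) r).

Lemma polar_pi r : polar r pi = - r%:C :> R[i].
Proof.
rewrite /polar /cis cospi sinpi; apply/eqP; rewrite eq_complex/=.
by apply/andP; split; apply/eqP; ring.
Qed.

Lemma polar_Npi r : polar r (- pi) = - r%:C :> R[i].
Proof.
rewrite /polar /cis cosN sinN cospi sinpi; apply/eqP; rewrite eq_complex/=.
by apply/andP; split; apply/eqP; ring.
Qed.

Lemma ray_diff x r :
  rayf x pi r - rayf x (- pi) r = (c0 * (r `^ (- al))%:C) *: Q (- r%:C) x.
Proof.
rewrite /rayf polar_pi polar_Npi -scalerBl /ray_coef /c0; congr (_ *: _); ring.
Qed.

Lemma c0_neq0 : c0 != 0.
Proof.
have s0 : 0 < sin ((1 - al) * pi).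
  have pi0 := @pi_gt0 R; case/andP: al01 => a0 a1; apply: sin_gt0_pi.
  by rewrite mulr_gt0 ?subr_gt0//= gtr_pMl//; lra.
rewrite /c0 mulrN /cis cosN sinN; apply/eqP => -[_].
by move: s0; set s := sin _; lra.
Qed.

(** On the negative half-line the Laplace transform bounds the resolvent by a multiple of 1 / (w +
    r), finite at r = 0, so the two sides of the cut can be followed down to the origin; the bound
    is brought to the form of [integrable_beta]. *)
Lemma ray_bound_pos x r : 0 < r ->
  nrm ((r `^ (- al))%:C *: Q (- r%:C) x) <=
  M * nrm x * G0 * (1 + w^-1) * (r `^ (- al) * (1 + r)^-1).
Proof.
move=> r0; have zw : complex.Re (- r%:C : R[i]) < w by rewrite /= (lt_trans _ w0)// oppr_lt0.
have w00 : 0 < w by exact: w0.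
have := res_lap_le x zw; rewrite /= opprK => H.
rewrite nrmZr ger0_norm ?powR_ge0// (le_trans (ler_wpM2l (powR_ge0 _ _) H))//.
have i0 : 0 < w^-1 by rewrite invr_gt0.
have h : (w + r)^-1 <= (1 + w^-1) * (1 + r)^-1.
  rewrite ler_pdivlMr; last by lra.
  rewrite mulrC ler_pdivrMr; last by lra.
  have -> : (1 + w^-1) * (w + r) = w + r + 1 + r * w^-1 by field; exact: lt0r_neq0.
  have := mulr_gt0 r0 i0; lra.
have -> : M * nrm x * G0 * (1 + w^-1) * (r `^ (- al) * (1 + r)^-1) =
  r `^ (- al) * (M * nrm x * ((1 + w^-1) * (1 + r)^-1 * G0)) by ring.
rewrite ler_wpM2l ?powR_ge0// ler_wpM2l ?mulr_ge0 ?nrm_ge0 ?(ltW M0)//.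
by rewrite ler_wpM2r ?G0_ge0.
Qed.

Lemma ray_cont_pos x phi : th <= `|phi| <= pi -> {within pos, continuous (rayf x phi)}.
Proof.
move=> hphi; have [K K0 hK] := sector_bound.
apply: within_scale.
  by move=> r; rewrite posE => r0; eexists; apply: cder_real; exact: is_derive1_powR.
apply: (@ccont_within _ _ rho (fun z => Q z x) (fun r => polar r phi)).
- by move=> z hz; exact: res_ccont.
- by move=> r; rewrite posE => r0; have [] := hK r phi x r0 hphi.
- by move=> r _; eexists; exact: cder_polar_r.
Qed.

Lemma norm_pi : th <= `|pi : R| <= pi.
Proof. by rewrite ger0_norm ?(ltW (@pi_gt0 R))// lexx andbT ltW. Qed.

Lemma norm_Npi : th <= `|- pi : R| <= pi.
Proof. by rewrite normrN norm_pi. Qed.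

Lemma D_int l x : rfun l -> mu.-integrable pos (EFin \o D l x).
Proof.
move=> hl; have [L L0 hL] := rfun_bound hl.
apply: (@pos_integrable_le _ _ (fun r => L * (normc c0 * (M * nrm x * G0 * (1 + w^-1) *
    (r `^ (- al) * (1 + r)^-1))))).
- have m1 := subspace_continuous_measurable_fun (measurable_itv _) (rfun_within hl (@ray_cont_pos x _ norm_pi)).
  have m2 := subspace_continuous_measurable_fun (measurable_itv _) (rfun_within hl (@ray_cont_pos x _ norm_Npi)).
  exact: (measurable_funB m1 m2).
- move=> r r0; rewrite /D -(rfunB _ _ hl) ray_diff (le_trans (hL _))// ler_wpM2l ?(ltW L0)//.
  by rewrite -scalerA nrmZ ler_wpM2l ?normc_ge0// ray_bound_pos.
- by do 3 apply: pos_integrableZ; exact: integrable_beta.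
Qed.

(** Cauchy's theorem on the slit annulus between the radii [e n] and [de]. Since 0 is in the
    resolvent set, the resolvent is bounded near 0 and the inner circle is of order (e n)^(1 - al),
    which tends to 0. *)
Lemma annulus l x : rfun l ->
  \int[mu]_(p in `[- pi, pi]) l (arcf x de p) = \int[mu]_(r in `]0, de]) D l x r.
Proof.
move=> hl; have [L L0 hL] := rfun_bound hl.
have pi0 := @pi_gt0 R; have pipi : - pi < pi :> R by lra.
have al1 : 0 < 1 - al by case/andP: al01 => _; lra.
pose e n : R := de / n.+2%:R.
have e0 n : 0 < e n by rewrite divr_gt0.
have ede n : e n < de by rewrite ltr_pdivrMr// ltr_pMr// ltr1n.
have cup : `]0, de]%classic = \bigcup_n `](e n), de]%classic.
  apply/seteqP; split=> y /=.
    rewrite in_itv/= => /andP[y0 yd].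
    have yde : 0 < y / de by rewrite divr_gt0.
    have [N _ hN] := near_infty_natSinv_lt (PosNum yde).
    exists N => //=; rewrite in_itv/= yd andbT /e ltr_pdivrMr//.
    have := hN N (leqnn _); rewrite ltr_pdivlMr// mulrC ltr_pdivrMr// => h.
    by rewrite (lt_le_trans h)// ler_pM2l// ler_nat.
  by move=> [n _] /=; rewrite !in_itv/= => /andP[h ->]; rewrite andbT (lt_trans (e0 n)).
have nd : nondecreasing_seq (fun n => `](e n), de]%classic : set R).
  move=> m n mn; apply/subsetPset => y /=; rewrite !in_itv/= => /andP[h ->]; rewrite andbT.
  by apply: le_lt_trans h; rewrite ler_pM2l// lef_pV2 ?posrE ?ltr0n// ler_nat !ltnS.
have mI : mset `]0, de]%classic by exact: measurable_itv.
have iD : mu.-integrable `]0, de]%classic (EFin \o D l x).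
  apply: (integrableS mpos mI _ (D_int x hl)) => y; rewrite posE /= in_itv/=.
  by case/andP.
have iD' := iD; rewrite cup in iD'.
have c1 := Rint_exhaust nd (fun=> measurable_itv _) iD'.
rewrite -cup in c1.
have cwf r : 0 < r <= de -> {within `[- pi, pi], continuous (arcf x r)}.
  move=> /andP[r0 rd]; apply: within_scale.
    by move=> p _; eexists; apply: cder_cst_mul; exact: cder_cis.
  apply: (@ccont_within _ _ rho (fun z => Q z x) (polar r)).
  - by move=> z hz; exact: res_ccont.
  - by move=> p pp; apply: disc_rho; rewrite normc_polar// ltW.
  - by move=> p _; eexists; exact: cder_polar_f.
have c2 n : \int[mu]_(r in `](e n), de]) D l x r =
    \int[mu]_(p in `[- pi, pi]) l (arcf x de p) - \int[mu]_(p in `[- pi, pi]) l (arcf x (e n) p).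
  rewrite /arcf (@polar_cauchy R E rho (fun z => Q z x) (fun v => - Q v (Q v x)) al (e n) de (- pi) pi
     (e0 n) (ede n) pipi)//.
  - apply: Rintegral_itv_obnd_cbnd; apply: (integrableS mI _ _ iD) => //.
    by move=> r /=; rewrite !in_itv/= => /andP[h ->]; rewrite andbT (lt_trans (e0 n)).
  - move=> r p; rewrite in_itv/= => /andP[hr rd] pp; apply: disc_rho; rewrite normc_polar//.
    by rewrite (le_trans _ hr)// ltW.
  - exact: res_hol.
  - by move=> z hz; exact: res_ccont2.
pose I n := \int[mu]_(p in `[- pi, pi]) l (arcf x (e n) p).
have cI : I n @[n --> \oo] --> (0 : R).
  apply/cvgrPdist_lt => ep ep0.
  have r00 : rho 0 by apply: disc_rho; rewrite normc0 ltW.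
  have [d1 d10 h1] := res_ccont x r00 ltr01.
  pose K := nrm (Q 0 x) + 1.
  have K0 : 0 <= K by rewrite addr_ge0 ?nrm_ge0.
  pose W := L * K * (pi - - pi) + 1.
  have W0 : 0 < W by rewrite ltr_wpDl// !mulr_ge0 ?(ltW L0)//; lra.
  have [d2 d20 hd] := cvg_powN al1 (divr_gt0 ep0 W0).
  have dd : 0 < Num.min d1 d2 / de by rewrite divr_gt0// lt_min d10.
  have [N _ hN] := near_infty_natSinv_lt (PosNum dd).
  exists N => // n /= Nn; rewrite sub0r normrN.
  have ed : e n < Num.min d1 d2.
    have := hN n Nn => /= h; have : n.+2%:R^-1 < Num.min d1 d2 / de.
      by apply: le_lt_trans h; rewrite lef_pV2 ?posrE ?ltr0n// ler_nat.
    by rewrite ltr_pdivlMr// mulrC.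
  move: ed; rewrite lt_min => /andP[ed1 ed2].
  have := hd (e n) (e0 n) ed2.
  have -> : (e n) `^ (1 - al) = e n * (e n) `^ (- al).
    by rewrite powRD ?powRr1 ?(ltW (e0 n))// (lt0r_neq0 (e0 n)) implybT.
  rewrite ltr_pdivlMr// => H; apply: le_lt_trans H.
  pose C := e n * (e n) `^ (- al) * (L * K).
  have ep0' : 0 <= e n * e n `^ (- al) by apply: mulr_ge0; [exact: ltW|exact: powR_ge0].
  have C0 : 0 <= C by rewrite /C; apply: mulr_ge0 => //; apply: mulr_ge0 => //; exact: ltW.
  have bd p : `[- pi, pi]%classic p -> `|l (arcf x (e n) p)| <= C.
    move=> pp; rewrite (le_trans (hL _))// /arcf nrmZ normc_arc_coef ?(ltW (e0 n))//.
    have hn : normc (polar (e n) p) = e n by rewrite normc_polar ?(ltW (e0 n)).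
    have h : nrm (Q (polar (e n) p) x) <= K.
      rewrite -(subrK (Q 0 x) (Q _ x)) (le_trans (nrmD _ _))// addrC lerD2l ltW// h1//.
        by apply: disc_rho; rewrite hn ltW.
      by rewrite subr0 hn.
    by rewrite /C [leRHS]mulrCA ler_wpM2l ?(ltW L0)// ler_wpM2l.
  have cwn : {within `[- pi, pi], continuous (arcf x (e n))} by apply: cwf; rewrite e0 ltW.
  have ia := cont_integrable (rfun_within hl cwn).
  have ic : mu.-integrable `[- pi, pi]%classic (EFin \o (fun=> C)).
    by apply: cont_integrable => y; exact: cvg_cst.
  apply: (le_trans (le_normr_Rintegral _ ia)) => //.
  apply: (@le_trans _ _ (\int[mu]_(p in `[- pi, pi]) C)).
    by apply: le_Rintegral => //; exact: (integrable_norm ia).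
  have -> : \int[mu]_(p in `[- pi, pi]) C = C * (pi - - pi).
    have mI2 : mu `[- pi, pi]%classic = (pi - - pi)%:E.
      by rewrite lebesgue_measure_itv/= lte_fin pipi.
    have := Rintegral_cst mu (measurable_itv `[- pi, pi] : mset _) C; set m := fine _.
    by have -> : m = pi - - pi by exact: (congr1 fine mI2).
  have -> : C * (pi - - pi) = e n * e n `^ (- al) * (L * K * (pi - - pi)) by rewrite /C; ring.
  by rewrite ler_wpM2l// /W lerDl.
set J := \int[mu]_(p in _) _.
have c3 : J - I n @[n --> \oo] --> J - 0 by apply: cvgB => //; exact: cvg_cst.
rewrite subr0 in c3.
rewrite -(cvg_lim (@Rhausdorff R) c1) -(cvg_lim (@Rhausdorff R) c3); congr (lim (_ @ \oo)).
by apply/funext => n; rewrite c2.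
Qed.

(** Bookkeeping of the pieces: [v1], [v2], [v3], [v4] stand for the rays at angles - th, th, pi, -
    pi, and [a1], [a2], [a3] for the arcs over [th, pi], [- pi, - th], [- th, th]. *)
Let contour_alg (v1 v2 v3 v4 a1 a2 a3 : R) : v3 - v2 = - a1 -> v1 - v4 = - a2 ->
  - (a2 + (a3 + a1) + (v3 - v4)) = v1 - a3 - v2.
Proof. by move=> h1 h2; lra. Qed.

(** Each ray is rotated to the cut by [arc_sector], at the price of an arc; the arcs complete the
    given one to a full circle, which [annulus] shrinks onto the cut. *)
Lemma contour_total x : exists V : E,
  V = ray_integral B al de (- th) x - arc_integral B al th de x - ray_integral B al de th x /\
  pint pos (fun r => (- c0 * (r `^ (- al))%:C) *: Q (- r%:C) x) V.
Proof.
eexists; split; first by reflexivity.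
have nth : th <= `|th| <= pi by rewrite gtr0_norm// lexx/= ltW.
have nNth : th <= `|- th| <= pi by rewrite normrN.
have [v1 [e1 p1]] := ray_exists x nNth; have [v2 [e2 p2]] := ray_exists x nth.
have [v3 [e3 p3]] := ray_exists x norm_pi; have [v4 [e4 p4]] := ray_exists x norm_Npi.
rewrite e1 e2 => l hl.
have pi0 := @pi_gt0 R.
have iD := D_int x hl.
have LE r : l ((- c0 * (r `^ (- al))%:C) *: Q (- r%:C) x) = - D l x r.
  by rewrite /D -(rfunB _ _ hl) ray_diff -(rfunN _ hl) -scaleNr mulNr.
split.
  have := pos_integrableZ (-1) iD.
  by congr (is_true (mu.-integrable pos _)); apply/funext => r /=; rewrite LE mulN1r.
transitivity (\int[mu]_(r in pos) (-1 * D l x r)).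
  by apply: eq_Rintegral => r _; rewrite LE mulN1r.
rewrite RintegralZl// mulN1r.
have mI : mset `]0, de]%classic by exact: measurable_itv.
have mJ : mset `]de, +oo[%classic by exact: measurable_itv.
have posU : pos = `]0, de]%classic `|` `]de, +oo[%classic.
  apply/seteqP; split=> y /=; rewrite !in_itv/= ?andbT.
    by move=> ->; case: (leP y de) => h; [left|right].
  by move=> [/andP[]//|]; exact: lt_trans.
have iJ : mu.-integrable `]de, +oo[%classic (EFin \o D l x).
  by apply: (integrableS mpos mJ _ iD) => y; rewrite posE /= in_itv/= andbT; exact: lt_trans.
have -> : \int[mu]_(r in pos) D l x r =
    \int[mu]_(r in `]0, de]) D l x r + \int[mu]_(r in `]de, +oo[) D l x r.
  rewrite posU Rintegral_setU//; first by rewrite -posU.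
  by apply/disj_setPS => y /= []; rewrite !in_itv/= => /andP[_ h1] /andP[h2 _]; move: h2; rewrite ltNge h1.
have [i3 q3] := p3 l hl; have [i4 q4] := p4 l hl.
have -> : \int[mu]_(r in `]de, +oo[) D l x r = l v3 - l v4.
  by rewrite -q3 -q4 -RintegralB.
rewrite -(annulus x hl).
have up := @arc_sector l x th pi v2 v3 hl thpi _ p2 p3.
have lo := @arc_sector l x (- pi) (- th) v4 v1 hl _ _ p4 p1.
have {}up : l v3 - l v2 = - \int[mu]_(p in `[th, pi]) l (arcf x de p).
  apply: up => p; rewrite in_itv/= => /andP[h1 h2].
  by rewrite ger0_norm ?h1// (le_trans _ h1)// ltW.
have {}lo : l v1 - l v4 = - \int[mu]_(p in `[- pi, - th]) l (arcf x de p).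
  apply: lo; first by rewrite ltrN2.
  move=> p; rewrite in_itv/= => /andP[h1 h2].
  have p0 : p <= 0 by rewrite (le_trans h2)// oppr_le0 ltW.
  by rewrite ler0_norm//; apply/andP; split; [rewrite lerNr|rewrite lerNl].
have [ia qa] := arc_exists x hl.
rewrite (rfunB _ _ hl) (rfunB _ _ hl) -qa.
have cwn : {within `[- pi, pi], continuous (arcf x de)}.
  apply: within_scale.
    by move=> p _; eexists; apply: cder_cst_mul; exact: cder_cis.
  apply: (@ccont_within _ _ rho (fun z => Q z x) (polar de)).
  - by move=> z hz; exact: res_ccont.
  - by move=> p pp; apply: disc_rho; rewrite normc_polar// ltW.
  - by move=> p _; eexists; exact: cder_polar_f.
have iA := cont_integrable (rfun_within hl cwn).
have piN : - pi <= - th by rewrite lerN2 ltW.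
have thN : - th <= th by apply: (@le_trans _ _ 0); [rewrite oppr_le0 ltW|exact: ltW].
have s1 : \int[mu]_(p in `[- pi, pi]) l (arcf x de p) =
    \int[mu]_(p in `[- pi, - th]) l (arcf x de p) + \int[mu]_(p in `[- th, pi]) l (arcf x de p).
  have k1 : mu.-integrable `]- th, pi]%classic (EFin \o (l \o arcf x de)).
    by apply: integrableS iA => // y; rewrite /= !in_itv/= => /andP[h1 h2]; rewrite h2 andbT (le_trans piN)// ltW.
  rewrite -(Rintegral_itv_obnd_cbnd k1).
  have := @Rintegral_itvB _ _ _ _ (- th) iA; rewrite !bnd_simp => /(_ piN (le_trans thN (ltW thpi))) <-.
  by rewrite addrC subrK.
have s2 : \int[mu]_(p in `[- th, pi]) l (arcf x de p) =
    \int[mu]_(p in `[- th, th]) l (arcf x de p) + \int[mu]_(p in `[th, pi]) l (arcf x de p).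
  have k0 : mu.-integrable `[- th, pi]%classic (EFin \o (l \o arcf x de)).
    by apply: integrableS iA => // y; rewrite /= !in_itv/= => /andP[h1 h2]; rewrite h2 andbT (le_trans piN).
  have k1 : mu.-integrable `]th, pi]%classic (EFin \o (l \o arcf x de)).
    by apply: integrableS k0 => // y; rewrite /= !in_itv/= => /andP[h1 h2]; rewrite h2 andbT (le_trans thN)// ltW.
  rewrite -(Rintegral_itv_obnd_cbnd k1).
  have := @Rintegral_itvB _ _ _ _ th k0; rewrite !bnd_simp => /(_ thN (ltW thpi)) <-.
  by rewrite addrC subrK.
rewrite s1 s2.
exact: contour_alg up lo.
Qed.

End contour.

(** * Fractional powers *)

Section fracJ.
Context {R : realType}.
Notation mu := (@lebesgue_measure R).
Notation mR := (measurableTypeR R).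
Notation mset := (@measurable _ (measurableTypeR R)).
Notation pos := (`]0%R, +oo[%classic : set R).

Lemma within_scaler (V : normedModType R[i]) (c : R -> R) (F : R -> V) (D : set R) :
  (forall t, D t -> {for t, continuous c}) ->
  {within D, continuous F} -> {within D, continuous (fun t => (c t)%:C *: F t)}.
Proof.
move=> hc /subspace_continuousP cF; apply/subspace_continuousP => t Dt.
apply: cvg_scale_nrm; last exact: cF.
move=> e e0; apply: cvg_within.
have /cvgrPdist_lt/(_ e e0) := hc t Dt; apply: filterS => s.
by rewrite -rmorphB normcR distrC.
Qed.

Lemma Rint_gt0 (f : R -> R) (c : R) : mu.-integrable pos (EFin \o f) ->
  (forall s, 0 < s -> 0 <= f s) -> 0 < c -> (forall s, 1 <= s <= 2 -> c <= f s) ->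
  0 < \int[mu]_(s in pos) f s.
Proof.
move=> fi f0 c0 fc; have mI : mset `[1%R, 2%R]%classic by exact: measurable_itv.
have mJ : mset (pos `\` `[1%R, 2%R]%classic) by apply: measurableD => //; exact: mpos.
have sI : `[1%R, 2%R]%classic `<=` pos.
  by move=> y; rewrite posE /= in_itv/= => /andP[y1 _]; exact: lt_le_trans y1.
have posU : pos = `[1%R, 2%R]%classic `|` (pos `\` `[1%R, 2%R]%classic) by rewrite setDUK.
have i1 := integrableS mpos mI sI fi.
rewrite posU Rintegral_setU//; first last.
- by apply/disj_setPS => y /= [yI []].
- by rewrite -posU.
have ic : mu.-integrable `[1%R, 2%R]%classic (EFin \o (fun=> c)).
  by apply: cont_integrable => y; exact: cvg_cst.
apply: ltr_wpDr; first by apply: Rintegral_ge0 => s [ps _]; rewrite posE in ps; exact: f0.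
have h : c <= \int[mu]_(s in `[1%R, 2%R]) f s.
  apply: (@le_trans _ _ (\int[mu]_(s in `[1%R, 2%R]) c)).
    have mI2 : mu `[1%R, 2%R]%classic = (2 - 1)%:E.
      by rewrite lebesgue_measure_itv/= lte_fin ltr1n.
    have := Rintegral_cst mu mI c; set m := fine _.
    have -> : m = 2 - 1 by exact: (congr1 fine mI2).
    by move=> ->; rewrite -[leLHS]mulr1 ler_wpM2l ?(ltW c0)//; lra.
  by apply: le_Rintegral => // s; rewrite /= in_itv/=; exact: fc.
exact: lt_le_trans h.
Qed.

(** Euler's Gamma(1 - a). *)
Definition gam (a : R) := \int[mu]_(r in pos) (r `^ (- a) * expR (- 1 * r)).

Lemma gam_gt0 a : 0 <= a < 1 -> 0 < gam a.
Proof.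
move=> a01; apply: (@Rint_gt0 _ (2 `^ (- a) * expR (- 2))).
- exact: integrable_pow_exp.
- by move=> s _; rewrite mulr_ge0 ?powR_ge0 ?expR_ge0.
- by rewrite mulr_gt0 ?powR_gt0 ?expR_gt0.
- move=> s /andP[s1 s2]; rewrite ler_pM ?powR_ge0 ?expR_ge0//.
    by apply: powR_N_anti => //; [case/andP: a01|exact: lt_le_trans s1].
  by rewrite ler_expR mulN1r lerN2.
Qed.

Lemma gamE a s : 0 <= a < 1 -> 0 < s ->
  \int[mu]_(r in pos) (r `^ (- a) * expR (- s * r)) = s `^ (- (1 - a)) * gam a.
Proof.
move=> a01 s0; have [i1 e1] := dilation s0 (integrable_pow_exp a01 ltr01).
transitivity (\int[mu]_(r in pos) (s `^ a * ((s * r) `^ (- a) * expR (- 1 * (s * r))))).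
  apply: eq_Rintegral => r; rewrite inE posE => r0.
  rewrite powRM ?(ltW r0) ?(ltW s0)// mulN1r mulNr -mulrA [RHS]mulrA -powRD; last first.
    by rewrite (lt0r_neq0 s0) implybT.
  by rewrite subrr powRr0 mul1r.
rewrite RintegralZl// e1 mulrA; congr (_ * _).
by rewrite opprB powRB ?powRr1 ?(ltW s0)// (lt0r_neq0 s0) implybT.
Qed.

Variables (E : completeNormedModType R[i]) (nE : norming E) (S : R -> E -> E).
Hypothesis hS : C0_semigroup S.
Variables (M w : R).
Hypotheses (M0 : 0 < M) (w0 : 0 < w).
Hypothesis bS : forall t x, 0 <= t -> nrm (S t x) <= M * expR (- w * t) * nrm x.
Let B := opN (generator S).

(* The integral of s^(-p) S(s) x; up to a constant it is (-A)^(p-1) x. *)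
Definition Jop p x : E := xget 0 [set v | pint pos (fun s => (s `^ (- p))%:C *: S s x) v].

Lemma JP p x : 0 <= p < 1 -> pint pos (fun s => (s `^ (- p))%:C *: S s x) (Jop p x).
Proof.
move=> p01; apply: xgetPex.
apply: (@pint_pos_exists _ _ _ (fun s => M * nrm x * (s `^ (- p) * expR (- w * s)))) => //.
- apply: within_scaler; last exact: (sg_cont_pos hS M0 w0 bS).
  by move=> t; rewrite posE; exact: cont_powR.
- move=> s s0; rewrite nrmZr ger0_norm ?powR_ge0//.
  rewrite (le_trans (ler_wpM2l (powR_ge0 _ _) (bS x (ltW s0))))//.
  by rewrite le_eqVlt; apply/orP; left; apply/eqP; ring.
- by apply: pos_integrableZ; exact: integrable_pow_exp.
Qed.

Lemma J_bl p : 0 <= p < 1 -> bounded_linear (Jop p).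
Proof.
move=> p01; split.
  move=> c x y; apply: (pint_uniq nE (JP _ p01)).
  have := pintD mpos (pintZ c (JP x p01)) (JP y p01); apply: pint_ext mpos _ => t.
  rewrite posE => t0; rewrite (bl_add _ _ (sg_bl hS (ltW t0))) (blZ _ _ (sg_bl hS (ltW t0))).
  by rewrite scalerDr !scalerA mulrC.
exists (M * \int[mu]_(s in pos) (s `^ (- p) * expR (- w * s))) => x.
have ie := integrable_pow_exp p01 w0.
rewrite mulrAC -RintegralZl//.
apply: (pint_le nE mpos (JP x p01)); first exact: pos_integrableZ.
move=> t; rewrite posE => t0; rewrite nrmZr ger0_norm ?powR_ge0//.
rewrite (le_trans (ler_wpM2l (powR_ge0 _ _) (bS x (ltW t0))))//.
by rewrite le_eqVlt; apply/orP; left; apply/eqP; ring.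
Qed.

Lemma J_comm p t x : 0 <= p < 1 -> 0 <= t -> Jop p (S t x) = S t (Jop p x).
Proof.
move=> p01 t0; apply: (pint_uniq nE (JP _ p01)).
have := pint_map (sg_bl hS t0) (JP x p01); apply: pint_ext mpos _ => s; rewrite posE => s0.
by rewrite /= (blZ _ _ (sg_bl hS t0)) -!(sgD hS) ?(ltW s0)// addrC.
Qed.

Let kmeas (l : E -> R) x : rfun l -> @measurable_fun _ _ mR _ pos (fun s => l (S s x)).
Proof.
move=> hl; have : measurable_fun pos (fun s => l (S s x)).
  apply: subspace_continuous_measurable_fun => //.
  apply: (@rfun_within _ _ _ (fun s => S s x) _ hl); exact: (sg_cont_pos hS M0 w0 bS).
by [].
Qed.

Let mfst : measurable_fun (pos `*` pos : set (mR * mR)) (fun z : mR * mR => z.1).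
Proof. by apply: measurable_funTS; exact: measurable_fst. Qed.
Let msnd : measurable_fun (pos `*` pos : set (mR * mR)) (fun z : mR * mR => z.2).
Proof. by apply: measurable_funTS; exact: measurable_snd. Qed.

(** Fubini for r^(-al) e^(- r s) l (S(s) x): the integral over r first is s^(-(1 - al)) times
    [gam al], the weight in [Jop (1 - al)]. *)
Lemma laplace_swap al (l : E -> R) x (v : E) : 0 < al < 1 -> rfun l ->
  \int[mu]_(r in pos) (r `^ (- al) * l (lap S (- r%:C) x)) = gam al * l (Jop (1 - al) x).
Proof.
move=> /andP[a0 a1] hl; have al01 : 0 <= al < 1 by rewrite ltW.
have bl01 : 0 <= 1 - al < 1 by apply/andP; split; lra.
pose k s := l (S s x); have [_ lZ _] := hl.
pose F r s := r `^ (- al) * (expR (- r * s) * k s).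
have re r : 0 < r -> complex.Re (- r%:C : R[i]) < w by move=> r0; rewrite /= (lt_trans _ w0)// oppr_lt0.
have lapF r s : l (ez (- r%:C) s *: S s x) = expR (- r * s) * k s.
  by rewrite /ez/= oppr0 mul0r cis0 mulr1 lZ.
have [iJ eJ] := JP x bl01 hl.
have Fr r : 0 < r -> mu.-integrable pos (EFin \o F r).
  move=> r0; apply: pos_integrableZ; have [i1 _] := lapP nE hS M0 w0 bS x (re r r0) hl.
  by move: i1; congr (is_true (mu.-integrable pos _)); apply/funext => s /=; rewrite lapF.
have Fs s : 0 < s -> mu.-integrable pos (EFin \o (F^~ s)).
  move=> s0; have := pos_integrableZ (k s) (integrable_pow_exp al01 s0).
  congr (is_true (mu.-integrable pos _)); apply/funext => r /=; rewrite /F.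
  by congr (_%:E); rewrite [- r * s]mulNr [r * s]mulrC mulNr; ring.
have EFs s : 0 < s -> \int[mu]_(r in pos) F r s = gam al * l ((s `^ (- (1 - al)))%:C *: S s x).
  move=> s0; transitivity (\int[mu]_(r in pos) (k s * (r `^ (- al) * expR (- s * r)))).
    apply: eq_Rintegral => r _; rewrite /F.
    by rewrite [- r * s]mulNr [r * s]mulrC mulNr; ring.
  rewrite RintegralZl ?gamE//; last exact: integrable_pow_exp.
  by rewrite lZ /k; ring.
have aF s : 0 < s -> \int[mu]_(r in pos) `|F r s| =
    gam al * `|l ((s `^ (- (1 - al)))%:C *: S s x)|.
  move=> s0; transitivity (\int[mu]_(r in pos) (`|k s| * (r `^ (- al) * expR (- s * r)))).
    apply: eq_Rintegral => r _; rewrite /F !normrM (ger0_norm (powR_ge0 _ _)) (ger0_norm (expR_ge0 _)).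
    by rewrite [- r * s]mulNr [r * s]mulrC mulNr; ring.
  rewrite RintegralZl ?gamE//; last exact: integrable_pow_exp.
  by rewrite lZ normrM (ger0_norm (powR_ge0 _ _)) /k; ring.
have [_ sw] : mu.-integrable pos (EFin \o (fun r => \int[mu]_(s in pos) F r s)) /\
  \int[mu]_(r in pos) \int[mu]_(s in pos) F r s =
  \int[mu]_(s in pos) \int[mu]_(r in pos) F r s.
  apply: quad_fubini => //.
    apply: measurable_funM.
      apply: (measurableT_comp (measurable_powR _)); exact: mfst.
    apply: measurable_funM.
      apply: (@measurableT_comp _ _ _ _ mR mR (@expR R) _ (fun z : mR * mR => - z.1 * z.2)).
        exact: measurable_expR.
      apply: measurable_funM; [exact: (measurableT_comp (@oppr_measurable R setT) mfst)|exact: msnd].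
    apply: (@measurable_comp _ _ _ _ mR _ pos k) => //.
      by move=> _ [[r s] [_ /= h] <-].
    exact: kmeas.
  have := pos_integrableZ (gam al) (integrable_norm iJ).
  apply: eq_integrable => //= s; rewrite inE posE => s0; congr (_%:E); exact/esym/aF.
rewrite -eJ -RintegralZl//.
transitivity (\int[mu]_(r in pos) \int[mu]_(s in pos) F r s).
  apply: eq_Rintegral => r; rewrite inE posE => r0.
  have [i1 <-] := lapP nE hS M0 w0 bS x (re r r0) hl.
  rewrite -RintegralZl//; apply: eq_Rintegral => s _; by rewrite /F -lapF.
rewrite sw; apply: eq_Rintegral => s; rewrite inE posE => s0; exact: EFs.
Qed.

(* The contour is deformed onto the two sides of the negative half-line, where the
   resolvent is the Laplace transform of the semigroup; then Fubini. *)
Lemma negpow_J al : 0 < al < 1 ->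
  exists2 c : R[i], c != 0 & forall x, negpow B al x = c *: Jop (1 - al) x.
Proof.
move=> al01; have := contourP nE hS M0 w0 bS.
rewrite -/B; case E0 : (contour B) => [th de] adm.
have [a0 a1] := andP al01.
pose c0 : R[i] := cis ((1 - al) * pi) - cis ((1 - al) * - pi).
have c00 : c0 != 0 by exact: c0_neq0.
(* By the reflection formula this is 1 / Gamma(al), the classical constant. *)
exists ((2 * pi%:C * 'i)^-1 * (c0 * (gam al)%:C)).
  have pi0 := @pi_gt0 R; have g0 : 0 < gam al by apply: gam_gt0; rewrite ltW.
  have rn (r : R) : 0 < r -> r%:C != 0 :> R[i].
    by move=> r0; apply: contra_neq (lt0r_neq0 r0) => -[].
  rewrite !mulf_neq0 ?invr_eq0 ?rn// !mulf_neq0 ?rn ?pnatr_eq0//.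
  by apply/eqP => -[] /eqP; rewrite oner_eq0.
move=> x; rewrite /negpow E0 -scalerA; congr (_ *: _).
have [V [<- PV]] := contour_total nE hS M0 w0 bS al01 adm x.
apply: norming_sep => // l hl; have [_ <-] := PV l hl.
(* As [l] is only real-linear, the complex factor is moved inside a new functional. *)
pose l' y := l (c0 *: y); have hl' : rfun l' := rfunZ c0 hl.
have -> : l ((c0 * (gam al)%:C) *: Jop (1 - al) x) = gam al * l' (Jop (1 - al) x).
  by rewrite mulrC -scalerA; case: hl => _ -> _.
rewrite -laplace_swap//; apply: eq_Rintegral => r; rewrite inE posE => r0.
have re : complex.Re (- r%:C : R[i]) < w by rewrite /= (lt_trans _ w0)// oppr_lt0.
have [_ ->] := resolvent_lap nE hS M0 w0 bS re.
rewrite scalerN -scaleNr mulNr opprK mulrC -scalerA.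
by case: hl => _ -> _.
Qed.

End fracJ.

Section Jcomposition.
Context {R : realType}.
Notation mu := (@lebesgue_measure R).
Notation mR := (measurableTypeR R).
Notation mset := (@measurable _ (measurableTypeR R)).
Notation pos := (`]0%R, +oo[%classic : set R).
Variables (E : completeNormedModType R[i]) (nE : norming E) (S : R -> E -> E).
Hypothesis hS : C0_semigroup S.
Variables (M w : R).
Hypotheses (M0 : 0 < M) (w0 : 0 < w).
Hypothesis bS : forall t x, 0 <= t -> nrm (S t x) <= M * expR (- w * t) * nrm x.
Let B := opN (generator S).
Notation Jop := (Jop S).

Let kmeas (l : E -> R) x : rfun l -> @measurable_fun _ _ mR _ pos (fun s => l (S s x)).
Proof.
move=> hl; have : measurable_fun pos (fun s => l (S s x)).
  apply: subspace_continuous_measurable_fun => //.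
  apply: (@rfun_within _ _ _ (fun s => S s x) _ hl); exact: (sg_cont_pos hS M0 w0 bS).
by [].
Qed.

Let mfst : measurable_fun (pos `*` pos : set (mR * mR)) (fun z : mR * mR => z.1).
Proof. by apply: measurable_funTS; exact: measurable_fst. Qed.
Let msnd : measurable_fun (pos `*` pos : set (mR * mR)) (fun z : mR * mR => z.2).
Proof. by apply: measurable_funTS; exact: measurable_snd. Qed.

(** The beta integral B(1 - q, q) = pi / sin (pi q). *)
Definition betaq (q : R) := \int[mu]_(u in pos) (u `^ (- q) * (1 + u)^-1).

Lemma betaq_gt0 q : 0 < q < 1 -> 0 < betaq q.
Proof.
move=> q01; have [q0 q1] := andP q01; apply: (@Rint_gt0 _ _ (2 `^ (- q) * 3^-1)).
- exact: integrable_beta.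
- by move=> s s0; rewrite mulr_ge0 ?powR_ge0// invr_ge0 addr_ge0// ltW.
- by rewrite mulr_gt0 ?powR_gt0.
- move=> s /andP[s1 s2]; have s0 : 0 < s by exact: lt_le_trans s1.
  rewrite ler_pM ?powR_ge0//.
    by apply: powR_N_anti => //; exact: ltW.
  rewrite lef_pV2 ?posrE ?addr_gt0//.
  by rewrite (_ : 3 = 1 + 2 :> R) ?lerD2l//; ring.
Qed.

Lemma lap0P x (l : E -> R) : rfun l -> mu.-integrable pos (EFin \o (fun s => l (S s x))) /\
  \int[mu]_(s in pos) l (S s x) = l (lap S 0 x).
Proof.
move=> hl; have re : complex.Re (0 : R[i]) < w by [].
have [i1 e1] := lapP nE hS M0 w0 bS x re hl.
have E0 s : ez (0 : R[i]) s *: S s x = S s x.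
  by rewrite /ez/= !mul0r expR0 cis0 mulr1 scale1r.
split; first by apply: eq_integrable i1 => // s _; rewrite /= E0.
by rewrite -e1; apply: eq_Rintegral => s _; rewrite /= E0.
Qed.

(* After the substitution s = t u the double integral over s^(q-1) k(t+s) t^(-q)
   becomes one over u^(q-1) k(t (1+u)). *)
Lemma J_comp q x : 0 < q < 1 -> Jop q (Jop (1 - q) x) = (betaq (1 - q))%:C *: lap S 0 x.
Proof.
move=> /andP[q0 q1]; have q01 : 0 <= q < 1 by rewrite ltW.
have p01 : 0 < 1 - q < 1 by apply/andP; split; lra.
have pp : 0 <= 1 - q < 1 by case/andP: p01 => /ltW ->.
have iB := integrable_beta p01.
apply: norming_sep => // l hl; have [_ lZ _] := hl; rewrite lZ.
pose k s := l (S s x); have [ik ek] := lap0P x hl.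
pose F t u := u `^ (- (1 - q)) * k ((1 + u) * t).
have inner t : 0 < t -> mu.-integrable pos (EFin \o F t) /\
    l ((t `^ (- q))%:C *: S t (Jop (1 - q) x)) = \int[mu]_(u in pos) F t u.
  move=> t0; have := pint_map (sg_bl hS (ltW t0)) (JP nE hS M0 w0 bS x pp) hl => -[i1 e1].
  have [i2 e2] := dilation t0 i1.
  have Fe : {in pos, forall u, F t u =
      t `^ (1 - q) * l (S t (((t * u) `^ (- (1 - q)))%:C *: S (t * u) x))}.
    move=> u; rewrite inE posE => u0; rewrite (blZ _ _ (sg_bl hS (ltW t0))) lZ.
    rewrite -(sgD hS) ?mulr_ge0 ?(ltW t0) ?(ltW u0)// powRM ?(ltW t0) ?(ltW u0)//.
    rewrite !mulrA -powRD ?subrr ?powRr0 ?mul1r; last by rewrite (lt0r_neq0 t0) implybT.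
    by rewrite /F /k; congr (_ * l (S _ _)); ring.
  split.
    have := pos_integrableZ (t `^ (1 - q)) i2.
    by apply: eq_integrable => // u up; rewrite /= Fe.
  transitivity (\int[mu]_(u in pos)
      (t `^ (1 - q) * l (S t (((t * u) `^ (- (1 - q)))%:C *: S (t * u) x)))).
    rewrite RintegralZl// e2 /= e1 lZ mulrA; congr (_ * _).
    rewrite powRB ?powRr1 ?(ltW t0)//; last by rewrite (lt0r_neq0 t0) implybT.
    by rewrite mulrAC mulfV ?mul1r ?powRN// lt0r_neq0.
  by apply: eq_Rintegral => u up; rewrite Fe.
have [iJ <-] := JP nE hS M0 w0 bS (Jop (1 - q) x) q01 hl.
have Fu u : 0 < u -> mu.-integrable pos (EFin \o (F^~ u)) /\
    \int[mu]_(t in pos) F t u = u `^ (- (1 - q)) * (1 + u)^-1 * l (lap S 0 x).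
  move=> u0; have u1 : 0 < 1 + u by rewrite addr_gt0.
  have [i1 e1] := dilation u1 ik; split; first exact: pos_integrableZ.
  by rewrite -ek -mulrA -e1 -RintegralZl.
have Fa u : 0 < u -> \int[mu]_(t in pos) `|F t u| =
    (\int[mu]_(s in pos) `|k s|) * (u `^ (- (1 - q)) * (1 + u)^-1).
  move=> u0; have u1 : 0 < 1 + u by rewrite addr_gt0.
  have [i1 e1] := dilation u1 (integrable_norm ik).
  transitivity (\int[mu]_(t in pos) (u `^ (- (1 - q)) * `|k ((1 + u) * t)|)).
    by apply: eq_Rintegral => t _; rewrite normrM (ger0_norm (powR_ge0 _ _)).
  by rewrite RintegralZl// e1 /= mulrA mulrC.
have [_ sw] : mu.-integrable pos (EFin \o (fun t => \int[mu]_(u in pos) F t u)) /\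
  \int[mu]_(t in pos) \int[mu]_(u in pos) F t u =
  \int[mu]_(u in pos) \int[mu]_(t in pos) F t u.
  apply: quad_fubini => //.
  - apply: measurable_funM.
      apply: (measurableT_comp (measurable_powR _)); exact: msnd.
    apply: (@measurable_comp _ _ _ _ mR _ pos k _ (fun z : mR * mR => (1 + z.2) * z.1)) => //.
    + move=> _ [[t u] [t0 u0] <-].
      have {}t0 : 0 < t by rewrite -posE.
      have {}u0 : 0 < u by rewrite -posE.
      by rewrite posE mulr_gt0// addr_gt0.
    + exact: kmeas.
    + by apply: measurable_funM => //; apply: measurable_funD.
  - by move=> t /inner[].
  - by move=> u /Fu[].
  - have := pos_integrableZ (\int[mu]_(s in pos) `|k s|) iB.
    by apply: eq_integrable => // u; rewrite inE posE => u0 /=; rewrite Fa.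
transitivity (\int[mu]_(t in pos) \int[mu]_(u in pos) F t u).
  by apply: eq_Rintegral => t; rewrite inE posE => /inner[].
rewrite sw /betaq mulrC -RintegralZl//.
by apply: eq_Rintegral => u; rewrite inE posE => /Fu[_ ->]; rewrite mulrC.
Qed.

Lemma lap0_inj : injective (lap S 0).
Proof.
move=> x y e; have re : complex.Re (0 : R[i]) < w by [].
have [_ h1] := lap_gen nE hS M0 w0 bS x re; have [_ h2] := lap_gen nE hS M0 w0 bS y re.
by apply/oppr_inj; move: h1; rewrite e h2 !scale0r !subr0.
Qed.

Lemma realc_neq0 (r : R) : 0 < r -> r%:C != 0 :> R[i].
Proof. by move=> r0; apply: contra_neq (lt0r_neq0 r0) => -[]. Qed.

(** By [J_comp], J_(1 - q) J_q is a nonzero multiple of (-A)^-1, which is injective. *)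
Lemma J_inj q : 0 < q < 1 -> injective (Jop q).
Proof.
move=> /andP[q0 q1] x y e; apply: lap0_inj.
have p01 : 0 < 1 - q < 1 by apply/andP; split; lra.
have q01 : 0 < q < 1 by rewrite q0.
have k0 := realc_neq0 (betaq_gt0 q01).
apply: (scalerI k0); have := J_comp x p01; have := J_comp y p01.
by rewrite (_ : 1 - (1 - q) = q) ?e => [->|]//; ring.
Qed.

Lemma negpow_inj al : 0 < al < 1 -> injective (negpow B al).
Proof.
move=> al01 x y; have [c c0 h] := negpow_J nE hS M0 w0 bS al01; rewrite !h => /(scalerI c0).
by apply: J_inj; case/andP: al01 => a0 a1; apply/andP; split; lra.
Qed.

Lemma fracpow_negpow al x : 0 < al < 1 -> fracpow B al (negpow B al x) = x.
Proof.
move=> al01; have a0 : al != 0 by case/andP: al01 => /lt0r_neq0.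
rewrite /fracpow (negbTE a0) /=; apply: xget_unique => // y.
exact: negpow_inj.
Qed.

Lemma fracpow_dom al x : 0 < al < 1 -> dom (fracpow B al) x ->
  exists v, [/\ x = negpow B al v & fracpow B al x = v].
Proof.
move=> al01; have a0 : al != 0 by case/andP: al01 => /lt0r_neq0.
move=> h; have [v _ <-] : range (negpow B al) x by move: h; rewrite /fracpow (negbTE a0).
by exists v; split => //; exact: fracpow_negpow.
Qed.

End Jcomposition.

(** * Uniform boundedness *)

Section unif_bound.
Context {R : realType}.
Variables (X : completeNormedModType R[i]) (I : Type) (p : I -> X -> R).
Hypothesis pB : forall i x y, p i x <= p i y + p i (x - y).
Hypothesis pBN : forall i x y, p i (x - y) <= p i x + p i y.
Hypothesis pZ : forall i (r : R) x, 0 < r -> p i (r%:C *: x) = r * p i x.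
Hypothesis pC : forall i, exists2 C, 0 < C & forall x, p i x <= C * nrm x.

(* A gliding hump: either endpoint of a segment x +- v has p i at least p i v,
   and a small enough ball around it keeps p i large. *)
Lemma hump (n : nat) (x : X) (r : R) : 0 < r ->
  (forall K, exists i x, K * nrm x < p i x) ->
  exists x' r', [/\ nrm (x' - x) <= r, 0 < r' <= r / 2 &
    exists i, forall y, nrm (y - x') <= 2 * r' -> n%:R <= p i y].
Proof.
(* Rescaling [u] to norm [r] makes [p i] at least n + 1; the radius (2 C)^-1 chosen below costs at
   most 1 of this. *)
move=> r0 H; have [i [u hu]] := H (n.+1%:R / r).
have [C C0 hC] := pC i.
have u0 : 0 < nrm u.
  apply: nrm_gt0; apply/eqP => u0; move: hu; rewrite u0 nrm0 mulr0 ltNge.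
  by have := hC 0; rewrite nrm0 mulr0 => ->.
pose v := (r / nrm u)%:C *: u.
have nv : nrm v = r.
  by rewrite nrmZr ger0_norm ?divr_ge0 ?(ltW r0) ?nrm_ge0// divfK// lt0r_neq0.
have pv : n.+1%:R <= p i v.
  rewrite pZ ?divr_gt0//.
  have -> : n.+1%:R = r / nrm u * (n.+1%:R / r * nrm u) :> R.
    by field; rewrite !lt0r_neq0.
  by rewrite ler_wpM2l ?divr_ge0 ?(ltW r0) ?nrm_ge0// ltW.
have [x' [hx' px']] : exists x', nrm (x' - x) <= r /\ n.+1%:R <= p i x'.
  have e : (2%:C *: v) = (x + v) - (x - v).
    by rewrite opprB addrC addrA subrK rmorph_nat scaler_nat mulr2n.
  have := pBN i (x + v) (x - v); rewrite -e pZ// => h.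
  case: (leP (p i v) (p i (x + v))) => h1.
    by exists (x + v); rewrite addrC addKr nv; split => //; exact: le_trans h1.
  exists (x - v); rewrite addrC addKr nrmN nv; split => //; apply: (le_trans pv).
  by lra.
exists x', (Num.min (r / 2) ((2 * C)^-1)); split => //.
  by rewrite lt_min ge_min lexx !divr_gt0// invr_gt0 mulr_gt0.
exists i => y hy; have h1 := pB i x' y.
have h2 : p i (x' - y) <= 1.
  apply: (le_trans (hC _)); rewrite -ler_pdivlMl// mulr1 nrmB (le_trans hy)//.
  have : Num.min (r / 2) ((2 * C)^-1) <= (2 * C)^-1 by rewrite ge_min lexx orbT.
  by rewrite invfM -ler_pdivlMl// mulrC; lra.
have : n%:R + 1 <= p i y + 1 by rewrite natr1 (le_trans px')// (le_trans h1)// lerD2l.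
by rewrite lerD2r.
Qed.

(** If no [K] worked, successive humps would produce centres converging to a point at which the
    family is unbounded. The seminorm-like form covers two applications, to operators S(z_n) near 0
    and to truncated L2 norms. *)
Lemma uniform_boundedness : (forall x, exists K, forall i, p i x <= K) ->
  exists K, forall i x, p i x <= K * nrm x.
Proof.
move=> hp; apply: contrapT => H.
have H' K : exists i x, K * nrm x < p i x.
  apply: contrapT => h; apply: H; exists K => i x; rewrite leNgt; apply/negP => hx.
  by apply: h; exists i, x.
have /choice[f hf] : forall s : nat * (X * R), exists s' : X * R, 0 < s.2.2 ->
    [/\ nrm (s'.1 - s.2.1) <= s.2.2, 0 < s'.2 <= s.2.2 / 2 &
    exists i, forall y, nrm (y - s'.1) <= 2 * s'.2 -> s.1%:R <= p i y].
  move=> [n [x r]]; case: (ltP 0 r) => r0; last first.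
    by exists (x, r) => /=; rewrite ltNge r0.
  by have [x' [r' h]] := hump n x r0 H'; exists (x', r').
pose s := fix s n := if n is m.+1 then f (m, s m) else (0 : X, 1 : R).
have s0 n : 0 < (s n).2.
  by elim: n => //= n /(hf (n, s n))[_ /andP[]].
have sP n : [/\ nrm ((s n.+1).1 - (s n).1) <= (s n).2, 0 < (s n.+1).2 <= (s n).2 / 2 &
    exists i, forall y, nrm (y - (s n.+1).1) <= 2 * (s n.+1).2 -> n%:R <= p i y].
  exact: (hf (n, s n) (s0 n)).
(* As the radii at least halve, the steps telescope: r + 2 r' <= 2 r. So the limit stays within
   twice the n-th radius of the n-th centre, exactly where the hump keeps [p i] large. *)
have cau m k : nrm ((s (m + k)%N).1 - (s m).1) <= 2 * (s m).2 - 2 * (s (m + k)%N).2.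
  elim: k => [|k IH]; first by rewrite addn0 subrr nrm0 subrr.
  rewrite addnS; have [h1 /andP[_ h2] _] := sP (m + k)%N.
  apply: (le_trans (nrm_tri (s (m + k)%N).1 _ _)).
  apply: (le_trans (lerD h1 IH)).
  by move: h2; rewrite ler_pdivlMr// => h2; lra.
have sh n : (s n).2 <= n.+1%:R^-1.
  have : (s n).2 * n.+1%:R <= 1.
    elim: n => [|n IH]; first by rewrite mulr1.
    have [_ /andP[_ h2] _] := sP n; move: h2; rewrite ler_pdivlMr// => h2.
    apply: le_trans IH; apply: (@le_trans _ _ ((s n.+1).2 * 2 * n.+1%:R)).
      by rewrite -mulrA ler_wpM2l ?(ltW (s0 _))// -natrM ler_nat mul2n -addnn addnS ltnS leq_addr.
    by rewrite ler_wpM2r.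
  by rewrite -ler_pdivlMr// div1r.
have : cvg ((fun n => (s n).1) @ \oo).
  apply: cauchy_seq_nrm => e e0.
  have e4 : 0 < e / 4 by rewrite divr_gt0.
  have [N _ hN] := near_infty_natSinv_lt (PosNum e4).
  exists N => m n Nm Nn.
  have sN : (s N).2 < e / 4 by apply: le_lt_trans (sh N) _; exact: (hN N (leqnn N)).
  have h k : (N <= k)%N -> nrm ((s k).1 - (s N).1) <= 2 * (s N).2.
    move=> Nk; have := cau N (k - N)%N; rewrite subnKC// => h.
    by apply: (le_trans h); rewrite gerBl mulr_ge0// ltW.
  apply: (le_lt_trans (nrm_tri (s N).1 _ _)); rewrite [X in _ + X]nrmB.
  apply: (le_lt_trans (lerD (h m Nm) (h n Nn))).
  by move: sN; rewrite ltr_pdivlMr// => sN; lra.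
move=> /cvg_ex[x /= cx].
have lx n : nrm (x - (s n).1) <= 2 * (s n).2.
  apply/ler_addgt0Pl => e e0; have /cvg_nrmP/(_ e e0)[N _ hN] := cx.
  have := hN (n + N)%N (leq_addl _ _) => h1.
  apply: (le_trans (nrm_tri (s (n + N)%N).1 _ _)); rewrite lerD ?(ltW h1)//.
  by apply: (le_trans (cau _ _)); rewrite gerBl mulr_ge0// ltW.
have [K hK] := hp x.
have [_ _ [i hi]] := sP (Num.truncn (`|K|)).+1.
have := hi _ (lx _); rewrite leNgt => /negP; apply.
apply: (le_lt_trans (hK i)); apply: (le_lt_trans (ler_norm _)).
exact: truncnS_gt.
Qed.

End unif_bound.

(** * Analytic semigroups *)

Section cauchy_estimate.
Context {R : realType}.
Notation mu := (@lebesgue_measure R).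
Notation mR := (measurableTypeR R).
Notation mset := (@measurable _ (measurableTypeR R)).

Lemma Rint_itv_near (f : R -> R) (a b c e : R) : a < b ->
  mu.-integrable `[a, b] (EFin \o f) ->
  (forall p, a <= p <= b -> `|f p - c| <= e) ->
  `|\int[mu]_(p in `[a, b]) f p - (b - a) * c| <= (b - a) * e.
Proof.
move=> ab fi H; have mI : mset `[a, b]%classic by exact: measurable_itv.
have cstE (k : R) : \int[mu]_(p in `[a, b]) k = (b - a) * k.
  have mI2 : mu `[a, b]%classic = (b - a)%:E by rewrite lebesgue_measure_itv/= lte_fin ab.
  have := Rintegral_cst mu mI k; set m := fine _.
  have -> : m = b - a by exact: (congr1 fine mI2).
  by rewrite mulrC.
have icst (k : R) : mu.-integrable `[a, b] (EFin \o (fun=> k)).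
  by apply: cont_integrable => y; exact: cvg_cst.
rewrite ler_distl -mulrBr -mulrDr -!cstE; apply/andP; split; apply: le_Rintegral => // p.
- by rewrite /= in_itv/= => /H; rewrite ler_distl => /andP[].
- by rewrite /= in_itv/= => /H; rewrite ler_distl => /andP[].
Qed.

(* The integrals of (f z - f 0) / z^2 over all circles around 0 agree; on a small
   circle the integral is nearly 2 pi i f' 0. *)
Lemma cauchy_est (E : normedModType R[i]) (f f' : R[i] -> E) (K : set R[i]) (r1 C : R) :
  norming E -> 0 < r1 -> (forall z, normc z <= r1 -> K z) -> hol K f f' ->
  (forall z, K z -> ccont K f' z) ->
  (forall z, normc z <= r1 -> nrm (f z - f 0) <= C) -> nrm (f' 0) <= C / r1.
Proof.
move=> nE r10 hK hf cf' hC.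
pose g z := f z - f 0.
have K0 : K 0 by apply: hK; rewrite normcR normr0 ltW.
have hg : hol K g f'.
  move=> z Kz; have [h [h1 h2 h3]] := hf z Kz; exists h; split => // w Kw.
  by rewrite /g opprB addrA subrK; exact: h2.
have [h [h1 h2 h3]] := hf 0 K0.
have npi : - pi < pi :> R by have := @pi_gt0 R; lra.
have e1 : nrm (f' 0) = nrm ('i *: f' 0) by rewrite nrmZ normc_i mul1r.
rewrite e1; apply: norming_le => // l hl l1.
pose A r := \int[mu]_(p in `[- pi, pi]) l (arc_coef 2 r p *: g (polar r p)).
have pw r : 0 < r -> r * r `^ (- 2) = r^-1.
  by move=> r0; rewrite powRN powR_mulrn ?(ltW r0)// expr2 invfM mulrA mulfV ?mul1r// lt0r_neq0.
have inK r p : 0 < r -> r <= r1 -> K (polar r p).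
  by move=> r0 rr; apply: hK; rewrite normc_polar// ltW.
have iA r : 0 < r -> r <= r1 -> mu.-integrable `[- pi, pi]
    (EFin \o (fun p => l (arc_coef 2 r p *: g (polar r p)))).
  move=> r0 rr; apply: cont_integrable.
  apply: (@rfun_within _ _ _ (fun p => arc_coef 2 r p *: g (polar r p)) _ hl).
  apply: within_scale.
    by move=> p _; eexists; apply: cder_cst_mul; exact: cder_cis.
  apply: (@ccont_within _ _ K g (polar r)).
  - exact: hol_ccont hg.
  - by move=> p _; exact: inK.
  - by move=> p _; eexists; exact: cder_polar_f.
have bA : `|A r1| <= (pi - - pi) * (C / r1).
  have := @Rint_itv_near (fun p => l (arc_coef 2 r1 p *: g (polar r1 p))) (- pi) pi 0 (C / r1) npi.
  rewrite mulr0 subr0; apply; first exact: iA.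
  move=> p _; rewrite subr0 (le_trans (l1 _))// nrmZ normc_arc_coef ?(ltW r10)// pw//.
  rewrite mulrC ler_wpM2r ?invr_ge0 ?(ltW r10)//; apply: hC.
  by rewrite normc_polar// ltW.
have eA r : 0 < r -> r < r1 -> A r1 = A r.
  move=> r0 rr; apply/eqP; rewrite -subr_eq0; apply/eqP.
  rewrite (@polar_cauchy R E K g f' 2 r r1 (- pi) pi r0 rr npi _ hg cf' l hl); last first.
    move=> s p; rewrite in_itv/= => /andP[s1 s2] _; apply: inK => //.
    exact: lt_le_trans s1.
  transitivity (\int[mu]_(s in `[r, r1]) (0 : R)).
    apply: eq_Rintegral => s _; rewrite polar_pi polar_Npi.
    (* The power z^(-2) is single-valued, so the two sides of the cut cancel. *)
    have -> : ray_coef 2 s pi = ray_coef 2 s (- pi) :> R[i].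
      rewrite /ray_coef; congr (_ * _).
      have -> : (1 - 2) * pi = - pi :> R by ring.
      have -> : (1 - 2) * - pi = pi :> R by ring.
      by rewrite /cis cosN sinN sinpi oppr0.
    by rewrite subrr.
  have mI : mset `[r, r1]%classic by exact: measurable_itv.
  by rewrite Rintegral_cst// mul0r.
suff : `|(pi - - pi) * l ('i *: f' 0)| <= (pi - - pi) * (C / r1).
  rewrite normrM gtr0_norm ?subr_gt0// ler_pM2l ?subr_gt0//; apply: le_trans.
  exact: ler_norm.
apply/ler_addgt0Pr => e e0.
have e2 : 0 < e / (pi - - pi) by rewrite divr_gt0// subr_gt0.
have [d d0 hd] := h3 _ e2.
pose r := Num.min (d / 2) (r1 / 2).
have r0 : 0 < r by rewrite lt_min !divr_gt0.
have rd : r < d by rewrite gt_min ltr_pdivrMr// ltr_pMr// ltr1n.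
have rr : r < r1 by rewrite gt_min [X in _ || X]ltr_pdivrMr// ltr_pMr// ltr1n orbT.
have bR : `|A r - (pi - - pi) * l ('i *: f' 0)| <= (pi - - pi) * (e / (pi - - pi)).
  apply: Rint_itv_near => //; first by apply: iA => //; exact: ltW.
  move=> p _; rewrite /g h2 ?subr0 ?scalerA; last by apply: inK => //; exact: ltW.
  (* Since z^(-2) dz/df times z is the constant i, the integrand on the small circle is i g(z) with
     g the difference quotient at 0, hence close to i f'(0). *)
  have -> : arc_coef 2 r p * polar r p = 'i.
    rewrite /arc_coef /polar pw// (_ : (1 - 2) * p = - p); last by ring.
    rewrite mulrACA [cis _ * _]mulrC cis_conj mulr1 -mulrA -rmorphM/= mulVf ?mulr1//.
    exact: lt0r_neq0.
  rewrite -(rfunB _ _ hl) -scalerBr (le_trans (l1 _))// nrmZ normc_i mul1r -h1 ltW// hd//.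
    by apply: inK => //; exact: ltW.
  by rewrite subr0 normc_polar// ltW.
rewrite mulrCA mulfV ?mulr1 in bR; last by rewrite lt0r_neq0// subr_gt0.
rewrite -(eA r r0 rr) in bR.
have t := ler_distD (A r1) 0 ((pi - - pi) * l ('i *: f' 0)).
rewrite !sub0r !normrN in t.
by apply: (le_trans t); rewrite lerD.
Qed.

End cauchy_estimate.

Section derivative.
Context {R : realType}.
Variables (E : normedModType R[i]) (F : R[i] -> E) (K : set R[i]).
Hypothesis dF : forall z, K z -> derivable (F : R[i]^o -> E) z 1.

Definition cderive (z : R[i]) : E := 'D_1 (F : R[i]^o -> E) z.

Lemma cderiveP z e : K z -> 0 < e -> exists2 d : R, 0 < d & forall h : R[i],
  h != 0 -> normc h < d -> nrm (h^-1 *: (F (z + h) - F z) - cderive z) < e.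
Proof.
move=> Kz e0; have := dF Kz; rewrite /derivable => c.
have /cvg_nrmP/(_ e e0) := c.
move=> [d /= d0 hd].
have dr : d = (complex.Re d)%:C by rewrite RRe_real// gtr0_real.
exists (complex.Re d); first by rewrite -ltcR -dr.
move=> h h0 hh; rewrite nrmB.
have := hd h; rewrite /= sub0r normrN nrmE nrm_normc dr ltcR => /(_ hh h0).
by rewrite /shift /GRing.scale/= mulr1 [h + z]addrC.
Qed.

Lemma cderive_hol : hol K F cderive.
Proof.
move=> z Kz; exists (fun w => if w == z then cderive z else (w - z)^-1 *: (F w - F z)).
rewrite eqxx; split => //.
  move=> w _; case: eqVneq => [->|wz]; first by rewrite !subrr scale0r.
  by rewrite scalerA mulfV ?scale1r// subr_eq0.
move=> e e0; have [d d0 hd] := cderiveP Kz e0; exists d => // w _ wd.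
rewrite eqxx; case: eqVneq => [_|wz]; first by rewrite subrr nrm0.
by have := hd (w - z); rewrite subr_eq0 [z + _]addrC subrK => /(_ wz wd).
Qed.

Lemma cderive_real z : K z ->
  (h%:C)^-1 *: (F (z + h%:C) - F z) @[h --> 0^'+] --> cderive z.
Proof.
move=> Kz; apply/cvg_nrmP => e e0; have [d d0 hd] := cderiveP Kz e0.
exists d => // h /= hh h0; rewrite nrmB; apply: hd.
  by apply: contra_neq (lt0r_neq0 h0) => -[].
by move: hh; rewrite sub0r normrN normcR.
Qed.

End derivative.

Lemma hol_shift (R : realType) (E : normedModType R[i]) (f f' : R[i] -> E) K a :
  hol K f f' -> hol (fun z => K (a + z)) (fun z => f (a + z)) (fun z => f' (a + z)).
Proof.
move=> hf z Kz; have [g [g1 g2 g3]] := hf _ Kz; exists (fun z => g (a + z)); split => //.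
  by move=> w Kw; rewrite g2//; congr (_ *: _); rewrite opprD addrACA subrr add0r.
move=> e e0; have [d d0 hd] := g3 e e0; exists d => // w Kw wd; apply: hd => //.
by rewrite opprD addrACA subrr add0r.
Qed.

Lemma ccont_shift (R : realType) (E : normedModType R[i]) (f : R[i] -> E) K a z :
  ccont K f (a + z) -> ccont (fun z => K (a + z)) (fun z => f (a + z)) z.
Proof.
move=> hf e e0; have [d d0 hd] := hf e e0; exists d => // w Kw wd; apply: hd => //.
by rewrite opprD addrACA subrr add0r.
Qed.

Lemma gen_T (R : realType) (E : normedModType R[i]) (T : R -> E -> E) s x :
  C0_semigroup T -> 0 <= s -> dom (generator T) x ->
  dom (generator T) (T s x) /\ generator T (T s x) = T s (generator T x).
Proof.
move=> [Tbl T0 TD _] s0 dx; have hs := Tbl s s0.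
have c1 : T s ((h%:C)^-1 *: (T h x - x)) @[h --> 0^'+] --> T s (generator T x).
  by apply: bl_cvg hs _; exact: dx.
have c2 : (h%:C)^-1 *: (T h (T s x) - T s x) @[h --> 0^'+] --> T s (generator T x).
  refine (cvg_ext_near _ c1); near=> h.
  have h0 : 0 <= h by near: h; exact: nbhs_right_ge.
  rewrite (blZ _ _ hs) (blB _ _ hs); congr (_ *: (_ - _)).
  by have := TD h s h0 s0; rewrite addrC TD// => /(congr1 (@^~ x)) /= ->.
split; last exact: cvg_lim c2.
by apply/cvg_ex; eexists; exact: c2.
Unshelve. all: by end_near. Qed.

Section analytic.
Context {R : realType}.
Variables (E : completeNormedModType R[i]) (nE : norming E) (T : R -> E -> E).
Variables (theta : R) (S : R[i] -> E -> E).
Hypotheses (th0 : 0 < theta) (ST : forall t : R, 0 <= t -> S t%:C = T t)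
  (Sbl : forall z, sector theta z -> bounded_linear (S z))
  (SD : forall z w, sector theta z -> sector theta w -> S (z + w) = S z \o S w)
  (Sder : forall x z, sector theta z ->
          derivable ((fun w => S w x) : R[i]^o -> E) z 1)
  (Sc : forall x, S z x @[z --> within (sector theta) (nbhs (0 : R[i]^o))] --> x).

(** The disc about [t] has radius proportional to [t]; this scaling is what makes Cauchy's estimate
    produce 1/t. *)
Lemma sector_disc : exists c : R, 0 < c < 1 /\
  forall t z, 0 < t -> normc (z - t%:C) <= c * t -> sector theta z.
Proof.
have /cvgrPdist_lt/(_ theta th0)[d /= d0 hd] := @continuous_atan R 0.
(* The bound 1/2 keeps the real part above t / 2; the bound d / 4 then keeps the slope |b / a| at
   most 2 c < d, so the angle atan (b / a) is below [theta]. *)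
pose c := Num.min 2^-1 (d / 4).
have c0 : 0 < c by rewrite lt_min invr_gt0 divr_gt0 ?ltr0n.
have c2 : c <= 2^-1 by rewrite ge_min lexx.
have cd : 2 * c < d.
  have : c <= d / 4 by rewrite ge_min lexx orbT.
  by rewrite ler_pdivlMr// => h; lra.
exists c; split; first by rewrite c0 (le_lt_trans c2)// invf_lt1 ?ltr1n.
move=> t [a b] t0 hz.
have h1 : `|a - t| <= c * t.
  apply: le_trans hz; rewrite /= -sqrtr_sqr ler_wsqrtr// lerDl; exact: sqr_ge0.
have h2 : `|b| <= c * t.
  by apply: le_trans hz; rewrite /= subr0 -sqrtr_sqr ler_wsqrtr// lerDr; exact: sqr_ge0.
have a2 : t / 2 <= a.
  have ct : c * t <= t / 2 by rewrite mulrC ler_pM2l.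
  by move: h1; rewrite ler_distl => /andP[h1 _]; apply: le_trans h1; lra.
have a0 : 0 < a by apply: lt_le_trans a2; rewrite divr_gt0.
have hba : `|b / a| < d.
  apply: le_lt_trans cd; rewrite normrM normfV (gtr0_norm a0) ler_pdivrMr//.
  apply: (le_trans h2); apply: (@le_trans _ _ (2 * c * (t / 2))).
    by rewrite le_eqVlt; apply/orP; left; apply/eqP; field.
  by rewrite ler_wpM2l// mulr_ge0// ltW.
pose phi := atan (b / a).
have cp : 0 < cos phi by apply: cos_gt0_pihalf; rewrite atan_gtNpi2 atan_ltpi2.
exists (a / cos phi), phi; split; first by rewrite divr_gt0.
  by have := hd (b / a); rewrite /= sub0r normrN atan0 sub0r normrN; apply.
apply/eqP; rewrite eq_complex /= !mul0r subr0 addr0 divfK ?lt0r_neq0// eqxx /=.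
have : tan phi = b / a by rewrite /phi atanK.
rewrite /tan => h; rewrite mulrAC -mulrA h; apply/eqP; field.
exact: lt0r_neq0.
Qed.

Lemma real_sector t : 0 < t -> sector theta t%:C.
Proof.
have [c [/andP[c0 _] hc]] := sector_disc; move=> t0; apply: (hc t) => //.
by rewrite subrr normcR normr0 mulr_ge0// ltW.
Qed.

(** Otherwise some z_n tending to 0 in the sector would have operators S(z_n) of norm above n + 1,
    although S(z_n) x converges to x for every x, against uniform boundedness. *)
Lemma near_bound : exists d K : R, [/\ 0 < d, 0 < K & forall z, sector theta z ->
  normc z < d -> forall x, nrm (S z x) <= K * nrm x].
Proof.
apply: contrapT => H.
have /choice[z hz] : forall n : nat, exists z, [/\ sector theta z, normc z < n.+1%:R^-1 &
    exists x, n.+1%:R * nrm x < nrm (S z x)].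
  move=> n; apply: contrapT => h; apply: H; exists n.+1%:R^-1, n.+1%:R.
  split; rewrite ?invr_gt0 ?ltr0n// => z sz zn x; rewrite leNgt; apply/negP => hx.
  by apply: h; exists z; split => //; exists x.
have nz (u : R[i]) : `|u| = (normc u)%:C by rewrite normc_def; case: u.
have zS n : sector theta (z n) by case: (hz n).
have pw : forall x, exists K, forall n, nrm (S (z n) x) <= K.
  move=> x; have /cvg_nrmP/(_ 1 ltr01) := Sc (x := x).
  move=> [d /= d0 hd].
  have dr : d = (complex.Re d)%:C by rewrite RRe_real// gtr0_real.
  have d0' : 0 < complex.Re d by rewrite -ltcR -dr.
  have [N _ hN] := near_infty_natSinv_lt (PosNum d0').
  (* From [N] on the values are within 1 of [x]; the sum covers the finitely many earlier ones. *)
  exists (nrm x + 1 + \sum_(i < N) nrm (S (z i) x)) => n.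
  have s0 : 0 <= \sum_(i < N) nrm (S (z i) x) by apply: sumr_ge0 => i _; exact: nrm_ge0.
  have [Nn|nN] := leqP N n; last first.
    rewrite (bigD1 (Ordinal nN))//= addrCA lerDl !addr_ge0 ?nrm_ge0//.
    by apply: sumr_ge0 => i _; exact: nrm_ge0.
  have hzn : normc (z n) < complex.Re d.
    by have [_ h _] := hz n; apply: (lt_trans h); exact: (hN n Nn).
  have := hd (z n); rewrite /= sub0r normrN nz dr ltcR => /(_ hzn (zS n)) h.
  rewrite -[leLHS]addr0 lerD// -(subrK x (S (z n) x)) (le_trans (nrmD _ _))// addrC lerD2l.
  by rewrite nrmB ltW.
pose p n x := nrm (S (z n) x).
have p1 n x y : p n x <= p n y + p n (x - y).
  by rewrite /p (blB _ _ (Sbl (zS n))) -{1}(subrK (S (z n) y) (S (z n) x)) addrC nrmD.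
have p2 n x y : p n (x - y) <= p n x + p n y.
  by rewrite /p (blB _ _ (Sbl (zS n))) nrmBD.
have p3 n (r : R) x : 0 < r -> p n (r%:C *: x) = r * p n x.
  by move=> r0; rewrite /p (blZ _ _ (Sbl (zS n))) nrmZr gtr0_norm.
have p4 n : exists2 C, 0 < C & forall x, p n x <= C * nrm x.
  exact: bl_bound (Sbl (zS n)).
have [K hK] := uniform_boundedness p1 p2 p3 p4 pw.
have [N hN] : exists N : nat, K <= N.+1%:R.
  exists (Num.truncn `|K|); rewrite (le_trans (ler_norm K))// ltW// truncnS_gt//.
have [_ _ [x hx]] := hz N; move: hx; rewrite ltNge => /negP; apply.
by rewrite (le_trans (hK N x))// ler_wpM2r ?nrm_ge0.
Qed.

Notation F' x := (cderive (fun z => S z x)).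

Lemma gen_cderive t x : 0 < t ->
  dom (generator T) (T t x) /\ generator T (T t x) = F' x t%:C.
Proof.
move=> t0; have c1 := cderive_real (@Sder x) (real_sector t0).
have c2 : (h%:C)^-1 *: (T h (T t x) - T t x) @[h --> 0^'+] --> F' x t%:C.
  refine (cvg_ext_near _ c1); near=> h.
  have h0 : 0 < h by near: h; exact: nbhs_right_gt.
  by rewrite [t%:C + _]addrC (SD (real_sector h0) (real_sector t0)) /= !ST ?(ltW t0) ?(ltW h0).
split; last exact: cvg_lim c2.
by apply/cvg_ex; eexists; exact: c2.
Unshelve. all: by end_near. Qed.

(** Near a given point the derivative is S(v) applied to a fixed vector; this yields the continuity
    of the derivative that [cauchy_est] requires. *)
Lemma cderive_shift x s v : 0 < s -> sector theta v -> sector theta (v + s%:C) ->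
  F' x (v + s%:C) = S v (F' x s%:C).
Proof.
move=> s0 sv svs; have c1 := cderive_real (@Sder x) svs.
have c2 : S v ((h%:C)^-1 *: (S (s%:C + h%:C) x - S s%:C x)) @[h --> 0^'+] --> S v (F' x s%:C).
  by apply: bl_cvg (Sbl sv) _; exact: (@cderive_real _ _ (fun z => S z x) _ (@Sder x) _ (real_sector s0)).
have c3 : (h%:C)^-1 *: (S (v + s%:C + h%:C) x - S (v + s%:C) x) @[h --> 0^'+] --> S v (F' x s%:C).
  refine (cvg_ext_near _ c2); near=> h.
  have h0 : 0 < h by near: h; exact: nbhs_right_gt.
  rewrite (blZ _ _ (Sbl sv)) (blB _ _ (Sbl sv)) -addrA (SD sv (real_sector s0)).
  have rs : sector theta (s%:C + h%:C) by rewrite -rmorphD; apply: real_sector; exact: addr_gt0.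
  by rewrite (SD sv rs).
by rewrite -(cvg_lim (@norm_hausdorff _ E) c1) -(cvg_lim (@norm_hausdorff _ E) c3).
Unshelve. all: by end_near. Qed.

(** A T(t) x is the derivative of z |-> S(z) x at t. Cauchy's estimate on the disc of radius c t / 2
    applies for small [t], where [near_bound] controls S on the disc; the oscillation there is at
    most 2 K |x|. *)
Lemma gen_est0 : exists d C : R, [/\ 0 < d, 0 < C & forall t x, 0 < t < d ->
  nrm (generator T (T t x)) <= C / t * nrm x].
Proof.
have [c [/andP[c0 c1] hc]] := sector_disc.
have [d [K [d0 K0 hK]]] := near_bound.
exists (d / 2), (2 * K * (2 / c)); split; [by rewrite divr_gt0|by rewrite !mulr_gt0// invr_gt0|].
move=> t x /andP[t0 td].
have [_ ->] := gen_cderive x t0.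
pose D : set R[i] := [set z | normc (z - t%:C) < c * t].
have DS z : D z -> sector theta z by move=> /ltW; exact: hc.
have ct : 0 < c * t by rewrite mulr_gt0.
have ccF z : D z -> ccont D (F' x) z.
  (* A third of the distance from [z] to the boundary: moving from [z] by less than [s] and then
     left by [s] stays in the disc. *)
  move=> Dz; pose s := (c * t - normc (z - t%:C)) / 3.
  have s0 : 0 < s by rewrite divr_gt0// subr_gt0.
  have e3 : normc (z - t%:C) + 3 * s = c * t by rewrite /s; field.
  have inD v : normc (v - z) < s -> sector theta (v - s%:C) /\ D (v - s%:C).
    move=> vs; suff h : D (v - s%:C) by split => //; exact: DS.
    rewrite /D /=.
    have -> : v - s%:C - t%:C = (v - z) + ((z - t%:C) - s%:C) by ring.
    apply: (le_lt_trans (le_normcD _ _)).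
    apply: (lt_le_trans (ltr_leD vs (le_normcD _ _))).
    by rewrite normcN normcR gtr0_norm// -e3; lra.
  have szz : normc (z - z) < s by rewrite subrr normcR normr0.
  have [sz Dzs] := inD z szz.
  have cc := hol_ccont (cderive_hol (@Sder (F' x s%:C))) sz.
  move=> e e0; have [d' d'0 hd'] := cc e e0.
  exists (Num.min d' s); first by rewrite lt_min d'0.
  move=> v Dv; rewrite lt_min => /andP[vd vs].
  have [sv _] := inD v vs.
  have e1 : F' x v = S (v - s%:C) (F' x s%:C).
    by rewrite -cderive_shift ?subrK//; exact: DS.
  have e2 : F' x z = S (z - s%:C) (F' x s%:C).
    by rewrite -cderive_shift ?subrK//; exact: DS.
  rewrite e1 e2; apply: hd' => //.
  by rewrite opprB addrA subrK.
have hD : hol D (fun z => S z x) (F' x).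
  exact: (@cderive_hol _ _ (fun z => S z x) D (fun z Dz => @Sder x _ (DS z Dz))).
have r0 : 0 < c * t / 2 by rewrite divr_gt0.
have sub z : normc z <= c * t / 2 -> D (t%:C + z).
  rewrite /D /= => h; rewrite addrC addKr (le_lt_trans h)//.
  by rewrite ltr_pdivrMr// ltr_pMr// ltr1n.
have bd z : normc z <= c * t / 2 -> nrm (S (t%:C + z) x) <= K * nrm x.
  move=> h; apply: hK; first by apply: DS; exact: sub.
  apply: (le_lt_trans (le_normcD _ _)); rewrite normcR gtr0_norm//.
  have h2 : c * t / 2 <= t / 2.
    by rewrite -mulrA ler_piMl ?(ltW c1)// divr_ge0// ltW.
  move: td; rewrite ltr_pdivlMr// => td; lra.
have := @cauchy_est R E (fun z => S (t%:C + z) x) (fun z => F' x (t%:C + z))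
  (fun z => D (t%:C + z)) (c * t / 2) (2 * (K * nrm x)) nE r0 sub (@hol_shift _ _ _ _ _ t%:C hD).
rewrite addr0 => H; apply: (le_trans (H _ _)).
- by move=> z Dz; apply: ccont_shift; exact: ccF.
- move=> z h; rewrite (le_trans (nrmBD _ _))// mulr_natl mulr2n lerD ?bd//.
  have := bd 0; rewrite addr0; apply; rewrite normcR normr0; exact: ltW.
- rewrite le_eqVlt; apply/orP; left; apply/eqP; field.
  by rewrite !lt0r_neq0.
Qed.

End analytic.

Lemma gen_lin (R : realType) (E : normedModType R[i]) (T : R -> E -> E) c x y :
  (forall t, 0 <= t -> bounded_linear (T t)) -> dom (generator T) x -> dom (generator T) y ->
  dom (generator T) (c *: x + y) /\
  generator T (c *: x + y) = c *: generator T x + generator T y.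
Proof.
move=> hT dx dy.
have c1 : c *: ((h%:C)^-1 *: (T h x - x)) + (h%:C)^-1 *: (T h y - y) @[h --> 0^'+] -->
    c *: generator T x + generator T y.
  by apply: cvgD; [apply: cvgZl_tmp; exact: dx|exact: dy].
have c2 : (h%:C)^-1 *: (T h (c *: x + y) - (c *: x + y)) @[h --> 0^'+] -->
    c *: generator T x + generator T y.
  refine (cvg_ext_near _ c1); near=> h.
  have h0 : 0 <= h by near: h; exact: nbhs_right_ge.
  rewrite (bl_add _ _ (hT _ h0)) (blZ _ _ (hT _ h0)) scalerA mulrC -scalerA -scalerDr scalerBr.
  by rewrite opprD addrACA.
split; last exact: cvg_lim c2.
by apply/cvg_ex; eexists; exact: c2.
Unshelve. all: by end_near. Qed.

Lemma expR_decay (R : realType) (w t : R) : 0 < w -> 0 < t -> expR (- w * t) <= (w * t)^-1.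
Proof.
move=> w0 t0; rewrite mulNr expRN lef_pV2 ?posrE ?expR_gt0 ?mulr_gt0//.
by apply: le_trans (expR_ge1Dx _); rewrite lerDr.
Qed.

(** Half of the decay rate [w1] is kept as [w]; the other half pays for a factor 1/t, as e^(- w t)
    <= 1 / (w t). This carries the small-time estimate to all times, through A T(t) = T(t - s) A
    T(s) with [s] fixed. *)
Lemma analytic_rates (R : realType) (E : completeNormedModType R[i]) (T : R -> E -> E) :
  norming E -> analytic_semigroup T -> exp_stable T ->
  exists M w C : R, [/\ 0 < M, 0 < w, 0 < C,
    forall t x, 0 <= t -> nrm (T t x) <= M * expR (- w * t) * nrm x &
    forall t x, 0 < t -> [/\ dom (generator T) (T t x),
      nrm (generator T (T t x)) <= C * t^-1 * expR (- w * t) * nrm x &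
      nrm (T t x) <= C * t^-1 * expR (- w * t) * nrm x]].
Proof.
move=> nE [hT [th /andP[th0 _] [S [S0 S1 S2 S3 S4]]]] [M0 [w1 [w10 hM0]]].
pose M := `|M0| + 1; have Mp : 0 < M by rewrite ltr_wpDl.
have hM t x : 0 <= t -> nrm (T t x) <= M * expR (- w1 * t) * nrm x.
  move=> t0; apply: (le_trans (hM0 t x t0)); rewrite ler_wpM2r ?nrm_ge0//.
  by rewrite ler_wpM2r ?expR_ge0// /M (le_trans (ler_norm M0))// lerDl.
have [d [C [d0 C0 hC]]] := gen_est0 nE th0 S0 S1 S2 S3 S4.
pose w := w1 / 2; have w0 : 0 < w by rewrite divr_gt0.
have ew t : expR (- w1 * t) = expR (- w * t) * expR (- w * t).
  by rewrite -expRD; congr expR; rewrite /w; field.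
have ew1 t : 0 <= t -> expR (- w * t) <= 1.
  by move=> t0; rewrite expR_le1 mulNr oppr_le0 mulr_ge0// ltW.
pose s := d / 2; have s0 : 0 < s by rewrite divr_gt0.
have sd : s < d by rewrite ltr_pdivrMr// ltr_pMr// ltr1n.
(* [C1] serves A T(t) for t < d, where it compensates e^(- w t), [C2] serves A T(t) for t >= d, and
   [C3] serves T(t). *)
pose C1 := C * expR (w * d).
pose C2 := M * (C / s) * expR (w1 * s) * w^-1.
pose C3 := M * w^-1.
have p1 : 0 < C1 by rewrite mulr_gt0 ?expR_gt0.
have p2 : 0 < C2 by rewrite !mulr_gt0 ?expR_gt0 ?invr_gt0.
have p3 : 0 < C3 by rewrite mulr_gt0 ?invr_gt0.
have le3 (u v a b c e k : R) : 0 <= e -> 0 <= k -> u <= a * k * e -> a <= c -> u <= c * k * e.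
  by move=> e0 k0 h ac; apply: (le_trans h); rewrite ler_wpM2r// ler_wpM2r.
exists M, w, (C1 + C2 + C3); split => //; first by rewrite !addr_gt0.
  move=> t x t0; apply: (le_trans (hM t x t0)); rewrite ler_wpM2r ?nrm_ge0// ler_wpM2l ?(ltW Mp)//.
  by rewrite ew ler_piMl ?expR_ge0// ew1.
move=> t x t0; have ti : 0 <= t^-1 by rewrite invr_ge0 ltW.
have [dx _] := gen_cderive th0 S0 S2 S3 x t0.
have X3 : nrm (T t x) <= C3 * t^-1 * expR (- w * t) * nrm x.
  apply: (le_trans (hM t x (ltW t0))); rewrite ler_wpM2r ?nrm_ge0// ew mulrA ler_wpM2r ?expR_ge0//.
  by rewrite /C3 -mulrA -invfM ler_wpM2l ?(ltW Mp)// expR_decay.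
have mono a y : a <= C1 + C2 + C3 -> y <= a * t^-1 * expR (- w * t) * nrm x ->
    y <= (C1 + C2 + C3) * t^-1 * expR (- w * t) * nrm x.
  move=> ha hy; apply: (le_trans hy).
  by rewrite ler_wpM2r ?nrm_ge0// ler_wpM2r ?expR_ge0// ler_wpM2r.
split => //; last by apply: mono X3; rewrite lerDr ltW// addr_gt0.
have [td|dt] := ltP t d.
  have h := hC t x; rewrite t0 td in h; apply: (mono C1); first by rewrite -addrA lerDl addr_ge0// ltW.
  apply: (le_trans (h isT)); rewrite ler_wpM2r ?nrm_ge0// /C1.
  have -> : C * expR (w * d) * t^-1 * expR (- w * t) = C / t * (expR (w * d) * expR (- w * t)) by ring.
  have e1 : 1 <= expR (w * d) * expR (- w * t).
    rewrite -expRD; have -> : w * d + - w * t = w * (d - t) by ring.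
    apply: le_trans (expR_ge1Dx _).
    by rewrite lerDl mulr_ge0 ?(ltW w0)// subr_ge0 ltW.
  by rewrite ler_peMr// divr_ge0// ltW.
have [ds _] := gen_cderive th0 S0 S2 S3 x s0.
have st : s < t by exact: lt_le_trans dt.
have ts0 : 0 <= t - s by rewrite subr_ge0 ltW.
have -> : T t x = T (t - s) (T s x) by rewrite -(sgD hT) ?subrK// ltW.
have [_ ->] := gen_T hT ts0 ds.
apply: (mono C2); first by rewrite addrAC lerDr addr_ge0// ltW.
apply: (le_trans (hM _ _ ts0)).
have h := hC s x; rewrite s0 sd in h.
apply: (le_trans (ler_wpM2l _ (h isT))); first by rewrite mulr_ge0 ?expR_ge0// ltW.
rewrite mulrA ler_wpM2r ?nrm_ge0//.
have -> : expR (- w1 * (t - s)) = expR (w1 * s) * (expR (- w * t) * expR (- w * t)).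
  by rewrite -ew -expRD; congr expR; ring.
have -> : C2 * t^-1 * expR (- w * t) =
   M * (C / s) * expR (w1 * s) * expR (- w * t) * (w^-1 * t^-1) by rewrite /C2; ring.
have -> : M * (expR (w1 * s) * (expR (- w * t) * expR (- w * t))) * (C / s) =
   M * (C / s) * expR (w1 * s) * expR (- w * t) * expR (- w * t) by ring.
rewrite ler_wpM2l ?mulr_ge0 ?expR_ge0 ?invr_ge0 ?(ltW Mp) ?(ltW C0) ?(ltW s0)//.
by rewrite -invfM expR_decay.
Qed.

(** * Fractional powers applied after the semigroup *)

Section fracspec.
Context {R : realType}.
Notation mu := (@lebesgue_measure R).
Notation mR := (measurableTypeR R).
Notation mset := (@measurable _ (measurableTypeR R)).
Notation pos := (`]0%R, +oo[%classic : set R).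
Variables (E : completeNormedModType R[i]) (nE : norming E) (T : R -> E -> E).
Hypothesis hT : C0_semigroup T.
Variables (M w Ca : R).
Hypotheses (M0 : 0 < M) (w0 : 0 < w) (Ca0 : 0 < Ca).
Hypothesis bT : forall t x, 0 <= t -> nrm (T t x) <= M * expR (- w * t) * nrm x.
Hypothesis gT : forall t x, 0 < t -> [/\ dom (generator T) (T t x),
      nrm (generator T (T t x)) <= Ca * t^-1 * expR (- w * t) * nrm x &
      nrm (T t x) <= Ca * t^-1 * expR (- w * t) * nrm x].
Notation Jop := (Jop T).
Notation gen := (generator T).

Lemma betaE q t : 0 < q < 1 -> 0 < t ->
  mu.-integrable pos (EFin \o (fun s => s `^ (- q) * (s + t)^-1)) /\
  \int[mu]_(s in pos) (s `^ (- q) * (s + t)^-1) = t `^ (- q) * betaq q.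
Proof.
move=> q01 t0; have ti : 0 < t^-1 by rewrite invr_gt0.
have [i1 e1] := dilation ti (integrable_beta q01).
have E1 : {in pos, forall s, s `^ (- q) * (s + t)^-1 =
    t `^ (- q) * t^-1 * ((t^-1 * s) `^ (- q) * (1 + t^-1 * s)^-1)}.
  move=> s; rewrite inE posE => s0; rewrite powRM ?(ltW s0) ?(ltW ti)//.
  have -> : t^-1 `^ (- q) = (t `^ (- q))^-1.
    by rewrite -(powR_inv1 (ltW t0)) -powRrM mulN1r powRN.
  have p0 : t `^ (- q) != 0 by rewrite lt0r_neq0// powR_gt0.
  have st : s + t != 0 by rewrite lt0r_neq0// addr_gt0.
  have ts : t + s != 0 by rewrite addrC.
  field; rewrite ?p0 ?st ?ts ?lt0r_neq0//.
split.
  have := pos_integrableZ (t `^ (- q) * t^-1) i1.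
  by apply: eq_integrable => // s sp; rewrite /= E1.
transitivity (\int[mu]_(s in pos)
    (t `^ (- q) * t^-1 * ((t^-1 * s) `^ (- q) * (1 + t^-1 * s)^-1))).
  by apply: eq_Rintegral => s sp; rewrite E1.
rewrite RintegralZl// e1 invrK mulrA; congr (_ * _).
by rewrite -mulrA mulVf ?mulr1// lt0r_neq0.
Qed.

Lemma J_est q t y N : 0 < q < 1 -> 0 < t ->
  (forall s, 0 < s -> nrm (T s y) <= N * (s + t)^-1) ->
  nrm (Jop q y) <= N * (t `^ (- q) * betaq q).
Proof.
move=> q01 t0 hy; have [i1 <-] := betaE q01 t0.
have qq : 0 <= q < 1 by case/andP: q01 => /ltW ->.
rewrite -RintegralZl//.
apply: (pint_le nE mpos (JP nE hT M0 w0 bT y qq)); first exact: pos_integrableZ.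
move=> s; rewrite posE => s0; rewrite nrmZr ger0_norm ?powR_ge0//.
by rewrite mulrCA ler_wpM2l ?powR_ge0// hy.
Qed.

Lemma J_gen q t x : 0 < q < 1 -> 0 < t -> dom gen (T t (Jop q x)) /\
  gen (T t (Jop q x)) = Jop q (gen (T t x)).
Proof.
move=> q01 t0; have qq : 0 <= q < 1 by case/andP: q01 => /ltW ->.
have [dx _ _] := gT x t0; have hJ := J_bl nE hT M0 w0 bT qq.
have c1 : Jop q ((h%:C)^-1 *: (T h (T t x) - T t x)) @[h --> 0^'+] --> Jop q (gen (T t x)).
  by apply: bl_cvg hJ _; exact: dx.
have c2 : (h%:C)^-1 *: (T h (T t (Jop q x)) - T t (Jop q x)) @[h --> 0^'+] --> Jop q (gen (T t x)).
  refine (cvg_ext_near _ c1); near=> h.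
  have h0 : 0 <= h by near: h; exact: nbhs_right_ge.
  by rewrite (blZ _ _ hJ) (blB _ _ hJ) !(J_comm nE hT M0 w0 bT) ?(ltW t0).
split; last exact: cvg_lim c2.
by apply/cvg_ex; eexists; exact: c2.
Unshelve. all: by end_near. Qed.

Lemma gen_comm s t x : 0 <= s -> 0 < t -> gen (T (s + t) x) = T s (gen (T t x)).
Proof.
move=> s0 t0; have [dx _ _] := gT x t0; rewrite (sgD hT) ?(ltW t0)//.
by have [_ ->] := gen_T hT s0 dx.
Qed.

(** A T(s + t) is of order 1 / (s + t), and integrating this against s^(-q) gives t^(-q) times a
    beta integral; the factor e^(- w s) is dropped. *)
Lemma Jgen_est q t x : 0 < q < 1 -> 0 < t ->
  nrm (Jop q (gen (T t x))) <= Ca * betaq q * t `^ (- q) * expR (- w * t) * nrm x.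
Proof.
move=> q01 t0; apply: (le_trans (@J_est q t _ (Ca * expR (- w * t) * nrm x) q01 t0 _)).
  move=> s s0; rewrite -gen_comm ?(ltW s0)//.
  have [_ h _] := gT x (addr_gt0 s0 t0); apply: (le_trans h).
  have -> : Ca * expR (- w * t) * nrm x * (s + t)^-1 = Ca * (s + t)^-1 * expR (- w * t) * nrm x by ring.
  rewrite ler_wpM2r ?nrm_ge0// ler_wpM2l ?mulr_ge0 ?invr_ge0 ?(ltW Ca0) ?addr_ge0 ?(ltW s0) ?(ltW t0)//.
  by rewrite ler_expR !mulNr lerN2 ler_pM2l// lerDr ltW.
by rewrite le_eqVlt; apply/orP; left; apply/eqP; ring.
Qed.

Lemma JT_est q t x : 0 < q < 1 -> 0 < t ->
  nrm (Jop q (T t x)) <= Ca * betaq q * t `^ (- q) * expR (- w * t) * nrm x.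
Proof.
move=> q01 t0; apply: (le_trans (@J_est q t _ (Ca * expR (- w * t) * nrm x) q01 t0 _)).
  move=> s s0; rewrite -(sgD hT) ?(ltW s0) ?(ltW t0)//.
  have [_ _ h] := gT x (addr_gt0 s0 t0); apply: (le_trans h).
  have -> : Ca * expR (- w * t) * nrm x * (s + t)^-1 = Ca * (s + t)^-1 * expR (- w * t) * nrm x by ring.
  rewrite ler_wpM2r ?nrm_ge0// ler_wpM2l ?mulr_ge0 ?invr_ge0 ?(ltW Ca0) ?addr_ge0 ?(ltW s0) ?(ltW t0)//.
  by rewrite ler_expR !mulNr lerN2 ler_pM2l// lerDr ltW.
by rewrite le_eqVlt; apply/orP; left; apply/eqP; ring.
Qed.

Lemma gen_bl t : 0 < t -> bounded_linear (fun x => gen (T t x)).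
Proof.
move=> t0; split.
  move=> c x y; have [dx _ _] := gT x t0; have [dy _ _] := gT y t0.
  rewrite (bl_add _ _ (sg_bl hT (ltW t0))) (blZ _ _ (sg_bl hT (ltW t0))).
  by have [] := gen_lin c (sg_bl hT) dx dy.
by exists (Ca * t^-1 * expR (- w * t)) => x; have [] := gT x t0.
Qed.

Lemma lap0_gen x : dom gen x -> lap T 0 (gen x) = - x.
Proof.
move=> dx; have re : complex.Re (0 : R[i]) < w by [].
have [_ _ h] := lap_resolvent nE hT M0 w0 bT re.
have := h x dx; have -> : opN gen x = - gen x by [].
by rewrite scale0r sub0r opprK => /(congr1 -%R); rewrite opprK.
Qed.

(* P t stands for (-A)^q T(t). *)
Definition frac_kernel (q C c : R) (P : R -> E -> E) : Prop :=
  [/\ forall t, 0 < t -> bounded_linear (P t),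
      forall t x, 0 < t -> nrm (P t x) <= C * t `^ (- q) * expR (- w * t) * nrm x,
      forall s t x, 0 <= s -> 0 < t -> P (s + t) x = T s (P t x),
      forall s t x, 0 <= s -> 0 < t -> P (s + t) x = P t (T s x) &
      forall t x, 0 < t -> nrm (T t x) <= c * nrm (P t x)].

(** For q > 0, applying (-A)^(-q) = c J_(1 - q) to k J_q A T(t) x and using [J_comp] returns T(t) x,
    so T(t) x lies in the range of the negative power and [P t] is what [fracpow] assigns to it. The
    lower bound on P(t) x is the boundedness of (-A)^(-q). *)
Lemma fracpow_kernel q : 0 <= q < 1 -> exists P C c, [/\ 0 < C, 0 < c, frac_kernel q C c P &
  forall t x, 0 < t -> fracpow (opN gen) q (T t x) = P t x].
Proof.
move=> /andP[q0 q1]; have [->|qn0] := eqVneq q 0.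
  exists T, M, 1; split => //; last by move=> t x t0; rewrite /fracpow eqxx.
  split.
  - by move=> t /ltW; exact: sg_bl.
  - by move=> t x t0; rewrite oppr0 powRr0 mulr1 bT// ltW.
  - by move=> s t x s0 t0; rewrite (sgD hT)// ltW.
  - by move=> s t x s0 t0; rewrite addrC (sgD hT)// ltW.
  - by move=> t x _; rewrite mul1r.
have {q0}q01 : 0 < q < 1 by rewrite lt_neqAle eq_sym qn0 q0.
have qq : 0 <= q < 1 by case/andP: q01 => /ltW ->.
have p01 : 0 < 1 - q < 1 by case/andP: q01 => a b; apply/andP; split; lra.
have pp : 0 <= 1 - q < 1 by case/andP: p01 => /ltW ->.
have [c c0 hc] := negpow_J nE hT M0 w0 bT q01.
have b0 := realc_neq0 (betaq_gt0 q01).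
(* The sign is there because [lap T 0] inverts - A, not A. *)
pose k : R[i] := - (c * (betaq q)%:C)^-1.
pose P t x := k *: Jop q (gen (T t x)).
have hJ := J_bl nE hT M0 w0 bT qq; have hJ' := J_bl nE hT M0 w0 bT pp.
have nP t x : 0 < t -> negpow (opN gen) q (P t x) = T t x.
  move=> t0; rewrite hc /P (blZ _ _ hJ') scalerA; have [dx _ _] := gT x t0.
  have := J_comp nE hT M0 w0 bT (gen (T t x)) p01.
  rewrite (_ : 1 - (1 - q) = q); last by ring.
  move=> ->; rewrite lap0_gen// !scalerN !scalerA -scaleNr.
  suff -> : - (c * k * (betaq q)%:C) = 1 by rewrite scale1r.
  by rewrite /k; field; rewrite c0 b0.
have [D D0 hD] := bl_bound hJ'.
have k0 : 0 <= normc k by exact: normc_ge0.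
have bq := betaq_gt0 q01.
exists P, ((normc k + 1) * (Ca * betaq q)), ((normc c + 1) * D); split.
- by rewrite !mulr_gt0// ltr_wpDl.
- by rewrite mulr_gt0// ltr_wpDl// normc_ge0.
- split.
  + move=> t t0; exact: (bl_comp (bl_comp (gen_bl t0) hJ) (bl_scale E k)).
  + move=> t x t0; rewrite /P nrmZ.
    have h := Jgen_est x q01 t0.
    apply: (le_trans (ler_wpM2l k0 h)); rewrite -!mulrA.
    by rewrite ler_wpM2r ?lerDl// !mulr_ge0 ?powR_ge0 ?expR_ge0 ?nrm_ge0 ?(ltW Ca0) ?(ltW bq).
  + move=> s t x s0 t0; rewrite /P gen_comm// (J_comm nE hT M0 w0 bT)//.
    by rewrite (blZ _ _ (sg_bl hT s0)).
  + by move=> s t x s0 t0; rewrite /P addrC (sgD hT)// ltW.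
  + move=> t x t0; rewrite -nP// hc nrmZ -mulrA.
    by rewrite ler_pM ?normc_ge0 ?nrm_ge0 ?hD// lerDl.
- move=> t x t0; rewrite -(nP t x t0).
  exact: (fracpow_negpow nE hT M0 w0 bT).
Qed.

End fracspec.

(** * The extrapolation space *)

Section extrapolation.
Context {R : realType}.
Notation mu := (@lebesgue_measure R).
Notation pos := (`]0%R, +oo[%classic : set R).
Variables (X : completeNormedModType R[i]) (nX : norming X) (T : R -> X -> X).
Hypothesis hT : C0_semigroup T.
Variables (M w Ca : R).
Hypotheses (M0 : 0 < M) (w0 : 0 < w) (Ca0 : 0 < Ca).
Hypothesis bT : forall t x, 0 <= t -> nrm (T t x) <= M * expR (- w * t) * nrm x.
Hypothesis gT : forall t x, 0 < t -> [/\ dom (generator T) (T t x),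
      nrm (generator T (T t x)) <= Ca * t^-1 * expR (- w * t) * nrm x &
      nrm (T t x) <= Ca * t^-1 * expR (- w * t) * nrm x].
Notation gen := (generator T).
Variables (Y : completeNormedModType R[i]) (iota : X -> Y) (a : R[i]).
Hypothesis ha : resolvent_set gen a.
Hypothesis hY : is_extrapolation_space gen a iota.
Notation Ra := (resolvent gen a).

Let iL : linear iota. Proof. by case: hY. Qed.
Let iN x : nrm (iota x) = nrm (Ra x). Proof. by case: hY. Qed.
Let hR : is_resolvent gen a Ra. Proof. exact: resolventP. Qed.

Lemma iota_bl : bounded_linear iota.
Proof.
split => //; have [hl _ _] := hR; have [K K0 hK] := bl_bound hl.
by exists K => x; rewrite iN.
Qed.

Lemma iota_inj : injective iota.
Proof.
have [hl h _] := hR => x y e; have : nrm (iota (x - y)) = 0.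
  by rewrite (blB _ _ iota_bl) e subrr nrm0.
rewrite iN => /nrm0_eq0 e0; apply/subr0_eq.
have [_ <-] := h (x - y); have [_ h2] := h 0.
by rewrite -h2 e0 (bl0 hl).
Qed.

Let G z := a *: z - gen z.

Let G_lin c x y : dom gen x -> dom gen y ->
  dom gen (c *: x + y) /\ G (c *: x + y) = c *: G x + G y.
Proof.
move=> dx dy; have [d e] := gen_lin c (sg_bl hT) dx dy; split => //.
by rewrite /G e scalerDr scalerBr opprD addrACA !scalerA [a * c]mulrC.
Qed.

Let iG z : dom gen z -> nrm (iota (G z)) = nrm z.
Proof. by move=> dz; rewrite iN; have [_ _ ->] := hR. Qed.

Let GB x y : dom gen x -> dom gen y -> nrm (iota (G x) - iota (G y)) = nrm (x - y).
Proof.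
move=> dx dy; have [d e] := G_lin (-1) dy dx.
rewrite !scaleN1r addrC in d; rewrite !scaleN1r [- y + x]addrC [- G y + _]addrC in e.
by rewrite -(blB _ _ iota_bl) -e iG.
Qed.

Let tn (n : nat) : R := n.+1%:R^-1.
Let tn0 n : 0 < tn n. Proof. by rewrite invr_gt0. Qed.
Let dT n x : dom gen (T (tn n) x). Proof. by have [] := gT x (tn0 n). Qed.

Let cT x : T (tn n) x @[n --> \oo] --> x.
Proof.
apply/cvg_nrmP => e e0; have [_ _ _ /(_ x)/cvg_nrmP/(_ e e0)[d /= d0 hd]] := hT.
have [N _ hN] := near_infty_natSinv_lt (PosNum d0).
exists N => // n Nn; apply: hd => //=.
by rewrite sub0r normrN gtr0_norm//; exact: hN.
Qed.

Let hH := @norm_hausdorff _ Y.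

(* (a - A) extends to an isometry of X onto X_{-1}. *)
Lemma Psi_exists : exists Psi : X -> Y, [/\ linear Psi, forall x, nrm (Psi x) = nrm x,
  forall z, dom gen z -> Psi z = iota (a *: z - gen z),
  (forall x, iota (G (T (tn n) x)) @[n --> \oo] --> Psi x) &
  forall y, exists x, Psi x = y].
Proof.
(* By smoothing, T(1/(n + 1)) x is in the domain and tends to x; a - A followed by [iota] is
   isometric there, so the images converge. *)
pose s x n := iota (G (T (tn n) x)).
have cs x : cvg (s x @ \oo).
  apply: cauchy_seq_nrm => e e0; have e2 : 0 < e / 2 by rewrite divr_gt0.
  have /cvg_nrmP/(_ _ e2)[N _ hN] := @cT x.
  exists N => m n Nm Nn; rewrite GB//; apply: (le_lt_trans (nrm_tri x _ _)).
  rewrite nrmB [ltRHS]splitr; exact: ltrD (hN _ Nm) (hN _ Nn).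
pose Psi x := lim (s x @ \oo).
have hP x : s x @ \oo --> Psi x by exact: cs.
have PL : linear Psi.
  move=> c x y.
  have c1 : (fun n => c *: s x n + s y n) @ \oo --> c *: Psi x + Psi y.
    exact: (cvgD (bl_cvg (bl_scale Y c) (hP x)) (hP y)).
  have c2 : s (c *: x + y) @ \oo --> c *: Psi x + Psi y.
    suff -> : s (c *: x + y) = (fun n => c *: s x n + s y n) by [].
    apply/funext => n; have [_ e] := G_lin c (@dT n x) (@dT n y).
    rewrite /s (bl_add _ _ (sg_bl hT (ltW (tn0 n)))) (blZ _ _ (sg_bl hT (ltW (tn0 n)))) e.
    by rewrite (bl_add _ _ iota_bl) (blZ _ _ iota_bl).
  by rewrite -(cvg_lim hH c2).
have PI x : nrm (Psi x) = nrm x.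
  have c1 : nrm (s x n) @[n --> \oo] --> nrm (Psi x) by exact: cvg_nrm (hP x).
  have c2 : nrm (T (tn n) x) @[n --> \oo] --> nrm x by exact: cvg_nrm (@cT x).
  have e : (fun n => nrm (s x n)) = (fun n => nrm (T (tn n) x)).
    by apply/funext => n; exact: iG.
  rewrite e in c1.
  by rewrite -(cvg_lim (@Rhausdorff R) c1) -(cvg_lim (@Rhausdorff R) c2).
have PD z : dom gen z -> Psi z = iota (G z).
  move=> dz; have c1 : s z @ \oo --> iota (G z).
    apply/cvg_nrmP => e e0; have /cvg_nrmP/(_ _ e0) := @cT z.
    by apply: filterS => n; rewrite -GB.
  by rewrite -(cvg_lim hH c1).
exists Psi; split => // y.
(* Surjectivity: approximate [y] by [iota (x n)]. As |iota x| = |R x| with R the resolvent at [a],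
   the vectors R (x n) are Cauchy in X, and their limit is a preimage of [y]. *)
have [hl hr hr2] := hR; have [_ _ dn] := hY.
have /choice[x hx] : forall n, exists x, nrm (y - iota x) < tn n.
  move=> n; have t0 : 0 < (tn n)%:C by rewrite ltcR.
  have [z [hz [x _ xz]]] : (ball y (tn n)%:C `&` range iota) !=set0.
    by apply: dn; [exists y; exact: ballxx|exact: ball_open].
  by exists x; rewrite xz; move: hz; rewrite -ball_normE/= nrmE ltcR.
have c1 : iota (x n) @[n --> \oo] --> y.
  apply/cvg_nrmP => e e0; have [N _ hN] := near_infty_natSinv_lt (PosNum e0).
  by exists N => // n Nn; apply: lt_trans (hx n) _; exact: hN.
have : cvg ((fun n => Ra (x n)) @ \oo).
  apply: cauchy_seq_nrm => e e0; have e2 : 0 < e / 2 by rewrite divr_gt0.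
  have /cvg_nrmP/(_ _ e2)[N _ hN] := c1.
  exists N => m n Nm Nn; rewrite -(blB _ _ hl) -iN (blB _ _ iota_bl).
  apply: (le_lt_trans (nrm_tri y _ _)); rewrite nrmB [ltRHS]splitr.
  exact: ltrD (hN _ Nm) (hN _ Nn).
move=> /cvg_ex[z /= cz]; exists z.
have PB : bounded_linear Psi by split => //; exists 1 => u; rewrite PI mul1r.
have c2 : Psi (Ra (x n)) @[n --> \oo] --> Psi z by exact: bl_cvg PB cz.
have e : (fun n => Psi (Ra (x n))) = (fun n => iota (x n)).
  by apply/funext => n; have [d1 d2] := hr (x n); rewrite PD// /G d2.
rewrite e in c2.
by rewrite -(cvg_lim hH c1) -(cvg_lim hH c2).
Qed.

Notation SY := (extrap_semigroup T iota).

Variable Psi : X -> Y.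
Hypotheses (PL : linear Psi) (PI : forall x, nrm (Psi x) = nrm x)
  (PD : forall z, dom gen z -> Psi z = iota (a *: z - gen z))
  (PC : forall x, iota (G (T (tn n) x)) @[n --> \oo] --> Psi x)
  (PS : forall y, exists x, Psi x = y).

Let PB : bounded_linear Psi.
Proof. by split => //; exists 1 => u; rewrite PI mul1r. Qed.

Lemma Psi_inj : injective Psi.
Proof.
by move=> x y e; apply/subr0_eq/nrm0_eq0; rewrite -PI (blB _ _ PB) e subrr nrm0.
Qed.

Lemma Psi_inv : exists2 Phi : Y -> X, cancel Phi Psi & linear Phi /\ forall y, nrm (Phi y) = nrm y.
Proof.
have [Phi hPhi] := choice PS; exists Phi => //; split.
  by move=> c x y; apply: Psi_inj; rewrite PL !hPhi.
by move=> y; rewrite -PI hPhi.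
Qed.

Let GT t x : 0 <= t -> dom gen x -> G (T t x) = T t (G x).
Proof.
move=> t0 dx; have [_ e] := gen_T hT t0 dx; rewrite /G e.
by rewrite (blB _ _ (sg_bl hT t0)) (blZ _ _ (sg_bl hT t0)).
Qed.

(** A bounded extension exists, namely the conjugate of T(t) by [Psi]; it extends T(t) because iota
    x = Psi (R x) with R the resolvent at [a], and R x stays in the domain under T(t). *)
Lemma extrapP t : 0 <= t -> bounded_linear (SY t) /\ forall x, SY t (iota x) = iota (T t x).
Proof.
move=> t0; have [Phi hPhi [Phil Phin]] := Psi_inv.
have PhiB : bounded_linear Phi by split => //; exists 1 => u; rewrite Phin mul1r.
suff : exists S, bounded_linear S /\ forall x, S (iota x) = iota (T t x).
  by move=> h; exact: (@xgetPex _ _ [set S : Y -> Y | bounded_linear S /\ forall x, S (iota x) = iota (T t x)] h).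
exists (fun y => Psi (T t (Phi y))); split.
  exact: (bl_comp (bl_comp PhiB (sg_bl hT t0)) PB).
move=> x; have [_ hr _] := hR; have [d1 d2] := hr x.
have e1 : iota x = Psi (Ra x) by rewrite PD// d2.
have -> : Phi (iota x) = Ra x by apply: Psi_inj; rewrite hPhi.
have [d3 _] := gen_T hT t0 d1.
by rewrite PD// -/(G _) GT// /G d2.
Qed.

(** The chosen extension is known only on the range of [iota]; density and boundedness identify it
    with the conjugate of T(t) by [Psi]. *)
Lemma extrap_Psi t x : 0 <= t -> SY t (Psi x) = Psi (T t x).
Proof.
move=> t0; have [hb hi] := extrapP t0.
have c1 : SY t (iota (G (T (tn n) x))) @[n --> \oo] --> SY t (Psi x) by exact: (bl_cvg hb (@PC x)).
have e : (fun n => SY t (iota (G (T (tn n) x)))) = (fun n => iota (G (T (tn n) (T t x)))).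
  apply/funext => n; rewrite hi -GT// -!(sgD hT) ?(ltW (tn0 n))//.
  by rewrite addrC.
rewrite e in c1.
by rewrite -(cvg_lim hH c1); apply: cvg_lim => //; exact: PC.
Qed.

Lemma extrap_C0 : C0_semigroup SY.
Proof.
split.
- by move=> t /extrapP[].
- by apply/funext => y; have [x <-] := PS y; rewrite extrap_Psi// (sg0 hT).
- move=> s t s0 t0; apply/funext => y; have [x <-] := PS y.
  by rewrite /= !extrap_Psi ?addr_ge0// (sgD hT).
- move=> y; have [x <-] := PS y.
  have [_ _ _ /(_ x) c0] := hT.
  have c1 : Psi (T t x) @[t --> 0^'+] --> Psi x by exact: bl_cvg PB c0.
  refine (cvg_ext_near _ c1); near=> t.
  by rewrite extrap_Psi.
Unshelve. all: by end_near. Qed.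

Lemma extrap_bound t y : 0 <= t -> nrm (SY t y) <= M * expR (- w * t) * nrm y.
Proof. by move=> t0; have [x <-] := PS y; rewrite extrap_Psi// !PI bT. Qed.

(** X_{-1} is given merely as a Banach space; its norming functionals are pulled back along the
    isometric inverse of [Psi]. *)
Lemma extrap_norming : norming Y.
Proof. by have [Phi hPhi [Phil Phin]] := Psi_inv; exact: norming_iso nX Phil Phin. Qed.

Lemma J_Psi p x : 0 <= p < 1 -> Jop SY p (Psi x) = Psi (Jop T p x).
Proof.
move=> p01; apply: (pint_uniq extrap_norming (JP extrap_norming extrap_C0 M0 w0 extrap_bound _ p01)).
have := pint_map PB (JP nX hT M0 w0 bT x p01); apply: pint_ext mpos _ => t; rewrite posE => t0.
by rewrite /= (blZ _ _ PB) extrap_Psi// ltW.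
Qed.

Variables (U : completeNormedModType R[i]).

(* K t u is the element of X represented by T_{-1}(t) B u. *)
Definition control_kernel (gamma C : R) (B : U -> Y) (K : R -> U -> X) : Prop :=
  [/\ forall t u, 0 < t -> SY t (B u) = iota (K t u),
      forall t, 0 < t -> bounded_linear (K t),
      forall t u, 0 < t -> nrm (K t u) <= C * t `^ (- gamma) * expR (- w * t) * nrm u &
      forall s t u, 0 <= s -> 0 < t -> K (s + t) u = T s (K t u)].

(* For gamma > 0, B u = (-A)^-(1-gamma) v with |v| <= N |u|, which gives K the rate
   t^(-gamma). *)
Lemma kernel_exists gamma (B : U -> Y) : 0 <= gamma < 1 ->
  bounded_into_Xneg T iota gamma B ->
  bounded_linear B /\ exists K C, 0 < C /\ control_kernel gamma C B K.
Proof.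
move=> /andP[g0 g1] [BL BX [N0 hN0]].
pose N := `|N0| + 1; have Np : 0 < N by rewrite ltr_wpDl.
have hN u : Xneg_norm T iota gamma (B u) <= N * nrm u.
  apply: (le_trans (hN0 u)); rewrite ler_wpM2r ?nrm_ge0//.
  by rewrite (le_trans (ler_norm N0))// lerDl.
have [Dr Dr0 hDr] := bl_bound iota_bl.
have [e|gn0] := eqVneq gamma 0.
  rewrite e /Xneg_norm /Xneg eqxx in hN BX.
  pose b u := opinv iota (B u).
  have hb u : iota (b u) = B u.
    have [x _ xb] := BX u.
    exact: (@xgetPex _ 0 [set x | iota x = B u] (ex_intro _ x xb)).
  have bl : linear b.
    by move=> c x y; apply: iota_inj; rewrite iL !hb BL.
  have bB : bounded_linear b by split => //; exists N => u; exact: hN.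
  split.
    by split => //; exists (Dr * N) => u; rewrite -hb (le_trans (hDr _))// -mulrA ler_wpM2l ?hN// ltW.
  exists (fun t u => T t (b u)), (M * N); split; first by rewrite mulr_gt0.
  split.
  - by move=> t u /ltW t0; have [_ h] := extrapP t0; rewrite -hb h.
  - by move=> t /ltW t0; exact: (bl_comp bB (sg_bl hT t0)).
  - move=> t u /ltW t0; rewrite e oppr0 powRr0 mulr1 (le_trans (bT _ t0))//.
    have -> : M * N * expR (- w * t) * nrm u = M * expR (- w * t) * (N * nrm u) by ring.
    by rewrite ler_wpM2l ?hN// mulr_ge0 ?expR_ge0// ltW.
  - by move=> s t u s0 /ltW t0; rewrite (sgD hT).
have g01 : 0 < gamma < 1 by rewrite lt_neqAle eq_sym gn0 g0.
have gg : 0 <= gamma < 1 by rewrite g0.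
have al01 : 0 < 1 - gamma < 1 by case/andP: g01 => x y; apply/andP; split; lra.
rewrite /Xneg_norm /Xneg (negbTE gn0) in hN BX.
have nY := extrap_norming; have cY := extrap_C0.
have [c c0 hc] := negpow_J nY cY M0 w0 extrap_bound al01.
rewrite (_ : 1 - (1 - gamma) = gamma) in hc; last by ring.
pose v u := extrap_fracpow T iota (1 - gamma) (B u).
have hv u : B u = c *: Jop SY gamma (v u).
  rewrite -hc; have [v' [e1 e2]] := fracpow_dom nY cY M0 w0 extrap_bound al01 (BX u).
  by rewrite [LHS]e1 /v /extrap_fracpow e2.
have hJY := J_bl nY cY M0 w0 extrap_bound gg; have hJ := J_bl nX hT M0 w0 bT gg.
have [Phi hPhi [Phil Phin]] := Psi_inv.
pose v' u := Phi (v u).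
have vN u : nrm (v' u) <= N * nrm u.
  by rewrite /v' Phin; apply: le_trans (hN u); rewrite lerDr nrm_ge0.
(* The fractional power is defined by a choice of preimage, so linearity is read off after applying
   the injective J_gamma. *)
have vL : linear v'.
  move=> k x y; rewrite /v' -Phil; congr Phi.
  apply: (J_inj nY cY M0 w0 extrap_bound g01); apply: (scalerI c0).
  rewrite -hv BL !hv (bl_add _ _ hJY) (blZ _ _ hJY) scalerDr !scalerA; congr (_ *: _ + _).
  by rewrite mulrC.
have vB : bounded_linear v' by split => //; exists N.
have hB u : B u = Psi (c *: Jop T gamma (v' u)).
  by rewrite hv -[v u]hPhi J_Psi// (blZ _ _ PB).
split.
  split => //; have [D D0 hD] := bl_bound hJ; exists (normc c * (D * N)) => u.
  rewrite hB PI nrmZ -mulrA ler_wpM2l ?normc_ge0// (le_trans (hD _))//.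
  by rewrite -mulrA ler_wpM2l ?vN// ltW.
pose C0 := Ca * betaq gamma.
have bq := betaq_gt0 g01; have C00 : 0 < C0 by rewrite mulr_gt0.
(* From B u = Psi (c J_gamma v'): the semigroup moves through [Psi] into X, and on the smoothed
   vector [Psi] is [iota] after a - A. The term with the generator carries the singularity. *)
exists (fun t u => c *: (a *: Jop T gamma (T t (v' u)) - Jop T gamma (gen (T t (v' u))))),
  ((normc c + 1) * ((normc a + 1) * C0 * N)); split.
  by rewrite !mulr_gt0// ltr_wpDl// normc_ge0.
split.
- move=> t u t0; have [d1 e1] := J_gen nX hT M0 w0 bT gT (v' u) g01 t0.
  rewrite hB extrap_Psi ?(ltW t0)// (blZ _ _ (sg_bl hT (ltW t0))) (blZ _ _ PB) PD//.
  by rewrite e1 (blZ _ _ iota_bl) (J_comm nX hT M0 w0 bT)// ltW.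
- move=> t t0; have h1 := bl_comp (bl_comp vB (bl_comp (sg_bl hT (ltW t0)) hJ)) (bl_scale X a).
  have h2 := bl_comp (bl_comp vB (bl_comp (gen_bl hT gT t0) hJ)) (bl_scale X (-1)).
  have := bl_comp (bl_addf h1 h2) (bl_scale X c).
  suff -> : (fun u => c *: (a *: Jop T gamma (T t (v' u)) - Jop T gamma (gen (T t (v' u))))) =
    (fun x => c *: x) \o (fun u => ((fun x => a *: x) \o (Jop T gamma \o T t \o v')) u +
      ((fun x => -1 *: x) \o (Jop T gamma \o (fun x => gen (T t x)) \o v')) u) by [].
  by apply/funext => u /=; rewrite scaleN1r.
- move=> t u t0; rewrite nrmZ.
  have h1 := JT_est nX hT M0 w0 Ca0 bT gT (v' u) g01 t0.
  have h2 := Jgen_est nX hT M0 w0 Ca0 bT gT (v' u) g01 t0.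
  rewrite -/C0 in h1 h2; pose Z := t `^ (- gamma) * expR (- w * t).
  have Z0 : 0 <= Z by rewrite mulr_ge0 ?powR_ge0 ?expR_ge0.
  have h3 : nrm (a *: Jop T gamma (T t (v' u)) - Jop T gamma (gen (T t (v' u)))) <=
      (normc a + 1) * (C0 * Z * (N * nrm u)).
    have hz : C0 * t `^ (- gamma) * expR (- w * t) * nrm (v' u) <= C0 * Z * (N * nrm u).
      have -> : C0 * t `^ (- gamma) * expR (- w * t) * nrm (v' u) = C0 * Z * nrm (v' u).
        by rewrite /Z; ring.
      by rewrite ler_wpM2l ?vN// mulr_ge0// ltW.
    rewrite (le_trans (nrmBD _ _))// nrmZ mulrDl mul1r lerD//.
      by rewrite ler_wpM2l ?normc_ge0// (le_trans h1).
    by rewrite (le_trans h2).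
  have -> : (normc c + 1) * ((normc a + 1) * C0 * N) * t `^ (- gamma) * expR (- w * t) * nrm u =
     (normc c + 1) * ((normc a + 1) * (C0 * Z * (N * nrm u))) by rewrite /Z; ring.
  by rewrite ler_pM ?normc_ge0 ?nrm_ge0// lerDl.
- move=> s t u s0 t0; rewrite (gen_comm hT gT)// (sgD hT) ?(ltW t0)//.
  rewrite !(J_comm nX hT M0 w0 bT)// ?(ltW t0)//.
  have hs := sg_bl hT s0; rewrite (blZ _ _ hs) (blB _ _ hs) (blZ _ _ hs) //.
Qed.

End extrapolation.

(** * The input part of the mild solution *)

Section convolution.
Context {R : realType}.
Notation mu := (@lebesgue_measure R).
Notation mset := (@measurable _ (measurableTypeR R)).
Notation pos := (`]0%R, +oo[%classic : set R).

Lemma within_lip (V : normedModType R[i]) (D D' : set R) (y : R -> V) (tau : R -> R) :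
  (forall t, D t -> D' (tau t)) -> (forall t s, `|tau t - tau s| <= `|t - s|) ->
  {within D', continuous y} -> {within D, continuous (fun t => y (tau t))}.
Proof.
move=> DD lip /within_nrmP cy; apply/within_nrmP => t Dt e e0.
have [d d0 hd] := cy _ (DD _ Dt) e e0; exists d => // s Ds ts.
by apply: hd; [exact: DD|exact: le_lt_trans ts].
Qed.

(** Compare through S(tau s) (y t): strong continuity handles the change of time, and the uniform
    bound [M] the change of vector. *)
Lemma sg_joint (E : completeNormedModType R[i]) (S : R -> E -> E) (M w : R)
    (D : set R) (y : R -> E) (tau : R -> R) :
  C0_semigroup S -> 0 < M -> 0 < w ->
  (forall t x, 0 <= t -> nrm (S t x) <= M * expR (- w * t) * nrm x) ->
  (forall t, D t -> 0 <= tau t) -> (forall t s, `|tau t - tau s| <= `|t - s|) ->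
  {within D, continuous y} -> {within D, continuous (fun t => S (tau t) (y t))}.
Proof.
move=> hS M0 w0 bS D0 lip /within_nrmP cy; apply/within_nrmP => t Dt e e0.
have e2 : 0 < e / 2 by rewrite divr_gt0.
have e2M : 0 < e / 2 / M by rewrite divr_gt0.
have [d1 d10 h1] := cy t Dt _ e2M.
have cS : {within `[0, +oo[, continuous (S^~ (y t))} by exact: (sg_cont hS M0 w0 bS).
move: cS => /within_nrmP/(_ (tau t)) cS.
have t0 : `[0, +oo[%classic (tau t) by rewrite /= in_itv/= andbT D0.
have [d2 d20 h2] := cS t0 _ e2.
exists (Num.min d1 d2); first by rewrite lt_min d10.
move=> s Ds; rewrite lt_min => /andP[s1 s2].
apply: (le_lt_trans (nrm_tri (S (tau s) (y t)) _ _)); rewrite [ltRHS]splitr; apply: ltrD.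
  by apply: h2; [rewrite /= in_itv/= andbT D0|exact: le_lt_trans s2].
have hs := sg_bl hS (D0 _ Ds); rewrite -(blB _ _ hs).
apply: (le_lt_trans (sg_le M0 w0 bS _ (D0 _ Ds))).
by rewrite -ltr_pdivlMl// mulrC; exact: h1.
Qed.

(** The mild solution integrates in s, while the kernel estimates are in the remaining time r = h -
    s. *)
Lemma is_rint_rev (V : normedModType R[i]) (f : R -> V) (h : R) v :
  is_rint f 0 h v -> is_rint (fun s => f (h - s)) 0 h v.
Proof.
move=> hf e e0; have [d d0 hd] := hf e e0; exists d => // n p xi p0 pn hp.
(* Cell i of the reversed partition is cell n - i - 1 of the original, which is why the tags are
   shifted by one. *)
pose p' i := h - p (n - i)%N; pose xi' i := h - xi (n - i.+1)%N.
have := hd n p' xi'; rewrite /p' subn0 subnn pn p0 subrr subr0.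
have H i : (i < n)%N -> h - p (n - i)%N <= xi' i <= h - p (n - i.+1)%N /\
    h - p (n - i.+1)%N - (h - p (n - i)%N) < d.
  move=> iN; have iN' : (n - i.+1 < n)%N by rewrite ltn_subrL (leq_ltn_trans _ iN).
  have e1 : (n - i = (n - i.+1).+1)%N by rewrite subnSK.
  have [/andP[a1 a2] a3] := hp _ iN'; rewrite /xi' e1; split.
    by rewrite !lerD2l !lerN2 a1 a2.
  by rewrite opprB addrC subrKA.
move=> /(_ erefl erefl H).
rewrite (reindex_inj rev_ord_inj) /=.
suff -> : \sum_(j < n) (h - p (n - (n - j.+1).+1)%N - (h - p (n - (n - j.+1))%N))%:C *: f (xi' (n - j.+1)%N) =
   \sum_(i < n) (p i.+1 - p i)%:C *: f (h - xi i) by [].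
apply: eq_bigr => i _; have iN := ltn_ord i.
have -> : (n - (n - i.+1).+1 = i)%N by rewrite subnSK// subKn// ltnW.
have -> : (n - (n - i.+1) = i.+1)%N by rewrite subKn.
congr (_%:C *: f _); first by ring.
by rewrite /xi' subnSK// subKn// ltnW.
Qed.

Lemma oc_bigcup (h : R) : 0 < h ->
  `]0%R, h]%classic = \bigcup_n `[h * n.+1%:R^-1, h]%classic.
Proof.
move=> h0; apply/seteqP; split => r /=; rewrite in_itv/=.
  move=> /andP[r0 rh]; have rh0 : 0 < r / h by rewrite divr_gt0.
  have [N _ hN] := near_infty_natSinv_lt (PosNum rh0).
  exists N => //=; rewrite in_itv/= rh andbT.
  have := hN N (leqnn N) => /= /ltW; rewrite ler_pdivlMr//.
  by rewrite mulrC.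
move=> [n _] /=; rewrite in_itv/= => /andP[r1 ->]; rewrite andbT.
by apply: lt_le_trans r1; rewrite mulr_gt0// invr_gt0.
Qed.

Lemma oc_exhaust_nd (h : R) : 0 < h ->
  nondecreasing_seq (fun n => `[h * n.+1%:R^-1, h]%classic : set R).
Proof.
move=> h0 m n mn; apply/subsetPset => r /=; rewrite !in_itv/= => /andP[r1 ->].
rewrite andbT (le_trans _ r1)// ler_pM2l// lef_pV2 ?posrE ?ltr0n// ler_nat ltnS//.
Qed.

Lemma ge0_Rint_subset (A : set R) (f : R -> R) : mset A -> A `<=` pos ->
  mu.-integrable pos (EFin \o f) -> (forall r, 0 < r -> 0 <= f r) ->
  \int[mu]_(r in A) f r <= \int[mu]_(r in pos) f r.
Proof.
move=> mA sA fi f0; have mJ : mset (pos `\` A) by apply: measurableD => //; exact: mpos.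
have posU : pos = A `|` (pos `\` A) by rewrite setDUK.
rewrite [X in _ <= \int[mu]_(r in X) _]posU Rintegral_setU//; first last.
- by apply/disj_setPS => y /= [yI []].
- by rewrite -posU.
by rewrite lerDl; apply: Rintegral_ge0 => s [ps _]; rewrite posE in ps; exact: f0.
Qed.

Variables (X : completeNormedModType R[i]) (nX : norming X) (T : R -> X -> X).
Hypothesis hT : C0_semigroup T.
Variables (M w : R).
Hypotheses (M0 : 0 < M) (w0 : 0 < w).
Hypothesis bT : forall t x, 0 <= t -> nrm (T t x) <= M * expR (- w * t) * nrm x.
Variables (Y : completeNormedModType R[i]) (nY : norming Y) (iota : X -> Y).
Hypotheses (iB : bounded_linear iota) (iI : injective iota).
Notation SY := (extrap_semigroup T iota).
Hypothesis cY : C0_semigroup SY.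
Hypothesis bY : forall t y, 0 <= t -> nrm (SY t y) <= M * expR (- w * t) * nrm y.
Variables (U : completeNormedModType R[i]) (B : U -> Y) (hB : bounded_linear B).
Variables (gamma CK : R) (K : R -> U -> X).
Hypotheses (g01 : 0 <= gamma < 1) (CK0 : 0 < CK) (hK : control_kernel T w iota gamma CK B K).

(** The integral exists as a Riemann integral in X_{-1} and as a weak integral of [K] in X, over (0,
    h] because of the singularity of [K] at 0. [iota] carries the second to a weak integral of the
    first integrand, so the two agree by uniqueness. *)
Lemma mild_spec (h : R) (u : R -> U) : 0 < h -> {within `[0, h], continuous u} ->
  exists psi : X, is_rint (fun s => SY (h - s) (B (u s))) 0 h (iota psi) /\
    pint `]0, h]%classic (fun r => K r (u (h - r))) psi.
Proof.
move=> h0 cu; have [k1 k2 k3 k4] := hK.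
have cur : {within `[0, h], continuous (fun r => u (h - r))}.
  apply: (@within_lip _ _ _ _ (fun r => h - r) _ _ cu).
    by move=> t /=; rewrite !in_itv/= subr_ge0 gerBl andbC.
  by move=> t s; rewrite opprB addrC subrKA distrC.
have [v [rv pv]] : exists v, is_rint (fun r => SY r (B (u (h - r)))) 0 h v /\
    pint `[0, h] (fun r => SY r (B (u (h - r)))) v.
  apply: rint_exists => //; first exact: ltW.
  apply: (@sg_joint _ SY M w `[0, h]%classic (fun r => B (u (h - r))) id cY M0 w0 bY) => //.
    by move=> t /=; rewrite in_itv/= => /andP[].
  move: cur => /subspace_continuousP cur; apply/subspace_continuousP => t Dt.
  exact: (bl_cvg hB (cur t Dt)).
have [psi hpsi] : exists psi, pint `]0, h]%classic (fun r => K r (u (h - r))) psi.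
  have [N hN] : exists N, forall s, 0 <= s <= h -> nrm (u s) <= N.
    have [c _ hc] := EVT_max (ltW h0) (nrm_within cu).
    by exists (nrm (u c)) => s sh; apply: hc; rewrite in_itv.
  have ig : mu.-integrable pos (EFin \o (fun r => CK * `|N| * (r `^ (- gamma) * expR (- w * r)))).
    by apply: pos_integrableZ; exact: integrable_pow_exp.
  have sub : `]0, h]%classic `<=` pos.
    by move=> r; rewrite posE /= in_itv/= => /andP[].
  have mI : mset `]0, h]%classic by exact: measurable_itv.
  have ig' := integrableS mpos mI sub ig.
  rewrite (oc_bigcup h0); rewrite (oc_bigcup h0) in ig'.
  apply: (pint_exists nX _ (oc_exhaust_nd h0) _ ig').
  - by move=> n; rewrite ler_piMr ?(ltW h0)// invf_le1 ?ler1n.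
  (* On [de, h] continuity follows from K(r) = T(r - de) K(de). *)
  - move=> n; set de := h * _; have de0 : 0 < de by rewrite mulr_gt0// invr_gt0.
    have c1 : {within `[de, h], continuous (fun r => T (r - de) (K de (u (h - r))))}.
      apply: (@sg_joint _ T M w `[de, h]%classic (fun r => K de (u (h - r))) (fun r => r - de)
        hT M0 w0 bT).
      + by move=> t /=; rewrite in_itv/= subr_ge0 => /andP[].
      + by move=> t s; rewrite opprB addrA subrK.
      + have sub2 : `[de, h]%classic `<=` `[0, h]%classic.
          by move=> r /=; rewrite !in_itv/= => /andP[r1 ->]; rewrite andbT (le_trans (ltW de0)).
        have := continuous_subspaceW sub2 cur => /subspace_continuousP c2.
        by apply/subspace_continuousP => t Dt; exact: (bl_cvg (k2 _ de0) (c2 t Dt)).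
    apply: within_ext c1 => r /=; rewrite in_itv/= => /andP[r1 _].
    by rewrite -k4 ?subrK// subr_ge0.
  - move=> t; rewrite -(oc_bigcup h0) /= in_itv/= => /andP[t0 th].
    apply: (le_trans (k3 _ _ t0)).
    have -> : CK * `|N| * (t `^ (- gamma) * expR (- w * t)) =
       CK * t `^ (- gamma) * expR (- w * t) * `|N| by ring.
    rewrite ler_wpM2l ?mulr_ge0 ?powR_ge0 ?expR_ge0 ?(ltW CK0)//.
    apply: le_trans (ler_norm N); apply: hN; rewrite subr_ge0 th gerBl; exact: ltW.
exists psi; split => //.
have mI : mset `]0, h]%classic by exact: measurable_itv.
have p1 : pint `]0, h]%classic (fun r => SY r (B (u (h - r)))) (iota psi).
  have := pint_map iB hpsi; apply: pint_ext mI _ => r /=; rewrite in_itv/= => /andP[r0 _].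
  by rewrite k1.
rewrite -(pint_uniq nY (pint_oc_of_cc pv) p1).
have := is_rint_rev rv; congr is_rint; apply/funext => s.
by rewrite subKr.
Qed.

Lemma control_admissible : C_admissible T iota B.
Proof.
move=> t u; rewrite le_eqVlt => /predU1P[<- _|t0 cu]; last first.
  by have [psi [h _]] := mild_spec t0 cu; exists psi.
(* At [t = 0] monotonicity squeezes every partition point to 0, so all Riemann sums vanish. *)
exists 0; rewrite (bl0 iB) => e e0; exists 1 => // n p xi p0 pn hp.
rewrite subr0 big1 ?nrm0// => i _.
have mono m : (m <= n)%N -> 0 <= p m.
  elim: m => [|m IH] mn; first by rewrite p0.
  have [/andP[a1 a2] _] := hp m mn; apply: (le_trans (IH (ltnW mn))); exact: le_trans a2.
have up m : (m <= n)%N -> p (n - m)%N <= 0.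
  elim: m => [|m IH] mn; first by rewrite subn0 pn.
  have [/andP[a1 a2] _] : p (n - m.+1)%N <= xi (n - m.+1)%N <= p (n - m.+1).+1 /\
     p (n - m.+1).+1 - p (n - m.+1)%N < 1.
    by apply: hp; rewrite ltn_subrL (leq_ltn_trans _ mn).
  by apply: le_trans (IH (ltnW mn)); rewrite -(subnSK mn); exact: le_trans a2.
have z m : (m <= n)%N -> p m = 0.
  move=> mn; apply/eqP; rewrite eq_le mono// andbT.
  by rewrite -(subKn mn) up// leq_subr.
by rewrite !z ?subrr ?scale0r// ltnW.
Qed.

Lemma mild_solutionE (h : R) (x : X) (u : R -> U) : 0 < h -> {within `[0, h], continuous u} ->
  exists2 psi, pint `]0, h]%classic (fun r => K r (u (h - r))) psi &
    mild_solution T iota B h x u = T h x + psi.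
Proof.
move=> h0 cu; have [psi [r1 p1]] := mild_spec h0 cu; exists psi => //.
rewrite /mild_solution (rintE (ltW h0) r1); congr (_ + _).
by rewrite /opinv /=; apply: xget_unique => // y; exact: iI.
Qed.

Variables (q CP cP : R) (P : R -> X -> X).
Hypotheses (q0 : 0 <= q) (CP0 : 0 < CP) (hP : frac_kernel T w q CP cP P) (p1 : q + gamma < 1).
Let p := q + gamma.

(* By the semigroup law P t (K r v) only depends on t + r, so split at the midpoint. *)
Lemma PK_le t r v : 0 < t -> 0 < r ->
  nrm (P t (K r v)) <= CP * CK * 2 `^ p * (t + r) `^ (- p) * expR (- w * (t + r)) * nrm v.
Proof.
move=> t0 r0; have [P1 P2 P3 P4 _] := hP; have [_ _ k3 k4] := hK.
pose m := (t + r) / 2; have m0 : 0 < m by rewrite divr_gt0// addr_gt0.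
(* The larger of [t] and [r] hands its excess over the midpoint to the other through the
   semigroup. *)
have e : P t (K r v) = P m (K m v).
  have [rm|mr] := leP m r.
    have -> : K r v = T (r - m) (K m v) by rewrite -k4 ?subr_ge0// subrK.
    by rewrite -P4 ?subr_ge0//; congr (P _ _); rewrite /m; field.
  have tm : 0 <= t - m.
    move: (mr); rewrite {1}/m ltr_pdivlMr// => h; rewrite subr_ge0 /m ler_pdivrMr//.
    by lra.
  have -> : P t (K r v) = P m (T (t - m) (K r v)) by rewrite -P4// subrK.
  by rewrite -k4//; congr (P _ (K _ _)); rewrite /m; field.
rewrite e; apply: (le_trans (P2 _ _ m0)).
apply: (le_trans (ler_wpM2l _ (k3 m v m0))).
  by rewrite !mulr_ge0 ?powR_ge0 ?expR_ge0 ?(ltW CP0).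
have hp : (t + r) `^ (- p) * 2 `^ p = m `^ (- q) * m `^ (- gamma).
  rewrite -powRD; last by rewrite (lt0r_neq0 m0) implybT.
  rewrite -opprD /m powRM ?invr_ge0 ?addr_ge0 ?(ltW t0) ?(ltW r0)//; congr (_ * _).
  by rewrite -powR_inv1// -powRrM mulN1r opprK.
have he : expR (- w * (t + r)) = expR (- w * m) * expR (- w * m).
  by rewrite -expRD; congr expR; rewrite /m; field.
rewrite le_eqVlt; apply/orP; left; apply/eqP.
have -> : CP * CK * 2 `^ p * (t + r) `^ (- p) * expR (- w * (t + r)) * nrm v =
  CP * CK * ((t + r) `^ (- p) * 2 `^ p) * expR (- w * (t + r)) * nrm v by ring.
rewrite hp he; ring.
Qed.

Let C2 := CP * CK * 2 `^ p.
Let gp := \int[mu]_(r in pos) (r `^ (- p) * expR (- w * r)).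

Let p01 : 0 <= p < 1. Proof. by rewrite /p p1 andbT addr_ge0//; case/andP: g01. Qed.

Let C20 : 0 <= C2. Proof. by rewrite !mulr_ge0 ?powR_ge0 ?(ltW CP0) ?(ltW CK0). Qed.

(** The first bound drops t in (t + r)^(-p) and integrates over r, the second drops r and gains the
    factor [h]. Their product bounds |P(t) psi|^2 by an integrable function of order h, although
    t^(-2 p) may fail to be integrable. *)
Lemma psi_le (h N : R) (u : R -> U) psi t : 0 < h -> 0 < t ->
  (forall s, 0 <= s <= h -> nrm (u s) <= N) ->
  pint `]0, h]%classic (fun r => K r (u (h - r))) psi ->
  nrm (P t psi) <= C2 * N * gp /\
  nrm (P t psi) <= C2 * N * h * (t `^ (- p) * expR (- w * t)).
Proof.
move=> h0 t0 hN hpsi; have [P1 _ _ _ _] := hP.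
have N0 : 0 <= N by apply: le_trans (hN 0 _); rewrite ?nrm_ge0// lexx ltW.
have mI : mset `]0, h]%classic by exact: measurable_itv.
have sub : `]0, h]%classic `<=` pos by move=> r; rewrite posE /= in_itv/= => /andP[].
have hm := pint_map (P1 _ t0) hpsi.
have ip := integrable_pow_exp p01 w0.
have ig : mu.-integrable pos (EFin \o (fun r => C2 * N * (r `^ (- p) * expR (- w * r)))).
  exact: pos_integrableZ.
have bd r : 0 < r -> r <= h -> nrm (P t (K r (u (h - r)))) <=
    C2 * N * ((t + r) `^ (- p) * expR (- w * (t + r))).
  move=> r0 rh; apply: (le_trans (PK_le _ t0 r0)); rewrite -/C2.
  have -> : C2 * N * ((t + r) `^ (- p) * expR (- w * (t + r))) =
    C2 * (t + r) `^ (- p) * expR (- w * (t + r)) * N by ring.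
  apply: ler_wpM2l; first by apply: mulr_ge0; rewrite ?expR_ge0//; apply: mulr_ge0; rewrite ?powR_ge0//; exact: C20.
  by apply: hN; rewrite subr_ge0 rh gerBl ltW.
have CN : 0 <= C2 * N by rewrite mulr_ge0.
have an s r : 0 < s -> s <= r -> r `^ (- p) * expR (- w * r) <= s `^ (- p) * expR (- w * s).
  move=> s0 sr; rewrite ler_pM ?powR_ge0 ?expR_ge0//.
    by apply: powR_N_anti => //; case/andP: p01.
  by rewrite ler_expR !mulNr lerN2 ler_pM2l.
split.
  apply: (@le_trans _ _ (\int[mu]_(r in `]0, h]) (C2 * N * (r `^ (- p) * expR (- w * r))))).
    apply: (pint_le nX mI hm); first exact: integrableS ig.
    move=> r /=; rewrite in_itv/= => /andP[r0 rh]; apply: (le_trans (bd r r0 rh)).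
    by rewrite ler_wpM2l// an// lerDr ltW.
  rewrite -RintegralZl//; apply: ge0_Rint_subset => //.
  by move=> r r0; apply: mulr_ge0 => //; rewrite mulr_ge0 ?powR_ge0 ?expR_ge0.
have := pint_le nX mI hm (integrable_cst_oc h (C2 * N * (t `^ (- p) * expR (- w * t)))).
rewrite Rint_cst_oc ?(ltW h0)// => H; apply: (le_trans (H _)).
  move=> r /=; rewrite in_itv/= => /andP[r0 rh]; apply: (le_trans (bd r r0 rh)).
  by rewrite ler_wpM2l// an// lerDl ltW.
by rewrite le_eqVlt; apply/orP; left; apply/eqP; ring.
Qed.

End convolution.

(** * The Lyapunov function *)

Section value_function.
Context {R : realType}.
Notation mu := (@lebesgue_measure R).
Notation mR := (measurableTypeR R).
Notation mset := (@measurable _ (measurableTypeR R)).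
Notation pos := (`]0%R, +oo[%classic : set R).

(* (f + g)^2 <= (1 + k) f^2 + (1 + 1/k) g^2 for all k > 0; optimise over k. *)
Lemma minkowski2 (D : set R) (f g h : R -> R) : mset D ->
  (forall t, D t -> 0 <= h t <= f t + g t) ->
  mu.-integrable D (EFin \o (fun t => f t ^+ 2)) ->
  mu.-integrable D (EFin \o (fun t => g t ^+ 2)) ->
  mu.-integrable D (EFin \o (fun t => h t ^+ 2)) ->
  Num.sqrt (\int[mu]_(t in D) h t ^+ 2) <=
  Num.sqrt (\int[mu]_(t in D) f t ^+ 2) + Num.sqrt (\int[mu]_(t in D) g t ^+ 2).
Proof.
move=> mD hfg fi gi hi.
set F := \int[mu]_(t in D) f t ^+ 2; set G := \int[mu]_(t in D) g t ^+ 2.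
have F0 : 0 <= F by apply: Rintegral_ge0 => t _; exact: sqr_ge0.
have G0 : 0 <= G by apply: Rintegral_ge0 => t _; exact: sqr_ge0.
have key k : 0 < k -> \int[mu]_(t in D) h t ^+ 2 <= (1 + k) * F + (1 + k^-1) * G.
  move=> k0; have i1 : mu.-integrable D (EFin \o (fun t => (1 + k) * f t ^+ 2)).
    by have := integrableZl mD (1 + k) fi.
  have i2 : mu.-integrable D (EFin \o (fun t => (1 + k^-1) * g t ^+ 2)).
    by have := integrableZl mD (1 + k^-1) gi.
  rewrite /F /G -!RintegralZl// -RintegralD//.
  apply: le_Rintegral => //; first exact: (integrableD mD i1 i2).
  move=> t /hfg /andP[h0 hle].
  have h1 : h t ^+ 2 <= (f t + g t) ^+ 2 by rewrite lerXn2r ?nnegrE// (le_trans h0).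
  apply: (le_trans h1).
  have : 0 <= k^-1 * (k * f t - g t) ^+ 2 by rewrite mulr_ge0 ?sqr_ge0// invr_ge0 ltW.
  have -> : k^-1 * (k * f t - g t) ^+ 2 =
     (1 + k) * f t ^+ 2 + (1 + k^-1) * g t ^+ 2 - (f t + g t) ^+ 2.
    by field; exact: lt0r_neq0.
  by rewrite subr_ge0.
set a := Num.sqrt F; set b := Num.sqrt G.
have a0 : 0 <= a by exact: sqrtr_ge0.
have b0 : 0 <= b by exact: sqrtr_ge0.
have aF : F = a ^+ 2 by rewrite sqr_sqrtr.
have bG : G = b ^+ 2 by rewrite sqr_sqrtr.
rewrite -[a + b]ger0_norm ?addr_ge0// -sqrtr_sqr ler_wsqrtr//.
(* The optimal weight is k = b / a; the shift by [d] keeps it meaningful when [a] or [b] is 0, and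
   [d] is small enough to cost at most [e]. *)
apply/ler_addgt0Pr => e e0; pose d := e / (a + b + 1).
have ab1 : 0 < a + b + 1 by rewrite ltr_wpDl// addr_ge0.
have d0 : 0 < d by rewrite divr_gt0.
have ad : 0 < a + d by rewrite ltr_wpDl.
have bd : 0 < b + d by rewrite ltr_wpDl.
have := key ((b + d) / (a + d)); rewrite divr_gt0// => /(_ isT) K.
apply: (le_trans K); rewrite aF bG invf_div.
have h1 : (b + d) / (a + d) * a ^+ 2 <= (b + d) * a.
  rewrite expr2 mulrA ler_wpM2r// mulrAC ler_pdivrMr// ler_wpM2l ?(ltW bd)// lerDl ltW//.
have h2 : (a + d) / (b + d) * b ^+ 2 <= (a + d) * b.
  rewrite expr2 mulrA ler_wpM2r// mulrAC ler_pdivrMr// ler_wpM2l ?(ltW ad)// lerDl ltW//.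
have h3 : d * (a + b) <= e.
  by rewrite /d mulrAC ler_pdivrMr// ler_wpM2l ?(ltW e0)// lerDl.
by rewrite !mulrDl !mul1r; nra.
Qed.

Variables (X : completeNormedModType R[i]) (T : R -> X -> X).
Hypothesis hT : C0_semigroup T.
Variables (M w : R).
Hypotheses (M0 : 0 < M) (w0 : 0 < w).
Hypothesis bT : forall t x, 0 <= t -> nrm (T t x) <= M * expR (- w * t) * nrm x.
Variables (q CP cP : R) (P : R -> X -> X).
Hypotheses (q0 : 0 <= q) (CP0 : 0 < CP) (cP0 : 0 < cP) (hP : frac_kernel T w q CP cP P).

Definition g2 x t := nrm (P t x) ^+ 2.
Definition Vf x := \int[mu]_(t in pos) g2 x t.

(** Near t one has P(r) x = T(r - t / 2) P(t / 2) x, so strong continuity of the semigroup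
    applies. *)
Lemma P_cont x : {within pos, continuous (P^~ x)}.
Proof.
have [_ _ P3 _ _] := hP.
apply/within_nrmP => t; rewrite posE => t0 e e0; pose s := t / 2.
have s0 : 0 < s by rewrite divr_gt0.
have st : s < t by rewrite ltr_pdivrMr// ltr_pMr// ltr1n.
have : {within `[0, +oo[, continuous (T^~ (P s x))} by exact: (sg_cont hT M0 w0 bT).
move=> /within_nrmP/(_ (t - s)) c.
have ts : `[0, +oo[%classic (t - s) by rewrite /= in_itv/= andbT subr_ge0 ltW.
have [d d0 hd] := c ts _ e0.
exists (Num.min d (t - s)); first by rewrite lt_min d0 subr_gt0.
move=> r r0; rewrite lt_min => /andP[h1 h2].
have sr : 0 <= r - s by move: h2; rewrite ltr_distlC => /andP[h2 _]; rewrite subr_ge0 ltW//; lra.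
have := hd (r - s); rewrite /= in_itv/= andbT => /(_ sr).
have -> : t - s - (r - s) = t - r by ring.
by move=> /(_ h1); rewrite -!P3 ?subrK// subr_ge0 ltW.
Qed.

Lemma g2_measurable x : @measurable_fun _ _ mR _ pos (g2 x).
Proof.
have : measurable_fun pos (fun t => nrm (P t x)).
  apply: subspace_continuous_measurable_fun => //.
  exact: nrm_within (@P_cont x).
move=> h; have h' : @measurable_fun _ _ mR _ pos (fun t => nrm (P t x)) by [].
exact: (measurable_funX 2 h').
Qed.

Lemma g2_ge0 x t : 0 <= g2 x t. Proof. exact: sqr_ge0. Qed.

Lemma g2_le x t : 0 < t -> g2 x t <= (CP * nrm x) ^+ 2 * (t `^ (- (2 * q)) * expR (- (2 * w) * t)).
Proof.
move=> t0; have [_ P2 _ _ _] := hP.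
have -> : (CP * nrm x) ^+ 2 * (t `^ (- (2 * q)) * expR (- (2 * w) * t)) =
    (CP * t `^ (- q) * expR (- w * t) * nrm x) ^+ 2.
  have -> : t `^ (- (2 * q)) = t `^ (- q) * t `^ (- q).
    by rewrite -powRD ?(lt0r_neq0 t0) ?implybT//; congr (_ `^ _); ring.
  have -> : expR (- (2 * w) * t) = expR (- w * t) * expR (- w * t).
    by rewrite -expRD; congr expR; ring.
  by ring.
by rewrite lerXn2r ?nnegrE ?nrm_ge0 ?P2// !mulr_ge0 ?powR_ge0 ?expR_ge0 ?nrm_ge0 ?(ltW CP0).
Qed.

Lemma g2_integrable_lt x : q < 2^-1 -> mu.-integrable pos (EFin \o g2 x).
Proof.
move=> q2; have qq : 0 <= 2 * q < 1 by rewrite mulr_ge0//=; lra.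
have w2 : 0 < 2 * w by rewrite mulr_gt0.
apply: (pos_integrable_le (@g2_measurable x) _ (pos_integrableZ ((CP * nrm x) ^+ 2) (integrable_pow_exp qq w2))).
by move=> s s0; rewrite ger0_norm ?g2_ge0// g2_le.
Qed.

Hypothesis iV : forall x, mu.-integrable pos (EFin \o g2 x).

Let Pbl t : 0 < t -> bounded_linear (P t). Proof. by case: hP => h _ _ _ _; exact: h. Qed.

Let ND (D : set R) x := Num.sqrt (\int[mu]_(t in D) g2 x t).

Let ND_tri D x y z : mset D -> D `<=` pos ->
  (forall t, 0 < t -> nrm (P t z) <= nrm (P t x) + nrm (P t y)) ->
  ND D z <= ND D x + ND D y.
Proof.
move=> mD sD H; have i u := integrableS mpos mD sD (iV u).
apply: (@minkowski2 D (fun t => nrm (P t x)) (fun t => nrm (P t y)) (fun t => nrm (P t z)) mD).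
- by move=> t /sD; rewrite posE nrm_ge0 => /H.
- exact: i.
- exact: i.
- exact: i.
Qed.

Let nP1 x y t : 0 < t -> nrm (P t x) <= nrm (P t y) + nrm (P t (x - y)).
Proof.
by move=> t0; rewrite (blB _ _ (Pbl t0)) -{1}(subrK (P t y) (P t x)) addrC nrmD.
Qed.

Let nP2 x y t : 0 < t -> nrm (P t (x - y)) <= nrm (P t x) + nrm (P t y).
Proof. by move=> t0; rewrite (blB _ _ (Pbl t0)) nrmBD. Qed.

Let Dn n : set R := `[n.+1%:R^-1, n.+1%:R]%classic.

Let mDn n : mset (Dn n). Proof. exact: measurable_itv. Qed.
Let sDn n : Dn n `<=` pos. Proof. by rewrite pos_bigcup; exact: bigcup_sup. Qed.

(** On [1/(n + 1), n + 1] the singularity t^(-2 q) is at most its value at the left end, so the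
    truncated norms are bounded even for q = 1/2. *)
Let ND_le n : exists2 C, 0 < C & forall x, ND (Dn n) x <= C * nrm x.
Proof.
pose m : R := n.+1%:R^-1; have m0 : 0 < m by rewrite invr_gt0.
pose E0 := m `^ (- (2 * q)); have E0' : 0 <= E0 by exact: powR_ge0.
pose L := \int[mu]_(t in pos) expR (- (2 * w) * t).
have w2 : 0 < 2 * w by rewrite mulr_gt0.
have ie := integrable_exp w2.
have L0 : 0 <= L by apply: Rintegral_ge0 => t _; exact: expR_ge0.
exists (Num.sqrt (L * E0 * CP ^+ 2) + 1); first by rewrite ltr_wpDl// sqrtr_ge0.
move=> x; rewrite mulrDl mul1r; apply: (@le_trans _ _ (Num.sqrt (L * E0 * CP ^+ 2) * nrm x)); last first.
  by rewrite lerDl nrm_ge0.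
have -> : Num.sqrt (L * E0 * CP ^+ 2) * nrm x = Num.sqrt (E0 * (CP * nrm x) ^+ 2 * L).
  have -> : E0 * (CP * nrm x) ^+ 2 * L = L * E0 * CP ^+ 2 * nrm x ^+ 2 by ring.
  rewrite [RHS]sqrtrM ?sqrtr_sqr ?(ger0_norm (nrm_ge0 x))//.
  exact: (mulr_ge0 (mulr_ge0 L0 E0') (sqr_ge0 CP)).
apply: ler_wsqrtr; rewrite /L -RintegralZl//.
have ig := pos_integrableZ (E0 * (CP * nrm x) ^+ 2) ie.
have k0 : 0 <= E0 * (CP * nrm x) ^+ 2 by rewrite mulr_ge0 ?sqr_ge0.
apply: (@le_trans _ _ (\int[mu]_(t in Dn n) (E0 * (CP * nrm x) ^+ 2 * expR (- (2 * w) * t)))).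
  apply: le_Rintegral => //.
  - exact: integrableS mpos (mDn n) (@sDn n) (iV x).
  - exact: integrableS mpos (mDn n) (@sDn n) ig.
  - move=> t; rewrite /Dn /= in_itv/= => /andP[mt _].
    have t0 : 0 < t by exact: lt_le_trans mt.
    apply: (le_trans (g2_le x t0)).
    have -> : E0 * (CP * nrm x) ^+ 2 * expR (- (2 * w) * t) =
      (CP * nrm x) ^+ 2 * (E0 * expR (- (2 * w) * t)) by ring.
    rewrite ler_wpM2l ?sqr_ge0// ler_wpM2r ?expR_ge0//.
    by apply: powR_N_anti => //; rewrite mulr_ge0.
apply: (ge0_Rint_subset (mDn n) (@sDn n) ig) => r _.
by rewrite mulr_ge0 ?expR_ge0.
Qed.

(* Uniform boundedness applied to the truncated norms; this covers q = 1/2, where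
   finiteness of W is only assumed pointwise. *)
Lemma Vf_bound : exists2 K, 0 < K & forall x, Vf x <= K * nrm x ^+ 2.
Proof.
have sub n x : \int[mu]_(t in Dn n) g2 x t <= Vf x.
  by apply: (ge0_Rint_subset (mDn n) (@sDn n) (iV x)) => r _; exact: g2_ge0.
have u1 n x y : ND (Dn n) x <= ND (Dn n) y + ND (Dn n) (x - y).
  by apply: (ND_tri (mDn n) (@sDn n)) => t; exact: nP1.
have u2 n x y : ND (Dn n) (x - y) <= ND (Dn n) x + ND (Dn n) y.
  by apply: (ND_tri (mDn n) (@sDn n)) => t; exact: nP2.
have u3 n (r : R) x : 0 < r -> ND (Dn n) (r%:C *: x) = r * ND (Dn n) x.
  move=> r0; rewrite /ND.
  have -> : \int[mu]_(t in Dn n) g2 (r%:C *: x) t = r ^+ 2 * \int[mu]_(t in Dn n) g2 x t.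
    rewrite -RintegralZl//; last exact: integrableS mpos (mDn n) (@sDn n) (iV x).
    apply: eq_Rintegral => t; rewrite inE => /sDn; rewrite posE => t0.
    by rewrite /g2 (blZ _ _ (Pbl t0)) nrmZr gtr0_norm// exprMn.
  by rewrite sqrtrM ?sqr_ge0// sqrtr_sqr gtr0_norm.
have u5 x : exists K, forall n, ND (Dn n) x <= K.
  by exists (Num.sqrt (Vf x)) => n; rewrite ler_wsqrtr.
have [K hK] := uniform_boundedness u1 u2 u3 ND_le u5.
exists (K ^+ 2 + 1); first by rewrite ltr_wpDl// sqr_ge0.
move=> x; apply/ler_addgt0Pr => e e0.
have iV' := iV x; rewrite pos_bigcup in iV'.
have := Rint_exhaust (@pos_exhaust_nd R) mDn iV'; rewrite -pos_bigcup.
move=> /cvgrPdist_lt/(_ e e0)[N _ hN].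
have := hN N (leqnn N) => /=; rewrite ltr_distlC => /andP[_ h].
have {}h : Vf x <= \int[mu]_(t in Dn N) g2 x t + e.
  by move: (hN N (leqnn N)); rewrite /= ltr_distl => /andP[_ /ltW].
apply: (le_trans h); rewrite lerD2r.
have D0 : 0 <= \int[mu]_(t in Dn N) g2 x t by apply: Rintegral_ge0 => t _; exact: g2_ge0.
rewrite -(sqr_sqrtr D0); apply: (@le_trans _ _ ((K * nrm x) ^+ 2)).
  by rewrite lerXn2r ?nnegrE ?sqrtr_ge0 ?hK// (le_trans _ (hK N x))// sqrtr_ge0.
by rewrite exprMn ler_wpM2r ?sqr_ge0// lerDl.
Qed.

Lemma Vf_ge0 x : 0 <= Vf x.
Proof. by apply: Rintegral_ge0 => t _; exact: g2_ge0. Qed.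

(** The square root of [Vf] is an L2 norm of P(t) x, hence subadditive, and is at most a multiple of
    |x|; so it is Lipschitz, and [Vf] is its square. *)
Lemma Vf_continuous : continuous Vf.
Proof.
have [K K0 hK] := Vf_bound.
have N1 x y : ND pos x <= ND pos y + ND pos (x - y).
  by apply: (ND_tri mpos) => // t; exact: nP1.
have NK x : ND pos x <= Num.sqrt K * nrm x.
  have -> : Num.sqrt K * nrm x = Num.sqrt (K * nrm x ^+ 2).
    by rewrite sqrtrM ?(ltW K0)// sqrtr_sqr ger0_norm ?nrm_ge0.
  by rewrite ler_wsqrtr//; exact: hK.
have VE x : Vf x = ND pos x * ND pos x by rewrite -expr2 sqr_sqrtr ?Vf_ge0.
move=> x; have c : ND pos y @[y --> x] --> ND pos x.
  apply/cvgrPdist_lt => e e0; have k0 : 0 < Num.sqrt K + 1 by rewrite ltr_wpDl// sqrtr_ge0.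
  have ek : 0 < e / (Num.sqrt K + 1) by rewrite divr_gt0.
  have /cvg_nrmP/(_ _ ek) : y @[y --> x] --> x by exact: cvg_id.
  apply: filterS => y; rewrite ltr_pdivlMr// => h.
  have kk z : nrm z * (Num.sqrt K + 1) < e -> ND pos z < e.
    apply: le_lt_trans; apply: (le_trans (NK z)).
    by rewrite mulrC ler_wpM2l ?nrm_ge0// lerDl.
  have b1 := kk _ h; have b2 : ND pos (y - x) < e by apply: kk; rewrite nrmB.
  rewrite ltr_norml; apply/andP; split.
    rewrite ltrNl opprB ltrBlDl; apply: (le_lt_trans (N1 y x)); by rewrite ltrD2l.
  by rewrite ltrBlDl; apply: (le_lt_trans (N1 x y)); rewrite ltrD2l.
have -> : Vf = (fun y => ND pos y * ND pos y) by apply/funext.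
exact: cvgM.
Qed.

(** The lower bound of [frac_kernel] transfers the size of T(r) x to P(r) x; this yields positivity
    as well as the rate of decrease. *)
Lemma g2_lower x h m : 0 < h -> (forall r, 0 < r <= h -> m <= nrm (T r x) ^+ 2) ->
  h * (m / cP ^+ 2) <= \int[mu]_(t in `]0, h]) g2 x t.
Proof.
move=> h0 hm; have [_ _ _ _ P5] := hP.
have mI : mset `]0, h]%classic by exact: measurable_itv.
have sI : `]0, h]%classic `<=` pos by move=> r; rewrite posE /= in_itv/= => /andP[].
rewrite -Rint_cst_oc ?(ltW h0)//; apply: le_Rintegral => //.
- exact: integrable_cst_oc.
- exact: integrableS mpos mI sI (iV x).
move=> r /=; rewrite in_itv/= => rh; have [r0 _] := andP rh.
rewrite ler_pdivrMr ?exprn_gt0//; apply: (le_trans (hm r rh)).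
have -> : g2 x r * cP ^+ 2 = (cP * nrm (P r x)) ^+ 2 by rewrite /g2; ring.
by rewrite lerXn2r ?nnegrE ?nrm_ge0 ?P5// mulr_ge0 ?nrm_ge0// ltW.
Qed.

Lemma T_near x e : 0 < e -> exists2 d, 0 < d &
  forall r, 0 < r < d -> nrm x ^+ 2 - e <= nrm (T r x) ^+ 2.
Proof.
move=> e0; have [_ _ _ /(_ x) c] := hT.
have c1 : nrm (T t x) @[t --> 0^'+] --> nrm x by exact: cvg_nrm c.
have c2 : nrm (T t x) ^+ 2 @[t --> 0^'+] --> nrm x ^+ 2.
  by under eq_fun do rewrite expr2; rewrite expr2; exact: cvgM.
have /cvgrPdist_lt/(_ e e0)[d /= d0 hd] := c2; exists d => // r /andP[r0 rd].
have := hd r; rewrite /= sub0r normrN gtr0_norm// => /(_ rd r0).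
by rewrite ltr_distl => /andP[_ h]; rewrite lerBlDr ltW.
Qed.

Lemma Vf_gt0 x : x != 0 -> 0 < Vf x.
Proof.
move=> x0; have nx := nrm_gt0 x0.
have e0 : 0 < nrm x ^+ 2 / 2 by rewrite divr_gt0// exprn_gt0.
have [d d0 hd] := T_near x e0.
have h0 : 0 < d / 2 by rewrite divr_gt0.
have L := @g2_lower x (d / 2) (nrm x ^+ 2 / 2) h0.
have mI : mset `]0, (d / 2)]%classic by exact: measurable_itv.
have sI : `]0, (d / 2)]%classic `<=` pos by move=> r; rewrite posE /= in_itv/= => /andP[].
have L2 : \int[mu]_(t in `]0, (d / 2)]) g2 x t <= Vf x.
  by apply: (ge0_Rint_subset mI sI (iV x)) => r _; exact: g2_ge0.
apply: lt_le_trans L2; apply: lt_le_trans (L _).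
  by rewrite mulr_gt0// divr_gt0// exprn_gt0.
move=> r /andP[r0 rh]; have := hd r; rewrite r0 (le_lt_trans rh); last first.
  by rewrite ltr_pdivrMr// ltr_pMr// ltr1n.
by move=> /(_ isT); apply: le_trans; lra.
Qed.

End value_function.

(** In the application [G] is |P(t) T(h) x|, [b] is |P(t) psi|, [f] is t^(-p) e^(- w t), and [H] is
    the loss over (0, h]. Young's inequality leaves H / (2 k) in front of [f]; as [k] exceeds the
    integral of [f], this costs at most H / 2 after integration. *)
Lemma young_step (R : realType) (G b c h f H k M gp : R) : 0 <= G -> 0 <= b -> 0 <= c ->
  0 < h -> 0 <= f -> 0 < k -> 0 < M -> b <= c * gp -> b <= c * h * f ->
  h * G ^+ 2 <= M ^+ 2 * H ->
  (G + b) ^+ 2 <= G ^+ 2 + f * (H / (2 * k) + 2 * k * M ^+ 2 * (h * c ^+ 2) + c ^+ 2 * gp * h).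
Proof.
move=> G0 b0 c0 h0 f0 k0 M0 b1 b2 hG.
have M2 : 0 < M ^+ 2 by rewrite exprn_gt0.
have s1 : b ^+ 2 <= f * (c ^+ 2 * gp * h).
  have -> : f * (c ^+ 2 * gp * h) = (c * gp) * (c * h * f) by ring.
  by rewrite expr2 ler_pM.
have s2 : 2 * G * b <= f * (2 * G * c * h).
  have -> : f * (2 * G * c * h) = 2 * G * (c * h * f) by ring.
  by rewrite ler_wpM2l// mulr_ge0.
have s3 : 2 * G * c * h <= H / (2 * k) + 2 * k * M ^+ 2 * (h * c ^+ 2).
  have t1 : h * G ^+ 2 / (2 * k * M ^+ 2) <= H / (2 * k).
    rewrite ler_pdivrMr ?mulr_gt0//.
    have -> : H / (2 * k) * (2 * k * M ^+ 2) = M ^+ 2 * H by field; exact: lt0r_neq0.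
    by [].
  have : 0 <= h * (G - 2 * k * M ^+ 2 * c) ^+ 2 / (2 * k * M ^+ 2).
    by apply: divr_ge0; [exact: (mulr_ge0 (ltW h0) (sqr_ge0 _))|exact: (mulr_ge0 (mulr_ge0 (ler0n R 2) (ltW k0)) (ltW M2))].
  have -> : h * (G - 2 * k * M ^+ 2 * c) ^+ 2 / (2 * k * M ^+ 2) =
    h * G ^+ 2 / (2 * k * M ^+ 2) - 2 * G * c * h + 2 * k * M ^+ 2 * (h * c ^+ 2).
    by field; rewrite !lt0r_neq0.
  by move: t1; lra.
have s4 : f * (2 * G * c * h) <= f * (H / (2 * k) + 2 * k * M ^+ 2 * (h * c ^+ 2)).
  by rewrite ler_wpM2l.
have -> : (G + b) ^+ 2 = G ^+ 2 + (2 * G * b + b ^+ 2) by ring.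
rewrite lerD2l mulrDr; apply: lerD => //; exact: le_trans s4.
Qed.

Lemma limf_esup_le (R : realType) (f : R -> R) (l C : R) : 0 < C ->
  (forall e : R, 0 < e -> \forall h \near 0^'+, f h <= l + C * e) ->
  (limf_esup (fun h => (f h)%:E) 0^'+ <= l%:E)%E.
Proof.
move=> C0 hf; apply/lee_addgt0Pr => e e0.
have eC : 0 < e / C by rewrite divr_gt0.
have hn := hf _ eC; rewrite limf_esupE; apply: ge_ereal_inf.
exists (ereal_sup ((fun h => (f h)%:E) @` [set h | f h <= l + C * (e / C)])); first by eexists; [exact: hn|].
apply: ge_ereal_sup => _ [h /= hh <-]; rewrite -EFinD lee_fin.
by move: hh; rewrite mulrCA mulfV ?mulr1// lt0r_neq0.
Qed.

Lemma Kinfty_sqr (R : realType) (K : R) : 0 < K -> class_Kinfty (fun r => K * r ^+ 2).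
Proof.
move=> K0; split.
- apply: continuous_subspaceT => r; apply: cvgM; first exact: cvg_cst.
  by under eq_fun do rewrite expr2; rewrite expr2; apply: cvgM; exact: cvg_id.
- move=> r s r0 rs; rewrite ltr_pM2l// ltrXn2r// ?nnegrE//.
- by rewrite expr0n/= mulr0.
- apply/cvgryPge => A; near=> r.
  have r1 : 1 <= r by near: r; apply: nbhs_pinfty_ge; rewrite num_real.
  have rA : A / K <= r by near: r; apply: nbhs_pinfty_ge; rewrite num_real.
  have r0 : 0 <= r by exact: le_trans r1.
  move: rA; rewrite ler_pdivrMr// => rA; apply: (le_trans rA).
  by rewrite mulrC ler_wpM2l ?(ltW K0)// expr2 ler_peMl.
Unshelve. all: by end_near. Qed.

(** * Decrease along mild solutions *)

Section decay.
Context {R : realType}.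
Notation mu := (@lebesgue_measure R).
Notation mset := (@measurable _ (measurableTypeR R)).
Notation pos := (`]0%R, +oo[%classic : set R).
Variables (X : completeNormedModType R[i]) (nX : norming X) (T : R -> X -> X).
Hypothesis hT : C0_semigroup T.
Variables (M w : R).
Hypotheses (M0 : 0 < M) (w0 : 0 < w).
Hypothesis bT : forall t x, 0 <= t -> nrm (T t x) <= M * expR (- w * t) * nrm x.
Variables (Y : completeNormedModType R[i]) (iota : X -> Y).
Variables (U : completeNormedModType R[i]) (B : U -> Y).
Variables (gamma CK : R) (K : R -> U -> X).
Hypotheses (g01 : 0 <= gamma < 1) (CK0 : 0 < CK) (hK : control_kernel T w iota gamma CK B K).
Variables (q CP cP : R) (P : R -> X -> X).
Hypotheses (q0 : 0 <= q) (CP0 : 0 < CP) (cP0 : 0 < cP) (hP : frac_kernel T w q CP cP P)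
  (p1 : q + gamma < 1).
Hypothesis iV : forall x, mu.-integrable pos (EFin \o g2 P x).
Hypothesis mild : forall (h : R) (x : X) (u : R -> U), 0 < h -> {within `[0, h], continuous u} ->
  exists2 psi, pint `]0, h]%classic (fun r => K r (u (h - r))) psi &
    mild_solution T iota B h x u = T h x + psi.
Let p := q + gamma.
Let C2 := CP * CK * 2 `^ p.
Let gp := \int[mu]_(r in pos) (r `^ (- p) * expR (- w * r)).
(** A bound for [gp] that is certainly positive, as it appears in a denominator. *)
Let k := gp + 1.
(** The coefficient of h N^2 in [Q * k] of [Vf_step], with [gp] enlarged to [k]. *)
Let C3 := C2 ^+ 2 * (2 * k ^+ 2 * M ^+ 2 + k ^+ 2).

Let p01 : 0 <= p < 1. Proof. by rewrite /p p1 andbT addr_ge0//; case/andP: g01. Qed.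
Let gp0 : 0 <= gp.
Proof. by apply: Rintegral_ge0 => t _; rewrite mulr_ge0 ?powR_ge0 ?expR_ge0. Qed.
Let k0 : 0 < k. Proof. by rewrite ltr_wpDl. Qed.

(** The semigroup law moves T(h) into the time argument, leaving the integral over (h, oo). *)
Lemma Vf_shift h x : 0 < h -> Vf P (T h x) = Vf P x - \int[mu]_(t in `]0, h]) g2 P x t.
Proof.
move=> h0; have [_ _ _ P4 _] := hP.
have mI : mset `]0, h]%classic by exact: measurable_itv.
have mJ : mset `]h, +oo[%classic by exact: measurable_itv.
have posU : pos = `]0, h]%classic `|` `]h, +oo[%classic.
  apply/seteqP; split=> y /=; rewrite !in_itv/= ?andbT.
    by move=> ->; case: (leP y h) => yh; [left|right].
  by move=> [/andP[]//|]; exact: lt_trans.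
have e1 : Vf P x = \int[mu]_(t in `]0, h]) g2 P x t + \int[mu]_(t in `]h, +oo[) g2 P x t.
  rewrite /Vf posU Rintegral_setU//; first by rewrite -posU.
  by apply/disj_setPS => y /= []; rewrite !in_itv/= => /andP[_ h1] /andP[h2 _]; move: h2; rewrite ltNge h1.
rewrite e1 addrAC subrr add0r -(translation (ltW h0) (iV x)) /Vf.
by apply: eq_Rintegral => t; rewrite inE posE => t0; rewrite /g2 addrC P4// ltW.
Qed.

(* With G the L2-mean of t |-> P t x over (0, h], one has |P (t + h) x| <= M G, so the
   cross term is absorbed by half of the loss h G^2. *)
Lemma Vf_step (h N : R) (x : X) (u : R -> U) psi : 0 < h ->
  (forall s, 0 <= s <= h -> nrm (u s) <= N) ->
  pint `]0, h]%classic (fun r => K r (u (h - r))) psi ->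
  Vf P (T h x + psi) <= Vf P x - (\int[mu]_(t in `]0, h]) g2 P x t) / 2 + C3 * h * N ^+ 2.
Proof.
move=> h0 hN hpsi; have [P1 _ P3 P4 _] := hP.
set H := \int[mu]_(t in `]0, h]) _.
have N0 : 0 <= N by apply: le_trans (hN 0 _); rewrite ?nrm_ge0// lexx ltW.
have C20 : 0 <= C2 by rewrite /C2 mulr_ge0 ?powR_ge0// mulr_ge0// ltW.
have H0 : 0 <= H by apply: Rintegral_ge0 => t _; exact: g2_ge0.
have mI : mset `]0, h]%classic by exact: measurable_itv.
have sI : `]0, h]%classic `<=` pos by move=> r; rewrite posE /= in_itv/= => /andP[].
have ip := integrable_pow_exp p01 w0.
pose Q := H / (2 * k) + 2 * k * M ^+ 2 * (h * (C2 * N) ^+ 2) + (C2 * N) ^+ 2 * gp * h.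
have iQ := pos_integrableZ Q ip.
have pw t : 0 < t -> g2 P (T h x + psi) t <=
    g2 P (T h x) t + Q * (t `^ (- p) * expR (- w * t)).
  move=> t0; have [b1 b2] := psi_le nX w0 g01 CK0 hK q0 CP0 hP p1 h0 t0 hN hpsi.
  have hG : h * nrm (P t (T h x)) ^+ 2 <= M ^+ 2 * H.
    have M2 : 0 < M ^+ 2 by rewrite exprn_gt0.
    rewrite -ler_pdivrMl// mulrCA -Rint_cst_oc ?(ltW h0)//; apply: le_Rintegral => //.
    - exact: integrable_cst_oc.
    - exact: integrableS mpos mI sI (iV x).
    move=> r /=; rewrite in_itv/= => /andP[r0 rh]; rewrite ler_pdivrMl//.
    have htr : 0 <= h + t - r by rewrite subr_ge0 (le_trans rh)// lerDl ltW.
    have -> : P t (T h x) = T (h + t - r) (P r x) by rewrite -P3// subrK P4// ltW.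
    have -> : M ^+ 2 * g2 P x r = (M * nrm (P r x)) ^+ 2 by rewrite /g2; ring.
    rewrite lerXn2r ?nnegrE ?nrm_ge0// ?mulr_ge0 ?nrm_ge0 ?(ltW M0)//.
    exact: (sg_le M0 w0 bT).
  have f0 : 0 <= t `^ (- p) * expR (- w * t) by rewrite mulr_ge0 ?powR_ge0 ?expR_ge0.
  have := young_step (nrm_ge0 (P t (T h x))) (nrm_ge0 (P t psi)) (mulr_ge0 C20 N0) h0 f0 k0 M0 b1 b2 hG.
  rewrite -/Q [_ * Q]mulrC; apply: le_trans; rewrite /g2 (bl_add _ _ (P1 _ t0)).
  by rewrite lerXn2r ?nnegrE ?nrm_ge0 ?nrmD// addr_ge0 ?nrm_ge0.
have iS := pos_integrableD (iV (T h x)) iQ.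
apply: (@le_trans _ _ (\int[mu]_(t in pos) (g2 P (T h x) t + Q * (t `^ (- p) * expR (- w * t))))).
  apply: (le_Rintegral mpos (iV _) iS) => t; rewrite posE; exact: pw.
rewrite RintegralD//; try exact: mpos; try exact: iV.
rewrite RintegralZl// -/gp -/(Vf P (T h x)) Vf_shift// -/H.
have gk : gp <= k by rewrite lerDl.
have q1 : Q * gp <= Q * k.
  have c0 : 0 <= (C2 * N) ^+ 2 by exact: sqr_ge0.
  have m0 : 0 <= M ^+ 2 by exact: sqr_ge0.
  rewrite ler_wpM2l// /Q addr_ge0// ?addr_ge0//.
  - by rewrite divr_ge0// mulr_ge0// ltW.
  - by apply: mulr_ge0; [apply: mulr_ge0 => //; rewrite mulr_ge0// ltW|rewrite mulr_ge0// ltW].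
  - by rewrite mulr_ge0 ?(ltW h0)// mulr_ge0.
have q2 : Q * k <= H / 2 + C3 * h * N ^+ 2.
  have -> : H / 2 + C3 * h * N ^+ 2 = Q * k + (C2 * N) ^+ 2 * h * (k * (k - gp)).
    by rewrite /Q /C3; field; exact: lt0r_neq0.
  rewrite lerDl; apply: mulr_ge0; first exact: (mulr_ge0 (sqr_ge0 _) (ltW h0)).
  by apply: mulr_ge0; [exact: ltW|rewrite subr_ge0].
have q3 := le_trans q1 q2.
apply: (le_trans (lerD (lexx _) q3)).
by rewrite le_eqVlt; apply/orP; left; apply/eqP; field.
Qed.

Lemma Vf_decay (x : X) (u : R -> U) : {within `[0, +oo[, continuous u} ->
  (limf_esup (fun h : R =>
      (h^-1 * (Vf P (mild_solution T iota B h x u) - Vf P x))%:E) 0^'+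
   <= (- (2 * cP ^+ 2)^-1 * nrm x ^+ 2 + (C3 + 1) * nrm (u 0) ^+ 2)%:E)%E.
Proof.
move=> cu; have c20 : 0 < 2 * cP ^+ 2 by rewrite mulr_gt0// exprn_gt0.
have C30 : 0 <= C3.
  by rewrite /C3 mulr_ge0 ?sqr_ge0// addr_ge0 ?sqr_ge0// mulr_ge0 ?sqr_ge0// mulr_ge0 ?sqr_ge0.
(* The coefficient of the error [e] has two sources: the lower bound for |T(r) x|^2 near r = 0, and
   the excess of N^2 over |u(0)|^2. *)
apply: (@limf_esup_le _ _ _ ((2 * cP ^+ 2)^-1 + (C3 + 1))).
  by rewrite addr_gt0 ?invr_gt0// ltr_wpDl.
(* A bound for |u| on a short interval whose square exceeds |u(0)|^2 by exactly [e], so that the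
   final estimate is linear in [e]. *)
move=> e e0; pose N := Num.sqrt (nrm (u 0) ^+ 2 + e).
have n0 := nrm_ge0 (u 0).
have NE : N ^+ 2 = nrm (u 0) ^+ 2 + e by rewrite sqr_sqrtr// addr_ge0 ?sqr_ge0// ltW.
have uN : nrm (u 0) < N.
  have : nrm (u 0) ^+ 2 < N ^+ 2 by rewrite NE ltrDl.
  by rewrite ltr_pXn2r// ?nnegrE ?sqrtr_ge0.
have [d1 d10 hd1] := T_near hT x e0.
move: (cu) => /within_nrmP/(_ 0); rewrite /= in_itv/= lexx => /(_ isT (N - nrm (u 0))).
rewrite subr_gt0 uN => /(_ isT)[d2 d20 hd2].
have d0 : 0 < Num.min d1 d2 by rewrite lt_min d10.
exists (Num.min d1 d2) => // h /=; rewrite sub0r normrN => hd h0; move: hd.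
rewrite gtr0_norm// lt_min => /andP[hh1 hh2].
have cuh : {within `[0, h], continuous u}.
  by apply: continuous_subspaceW cu => s /=; rewrite !in_itv/= andbT => /andP[].
have [psi hpsi ->] := mild x h0 cuh.
have hN s : 0 <= s <= h -> nrm (u s) <= N.
  move=> /andP[s0 sh]; have := hd2 s; rewrite in_itv/= andbT sub0r normrN ger0_norm// => /(_ s0).
  move=> /(_ (le_lt_trans sh hh2)) h1.
  have := nrmD (u 0) (u s - u 0); rewrite addrC subrK [nrm (u s - _)]nrmB => h2.
  by apply: (le_trans h2); rewrite -lerBrDl ltW.
have st := Vf_step x h0 hN hpsi.
have lo := @g2_lower R X T w q CP cP P cP0 hP iV x h (nrm x ^+ 2 - e) h0 _.
have {}lo : h * ((nrm x ^+ 2 - e) / cP ^+ 2) <= \int[mu]_(t in `]0, h]) g2 P x t.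
  by apply: lo => r /andP[r0 rh]; apply: hd1; rewrite r0 (le_lt_trans rh).
rewrite mulrC ler_pdivrMr//.
set H := \int[mu]_(t in _) _ in st lo.
have s1 : Vf P (T h x + psi) - Vf P x <= - H / 2 + C3 * h * N ^+ 2.
  by rewrite lerBlDl; apply: (le_trans st); rewrite -addrA mulNr.
have s2 : - H / 2 <= - (h * ((nrm x ^+ 2 - e) / cP ^+ 2)) / 2 by rewrite ler_pM2r// lerN2.
have s3 : C3 * h * N ^+ 2 <= (C3 + 1) * h * N ^+ 2.
  by rewrite ler_wpM2r ?sqr_ge0// ler_wpM2r ?(ltW h0)// lerDl.
apply: (le_trans s1); apply: (le_trans (lerD s2 s3)); rewrite NE.
rewrite le_eqVlt; apply/orP; left; apply/eqP; field.
exact: lt0r_neq0.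
Qed.

End decay.

Lemma fracpow_W (R : realType) (X : completeNormedModType R[i]) (T P : R -> X -> X) (q : R) :
  (forall t x, 0 < t -> fracpow (opN (generator T)) q (T t x) = P t x) ->
  forall x, W T q x = (\int[lebesgue_measure]_(t in `]0%R, +oo[) (g2 P x t)%:E)%E.
Proof.
move=> hF x; apply: eq_integral => t; rewrite inE posE => t0.
by rewrite hF.
Qed.

(** * The two ranges of q *)

Section main.
Context {R : realType}.
Notation mu := (@lebesgue_measure R).
Notation pos := (`]0%R, +oo[%classic : set R).
Variables (X U : completeNormedModType R[i]) (hX : hilbert X)
    (T : R -> X -> X) (hT : analytic_semigroup T) (hTs : exp_stable T)
    (Xm1 : completeNormedModType R[i]) (iota : X -> Xm1)
    (a : R[i]) (ha : resolvent_set (generator T) a)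
    (hXm1 : is_extrapolation_space (generator T) a iota).

Lemma W_finite (q : R) : 0 <= q < 2^-1 -> forall x, (W T q x < +oo)%E.
Proof.
move=> /andP[q0 q2] x; have nX := hilbert_norming hX; have [hC _] := hT.
have [M [w [C [M0 w0 C0 bT gT]]]] := analytic_rates nX hT hTs.
have q1 : 0 <= q < 1 by rewrite q0 (lt_trans q2)// invf_lt1// ltr1n.
have [P [CP [cP [CP0 cP0 hP hF]]]] := fracpow_kernel nX hC M0 w0 C0 bT gT q1.
rewrite (fracpow_W hF); apply: integrable_lty; first exact: mpos.
exact: (g2_integrable_lt hC M0 w0 bT q0 CP0 hP).
Qed.

(** Finiteness of W is taken as a hypothesis, so that the case q < 1/2, where it is proved, and the
    case q = 1/2, where it is assumed, share one argument. *)
Lemma W_Lyapunov (gamma q : R) : 0 <= gamma < 1 -> 0 <= q < 1 -> gamma + q < 1 ->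
  (forall x, (W T q x < +oo)%E) ->
  forall B : U -> Xm1, bounded_into_Xneg T iota gamma B ->
  L2_ISS_Lyapunov T iota B (fun x => fine (W T q x)).
Proof.
move=> g01 q01 gq fW B hB; have nX := hilbert_norming hX; have [hC _] := hT.
have [M [w [C [M0 w0 C0 bT gT]]]] := analytic_rates nX hT hTs.
have [P [CP [cP [CP0 cP0 hP hF]]]] := fracpow_kernel nX hC M0 w0 C0 bT gT q01.
have [Psi [PL PI PD PC PS]] := Psi_exists hC gT ha hXm1.
have [BB [K [CK [CK0 hK]]]] := kernel_exists nX hC M0 w0 C0 bT gT ha hXm1 PL PI PD PC PS g01 hB.
have iB := iota_bl ha hXm1; have iI := iota_inj ha hXm1.
have cY := extrap_C0 hC gT ha PL PI PD PC PS.
have bY := extrap_bound hC bT gT ha PL PI PD PC PS.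
have nY := extrap_norming nX PL PI PS.
have q0 : 0 <= q by case/andP: q01.
have p1 : q + gamma < 1 by rewrite addrC.
have iV x : mu.-integrable pos (EFin \o g2 P x).
  apply/integrableP; split.
    apply/measurable_EFinP; exact: (g2_measurable hC M0 w0 bT hP).
  rewrite (le_lt_trans _ (fW x))// (fracpow_W hF) le_eqVlt; apply/orP; left; apply/eqP.
  by apply: eq_integral => t _; rewrite /= ger0_norm ?g2_ge0.
have EV : (fun x => fine (W T q x)) = Vf P.
  by apply/funext => x; rewrite (fracpow_W hF).
rewrite EV; split.
- exact: (control_admissible nX hC M0 w0 bT nY iB cY bY BB g01 CK0 hK).
- exact: (@Vf_continuous _ _ _ _ w0 _ _ _ _ q0 CP0 hP iV).
- exact: Vf_ge0.
- have [K0 K00 hK0] := Vf_bound w0 q0 CP0 hP iV.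
  exists (fun r => K0 * r ^+ 2); first exact: Kinfty_sqr.
  by move=> x x0; rewrite hK0 andbT; exact: (Vf_gt0 hC cP0 hP iV).
- have mild (h : R) (x : X) (u : R -> U) := mild_solutionE nX hC M0 w0 bT nY iB iI cY bY BB g01 CK0 hK (h := h) x (u := u).
  have D := Vf_decay nX hC M0 w0 bT g01 CK0 hK q0 CP0 cP0 hP p1 iV mild.
  eexists; eexists; split; last first.
  + by move=> x u cu; exact: D.
  + apply: ltr_wpDl => //; rewrite mulr_ge0 ?sqr_ge0// addr_ge0 ?sqr_ge0//.
    by rewrite mulr_ge0 ?sqr_ge0// mulr_ge0 ?sqr_ge0.
  + by rewrite invr_gt0 mulr_gt0// exprn_gt0.
Qed.

End main.

Theorem theorem3 (R : realType) (X U : completeNormedModType R[i])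
    (hX : hilbert X)
    (T : R -> X -> X) (hT : analytic_semigroup T) (hTs : exp_stable T)
    (Xm1 : completeNormedModType R[i]) (iota : X -> Xm1)
    (a : R[i]) (ha : resolvent_set (generator T) a)
    (hXm1 : is_extrapolation_space (generator T) a iota) :
  (forall gamma q : R,
      0 <= gamma < 1 -> 0 <= q < 2^-1 -> gamma + q < 1 ->
      forall B : U -> Xm1, bounded_into_Xneg T iota gamma B ->
        (forall x : X, (W T q x < +oo)%E) /\
        L2_ISS_Lyapunov T iota B (fun x => fine (W T q x)))
  /\
  ((forall x : X, (W T 2^-1 x < +oo)%E) ->
    forall gamma : R, 0 <= gamma < 2^-1 ->
    forall B : U -> Xm1, bounded_into_Xneg T iota gamma B ->
      L2_ISS_Lyapunov T iota B (fun x => fine (W T 2^-1 x))).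
Proof.
have h1 : 2^-1 < 1 :> R by rewrite invf_lt1// ltr1n.
split.
  move=> gamma q g01 q01 gq B hB; have fW := W_finite hX hT hTs q01.
  split; first exact: fW.
  apply: (W_Lyapunov hX hT hTs ha hXm1 g01 _ gq fW hB).
  by case/andP: q01 => -> /lt_trans ->.
move=> fW gamma /andP[g0 g2] B hB.
apply: (W_Lyapunov hX hT hTs ha hXm1 _ _ _ fW hB).
- by rewrite g0 (lt_trans g2).
- by rewrite invr_ge0 ler0n.
- by rewrite [ltRHS]splitr mul1r ltrD2r.
Qed.
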